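(* Let $a>0$, $L>0$, $\lambda>0$, $k_b\in\mathbb{N}$, $p,r\in\mathbb{N}$, an integer $k\ge 1$ and real numbers $a_{-r},\dots,a_p$ be fixed such that $a_{-r}\,a_p\neq 0$ and $$\forall\, m=0,\dots,k,\quad \sum_{\ell=-r}^p \ell^m a_\ell=(-\lambda a)^m,\qquad \sup_{\theta\in[0,2\pi]}\Big|\sum_{\ell=-r}^p a_\ell\, e^{i\ell\theta}\Big|\le 1 .$$ Then there exists a constant $C>0$ such that for any final time $T\ge 1$, any integer $J\ge 1$ with $J\ge k_b-r$, and any data $f\in H^{k+1}((0,L))$ and $g\in H^{k+1}((0,T))$ satisfying the compatibility requirements $$\forall\, m=0,\dots,k,\quad f^{(m)}(0)=(-a)^{-m}\,g^{(m)}(0),$$ the following holds. Set $\Delta x=L/J$, $\Delta t=\lambda\Delta x$, $x_j=j\Delta x$, $t^n=n\Delta t$, and let $(u_j^n)$, for $1-r\le j\le J+p$ and integers $0\le n\le T/\Delta t$, be the solution to the scheme $$\begin{cases} u_j^0=\dfrac{1}{\Delta x}\displaystyle\int_{x_{j-1}}^{x_j} f(x)\,dx, & 1\le j\le J,\\[2mm] u_\ell^n=\displaystyle\sum_{\kappa=0}^{k-1}\frac{\Delta x^\kappa}{(\kappa+1)!\,(-a)^\kappa}\big(\ell^{\kappa+1}-(\ell-1)^{\kappa+1}\big)\,g^{(\kappa)}(t^n), & 0\le n\le T/\Delta t,\ \ \ell=1-r,\dots,0,\\[2mm] (D_-^{k_b}u^n)_{J+\ell}=0, & 0\le n\le T/\Delta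 t,\ \ \ell=1,\dots,p,\\[1mm] u_j^{n+1}=\displaystyle\sum_{\ell=-r}^p a_\ell\,u_{j+\ell}^n, & 0\le n\le T/\Delta t-1,\ \ 1\le j\le J. \end{cases}$$ Then $$\sup_{0\le n\le T/\Delta t}\ \sup_{1\le j\le J}\left|u_j^n-\frac{1}{\Delta x}\int_{x_{j-1}}^{x_j}u(t^n,x)\,dx\right|\le C\,T\,e^{CT/L}\,\Delta x^{\min(k,k_b)-1/2}\big(\|f\|_{H^{k+1}((0,L))}+\|g\|_{H^{k+1}((0,T))}\big),$$ where $u$ is the exact solution of the transport problem $\partial_t u+a\,\partial_x u=0$ on $x\in(0,L)$, with $u(0,x)=f(x)$ and $u(t,0)=g(t)$, that is, $u(t,x)=f(x-at)$ if $x\ge at$ and $u(t,x)=g(t-x/a)$ if $x\le at$.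
   Context: $\mathbb{N}$ contains $0$. $D_-$ is the backward difference operator acting on sequences indexed by $j$: $(D_-v)_j=v_j-v_{j-1}$; $D_-^m$ denotes its $m$-th iterate ($D_-^0$ is the identity). The conditions $(D_-^{k_b}u^n)_{J+\ell}=0$, $\ell=1,\dots,p$, successively determine the ghost values $u_{J+1}^n,\dots,u_{J+p}^n$ in terms of values $u_j^n$ with smaller index (they read $u^n_{J+\ell}=0$ if $k_b=0$, and there is no such condition if $p=0$). The constant $C$ may depend on $a,L,\lambda,k_b,k,p,r$ and the coefficients $a_\ell$, but not on $T,J,f,g$. Pointwise values of derivatives such as $f^{(m)}(0)$, $g^{(m)}(0)$, $g^{(\kappa)}(t^n)$ are those of the continuous representatives given by Sobolev embedding. $H^s$ are the usual $L^2$-based Sobolev spaces. *)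

(* Defs.v *)
From HB Require Import structures.
From mathcomp Require Export all_boot all_order all_algebra.
From mathcomp Require Export complex.
From mathcomp Require Export all_classical all_reals all_analysis.
Export Order.TTheory GRing.Theory Num.Theory.
Export numFieldNormedType.Exports.

Set Implicit Arguments.
Unset Strict Implicit.
Unset Printing Implicit Defensive.

Local Open Scope classical_set_scope.
Local Open Scope ring_scope.

Section Sobolev.
Context {R : realType}.
Local Notation mu := (@lebesgue_measure R).

Definition test_function (a b : R) (phi : R -> R) : Prop :=
  (forall (m : nat) (x : R), derivable (derive1n m phi) x 1) /\
  exists K : set R, [/\ compact K, K `<=` `]a, b[ &
                        forall x, ~ K x -> phi x = 0].

(* Local integrability makes both integrals below genuine (never the default
   value of the integral of a non-integrable function). *)
Definition is_weak_derivative (a b : R) (m : nat) (f w : R -> R) : Prop :=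
  [/\ locally_integrable `]a, b[ f, locally_integrable `]a, b[ w &
   forall phi, test_function a b phi ->
     \int[mu]_(x in `]a, b[) (f x * derive1n m phi x) =
     (-1) ^+ m * \int[mu]_(x in `]a, b[) (w x * phi x)].

Definition square_integrable (a b : R) (w : R -> R) : Prop :=
  measurable_fun `]a, b[ w /\ finite_norm mu 2%:E (w \_ `]a, b[).

(* H^s((a, b)); functions R -> R stand for their class modulo a.e. equality on
   ]a, b[, their values elsewhere are irrelevant. *)
Definition sobolev (a b : R) (s : nat) (f : R -> R) : Prop :=
  forall m, (m <= s)%N ->
    exists2 w, is_weak_derivative a b m f w & square_integrable a b w.

(* The weak derivative, unique up to a.e. equality when it exists. *)
Definition weak_derivative (a b : R) (m : nat) (f : R -> R) : R -> R :=
  xget (cst 0) [set w | is_weak_derivative a b m f w].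

Definition sobolev_norm (a b : R) (s : nat) (f : R -> R) : R :=
  Num.sqrt (\sum_(m < s.+1)
    fine ('N[mu]_2%:E[EFin \o (weak_derivative a b m f \_ `]a, b[)]) ^+ 2).

(* The continuous representative on the closed interval, unique there when
   a < b. *)
Definition continuous_representative (a b : R) (w : R -> R) : R -> R :=
  xget (cst 0) [set v : R -> R | {within `[a, b], continuous v} /\
                        ae_eq mu `]a, b[%classic v w].

(* For f in H^s((a, b)) and m < s: the pointwise value f^(m)(x), x in [a, b]. *)
Definition pointwise_derivative (a b : R) (m : nat) (f : R -> R) : R -> R :=
  continuous_representative a b (weak_derivative a b m f).

End Sobolev.

Section Scheme.
Context {R : realType}.
Local Notation mu := (@lebesgue_measure R).

Definition stencil_sum (V : nmodType) (r p : nat) (F : int -> V) : V :=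
  \sum_(i < (r + p).+1) F (i%:Z - r%:Z).

Definition expi (theta : R) : R[i] := (cos theta +i* sin theta)%C.

Definition Dminus (v : int -> R) : int -> R := fun j => v j - v (j - 1).

Definition cell_average (dx : R) (j : int) (h : R -> R) : R :=
  dx^-1 * \int[mu]_(x in `[(j - 1)%:~R * dx, j%:~R * dx]) h x.

Definition transport_solution (a : R) (f g : R -> R) (t x : R) : R :=
  if a * t <= x then f (x - a * t) else g (t - x / a).

(* u n j is the value at time level n and cell j; only the values with
   1 - r <= j <= J + p and n * dt <= T are constrained. *)
Definition is_scheme_solution (a L lambda : R) (kb k p r : nat)
    (al : int -> R) (T : R) (J : nat) (f g : R -> R) (u : nat -> int -> R)
    : Prop :=
  let dx := L / J%:R in
  let dt := lambda * dx in
  [/\ forall j : int, 1 <= j <= J%:Z -> u 0%N j = cell_average dx j f,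
      forall (n : nat) (l : int), n%:R * dt <= T -> 1 - r%:Z <= l <= 0 ->
        u n l = \sum_(0 <= kappa < k)
          dx ^+ kappa / ((kappa.+1)`!%:R * (- a) ^+ kappa)
          * (l ^+ kappa.+1 - (l - 1) ^+ kappa.+1)%:~R
          * pointwise_derivative 0 T kappa g (n%:R * dt),
      forall (n : nat) (l : int), n%:R * dt <= T -> 1 <= l <= p%:Z ->
        iter kb Dminus (u n) (J%:Z + l) = 0 &
      forall (n : nat) (j : int), n.+1%:R * dt <= T -> 1 <= j <= J%:Z ->
        u n.+1 j = stencil_sum r p (fun l => al l * u n (j + l))].

End Scheme.

(* Main.v *)
Require Import Defs.
From mathcomp Require Import zify ring lra measurable_realfun.

(** The error at the level [n] is measured against the exact cell averages, and
    the estimate combines a stability bound for the scheme with boundary values,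
    in the discrete energy norm, and a consistency bound. A single value is
    bounded by the sum of squares over the cells without the weight [dx] that an
    integral would carry; this costs half a power of [dx].

    Stability. By Parseval's identity the bound on the symbol makes the spatial
    operator a contraction for square summable sequences on the whole line
    ([step_op_contraction]). The energy in the interior cells can then grow only
    through the ghost values. Those on the inflow side are data, but those on the
    outflow side are tied to the solution by an extrapolation of order [kb], and
    the point is to bound them by the data in square mean over time
    ([ghost_values_bound]). The
    contraction property, applied to well-chosen prolongations of the solution
    beyond the outflow boundary, gives two inequalities for one time step. With
    the prolongation by zero, the energy that leaks out of the domain controls
    the trace, provided that the ghost values are under control
    ([boundary_step_dirichlet]); this uses that the coefficient [al (- r)] does
    not vanish. With a prolongation that decreases very slowly, a nearly constant
    trace loses energy at the rate of the transport, whose speed is positive by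
    the first moment of the coefficients ([boundary_step_neumann]). The first
    inequality, applied to the backward difference of order [kb] of the solution,
    bounds its trace; the second one lowers the order one by one, since a trace
    is nearly constant as soon as its difference is controlled
    ([outflow_trace_step]). Both are used for sequences that vanish near the
    inflow boundary. This is achieved by a window with a slope of order [1 / J],
    which creates source terms of relative size [1 / J] per time step; together
    with the weights used to absorb the residual, they produce the exponential
    factor of the estimate ([stability]).

    Consistency. The compatibility conditions say that the function equal to [f]
    on the right of the origin and to [g (- y / a)] on its left is as regular as
    the data, so the exact solution is a translate of one profile on the line.
    The pointwise derivatives of the data are those of the continuous
    representatives; this rests on the fundamental lemma of the calculus of
    variations ([weak_derivative_of_zero]), which makes weak derivatives unique,
    and on the primitive of a weak derivative ([weak_representative]). In this
    way the profile is given by a tower of functions, each the derivative of the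
    preceding one, with a primitive of the profile at the bottom, and the exact
    cell averages are differences of values of this primitive ([exists_profile]).
    The top of the tower, the derivative of order [k] of the profile, is only a
    primitive of a square integrable function. It satisfies
    [(F z - F y) ^ 2 <= (z - y) * (P z - P y)] with [P] monotone and bounded by
    the squared norms of the data ([half_modulus]). Since the scheme is exact on
    polynomials of degree at most [k], Taylor's formula bounds the residual in a
    cell by [dx ^ k] times an increment of the top derivative, and the increments
    of [P] telescope over the cells ([residual_sum_bound]): the sum of the squares
    of the residual is of order [dx ^ (2 k + 1)]. The inflow ghost values have
    the accuracy [dx ^ k] ([inflow_bound]), and the exact averages satisfy the
    outflow condition up to [dx ^ min k kb] ([outflow_bound]).

    Inserted in the stability estimate, the squares of all these defects are of
    order [dx ^ (2 min k kb)] at each time step. Their sum over a number of steps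
    of order [T / dx] is the square of the asserted bound. *)

Set Implicit Arguments.
Unset Strict Implicit.
Unset Printing Implicit Defensive.

Local Open Scope classical_set_scope.
Local Open Scope ring_scope.

(** * Sums over windows of integers *)

Section WindowSums.
Context {V : nmodType}.
Implicit Types (F G U : int -> V) (s : int) (M : nat).

(** A window is given by its first index and its length, because windows get
    shifted and split: a shift leaves the length alone, and a splitting adds two
    lengths. *)
Definition wsum s M F  : V := \sum_(i < M) F (s + i%:Z).

Lemma wsum0 s F : wsum s 0 F = 0.
Proof. by rewrite /wsum big_ord0. Qed.

Lemma wsumSr s M F : wsum s M.+1 F = wsum s M F + F (s + M%:Z).
Proof. by rewrite /wsum big_ord_recr. Qed.

Lemma wsum_cat s M N F : wsum s (M + N) F = wsum s M F + wsum (s + M%:Z) N F.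
Proof.
elim: N => [|N IH]; first by rewrite addn0 wsum0 addr0.
by rewrite addnS !wsumSr IH addrA PoszD [s + (_ + _)]addrA.
Qed.

Lemma wsumSl s M F : wsum s M.+1 F = F s + wsum (s + 1) M F.
Proof. by rewrite -add1n wsum_cat wsumSr wsum0 add0r addr0. Qed.

Lemma eq_wsum s M F G : (forall j, s <= j < s + M%:Z -> F j = G j) ->
  wsum s M F = wsum s M G.
Proof.
move=> H; apply: eq_bigr => i _; apply: H; have := ltn_ord i; lia.
Qed.

Lemma wsum_eq0 s M F : (forall j, s <= j < s + M%:Z -> F j = 0) -> wsum s M F = 0.
Proof.
move=> H; apply: big1 => i _; apply: H; have := ltn_ord i; lia.
Qed.

Lemma wsumD s M F G : wsum s M (fun j => F j + G j) = wsum s M F + wsum s M G.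
Proof. by rewrite /wsum big_split. Qed.

Lemma wsum_shift s M l F : wsum s M (fun j => F (j + l)) = wsum (s + l) M F.
Proof. by apply: eq_bigr => i _; congr F; ring. Qed.

Lemma wsum_exchange (I : finType) s M (F : I -> int -> V) :
  wsum s M (fun j => \sum_i F i j) = \sum_i wsum s M (F i).
Proof. by rewrite /wsum exchange_big. Qed.

Lemma wsum_widen s M s' M' F : s' <= s -> s + M%:Z <= s' + M'%:Z ->
  (forall j, ~~ (s <= j < s + M%:Z) -> F j = 0) -> wsum s' M' F = wsum s M F.
Proof.
move=> h1 h2 Fs.
have [d hd] : exists d : nat, s = s' + d%:Z by exists `|s - s'|%N; lia.
have [e he] : exists e : nat, M' = (d + M + e)%N by exists (M' - (d + M))%N; lia.
rewrite he !wsum_cat -hd (@wsum_eq0 s') ?add0r ?(@wsum_eq0 _ e) ?addr0 //.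
  by move=> j hj; apply: Fs; lia.
by move=> j hj; apply: Fs; lia.
Qed.

End WindowSums.

Section Windows.
Context {R : realType}.
Implicit Types (F G U : int -> R) (s : int) (M : nat).

Lemma le_wsum s M F G : (forall j, s <= j < s + M%:Z -> F j <= G j) ->
  wsum s M F <= wsum s M G.
Proof.
move=> H; apply: ler_sum => i _; apply: H; have := ltn_ord i; lia.
Qed.

Lemma wsum_ge0 s M F : (forall j, s <= j < s + M%:Z -> 0 <= F j) -> 0 <= wsum s M F.
Proof.
move=> H; apply: sumr_ge0 => i _; apply: H; have := ltn_ord i; lia.
Qed.

Lemma wsumB s M F G : wsum s M (fun j => F j - G j) = wsum s M F - wsum s M G.
Proof. by rewrite /wsum sumrB. Qed.

Lemma wsumZ s M c F : wsum s M (fun j => c * F j) = c * wsum s M F.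
Proof. by rewrite /wsum mulr_sumr. Qed.

Lemma wsum_const s M (c : R) : wsum s M (fun=> c) = M%:R * c.
Proof. by rewrite /wsum sumr_const card_ord mulr_natl. Qed.

Lemma wsum_sub s M s' M' F : s <= s' -> s' + M'%:Z <= s + M%:Z ->
  (forall j, s <= j < s + M%:Z -> 0 <= F j) -> wsum s' M' F <= wsum s M F.
Proof.
move=> h1 h2 F0; have [d hd] : exists d : nat, s' = s + d%:Z.
  by exists `|s' - s|%N; lia.
have [e he] : exists e : nat, M = (d + M' + e)%N.
  by exists (M - (d + M'))%N; lia.
rewrite hd he !wsum_cat.
have h3 : 0 <= wsum s d F by apply: wsum_ge0 => j hj; apply: F0; lia.
have h4 : 0 <= wsum (s + (d + M')%N) e F by apply: wsum_ge0 => j hj; apply: F0; lia.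
lra.
Qed.

Lemma wsum_term s M j F : s <= j < s + M%:Z ->
  (forall i, s <= i < s + M%:Z -> 0 <= F i) -> F j <= wsum s M F.
Proof.
move=> hj F0.
have -> : F j = wsum j 1 F by rewrite wsumSr wsum0 add0r addr0.
by apply: wsum_sub => //; lia.
Qed.

Lemma wsum_supp s M s' M' F : (forall j, 0 <= F j) ->
  (forall j, ~~ (s <= j < s + M%:Z) -> F j = 0) -> wsum s' M' F <= wsum s M F.
Proof.
move=> F0 Fs.
pose a := Num.min s s'; pose b := Num.max (s + M%:Z) (s' + M'%:Z).
have [N hN] : exists N : nat, a + N%:Z = b by exists `|b - a|%N; lia.
apply: (@le_trans _ _ (wsum a N F)).
  by apply: wsum_sub => //; lia.
by rewrite (@wsum_widen _ s M) //; lia.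
Qed.

(** The difference of the two sides is half the sum of the squares of
    [x i * y j - x j * y i]. *)
Lemma sqr_sum_le n (x y : 'I_n -> R) :
  (\sum_i x i * y i) ^+ 2 <= (\sum_i x i ^+ 2) * (\sum_i y i ^+ 2).
Proof.
rewrite -subr_ge0.
suff -> : (\sum_i x i ^+ 2) * (\sum_i y i ^+ 2) - (\sum_i x i * y i) ^+ 2 =
  2^-1 * \sum_i \sum_j (x i * y j - x j * y i) ^+ 2.
  by apply: mulr_ge0 => //; apply: sumr_ge0 => i _; apply: sumr_ge0 => j _; apply: sqr_ge0.
have -> : \sum_i \sum_j (x i * y j - x j * y i) ^+ 2 =
   \sum_i \sum_j (x i ^+2 * y j ^+2) + \sum_i \sum_j (x j ^+2 * y i ^+2)
   - 2 * \sum_i \sum_j ((x i * y i) * (x j * y j)).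
  rewrite mulr_sumr -big_split -sumrB /=; apply: eq_bigr => i _.
  rewrite mulr_sumr -big_split -sumrB /=; apply: eq_bigr => j _; ring.
have E (f g : 'I_n -> R) : \sum_i \sum_j (f i * g j) = (\sum_i f i) * (\sum_i g i).
  by rewrite mulr_suml; apply: eq_bigr => i _; rewrite mulr_sumr.
rewrite [X in _ + X - _]exchange_big /= !E expr2.
set p := \sum_i x i ^+ 2; set q := \sum_i y i ^+ 2; set t := \sum_i x i * y i.
by field.
Qed.

End Windows.

(** * The Fourier transform and the contraction property *)

Section Fourier.
Context {R : realType}.
Implicit Types (x y : R) (d s : int) (N : nat).

Lemma expiD x y : expi (x + y) = expi x * expi y.
Proof. by rewrite /expi cosD sinD; simpc; rewrite [cos x * sin y + _]addrC. Qed.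

Lemma expi0 : expi (0 : R) = 1.
Proof. by rewrite /expi cos0 sin0. Qed.

Lemma expiN x : expi (- x) = ((expi x)^*)%C.
Proof. by rewrite /expi cosN sinN. Qed.

Lemma expiMn x (n : nat) : expi (n%:R * x) = expi x ^+ n.
Proof.
elim: n => [|n IH]; first by rewrite mul0r expi0.
by rewrite exprS -IH -expiD -natr1; congr expi; ring.
Qed.

Lemma expi_neq1 x : 0 < x < 2 * pi -> expi x != 1.
Proof.
move=> hx; apply/eqP => -[hc _].
have hs : 0 < sin (x / 2) by apply: sin_gt0_pi; lra.
have := hc; have -> : x = (x / 2) *+ 2 by rewrite -mulr_natr; field.
rewrite cos_mulr2n => h.
have := cos2Dsin2 (x / 2); nra.
Qed.

(** The summands run through the powers of an [N]-th root of unity, which is not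
    1 when [d] is not a multiple of [N]. *)
Lemma expi_dft_sum N d : (0 < N)%N -> `|d| < N%:Z ->
  \sum_(m < N) expi (d%:~R * (m%:R * (2 * pi / N%:R)) : R) =
  if d == 0 then N%:R else 0.
Proof.
move=> N0 hd; have N0' : (N%:R : R) != 0 by rewrite pnatr_eq0 -lt0n.
case: eqP => [->|/eqP d0].
  under eq_bigr do rewrite mul0r expi0.
  by rewrite sumr_const card_ord.
have pos (c : nat) : (0 < c < N)%N ->
    \sum_(m < N) expi (c%:R * (m%:R * (2 * pi / N%:R)) : R) = 0.
  move=> hc; pose z := expi (c%:R * (2 * pi / N%:R) : R).
  under eq_bigr do rewrite mulrCA expiMn -/z.
  have z1 : z != 1.
    have N1 : (0 : R) < N%:R by rewrite ltr0n.
    apply: expi_neq1; apply/andP; split.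
      by rewrite mulr_gt0 ?divr_gt0 ?mulr_gt0 ?pi_gt0 ?ltr0n //; lia.
    rewrite mulrA ltr_pdivrMr // mulrC ltr_pM2l ?ltr_nat; last by rewrite mulr_gt0 ?pi_gt0.
    by lia.
  have zN : z ^+ N = 1.
    rewrite -expiMn mulrCA.
    have -> : N%:R * (2 * pi / N%:R) = pi *+ 2 :> R by rewrite -mulr_natr; field.
    by rewrite expiMn /expi cos2pi sin2pi expr1n.
  apply/eqP; have /eqP := subrX1 z N; rewrite zN subrr eq_sym mulf_eq0 subr_eq0.
  by rewrite (negbTE z1).
case: d hd d0 => c hd d0; first by rewrite -pmulrn pos //; lia.
transitivity ((\sum_(m < N) expi (c.+1%:R * (m%:R * (2 * pi / N%:R)) : R))^*)%C.
  rewrite [RHS](raddf_sum (@conjc R)); apply: eq_bigr => m _.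
  by rewrite -[RHS]/(conjc (expi _)) -expiN NegzE mulrNz mulNr -pmulrn.
by rewrite pos ?conjc0 //; lia.
Qed.

(** With a period [N] larger than all the supports involved, nothing is folded
    back and a finite sum over frequencies replaces the Fourier integral. *)
Definition dft N s (U : int -> R) (m : nat) : R[i] :=
  wsum s N (fun j => (U j)%:C%C * expi (- j%:~R * (m%:R * (2 * pi / N%:R)))).

Lemma dft_conj N s U m : ((dft N s U m)^*)%C =
  wsum s N (fun j => (U j)%:C%C * expi (j%:~R * (m%:R * (2 * pi / N%:R)))).
Proof.
rewrite /dft /wsum (raddf_sum (@conjc R)); apply: eq_bigr => i _.
rewrite [LHS](rmorphM (@conjc R)); congr (_ * _); first exact: conjc_real.
by rewrite -[LHS]/(conjc (expi _)) -expiN mulNr opprK.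
Qed.

Lemma dft_parseval N s U : (0 < N)%N ->
  \sum_(m < N) `|dft N s U m| ^+ 2 = (N%:R * wsum s N (fun j => U j ^+ 2))%:C%C.
Proof.
move=> N0.
under eq_bigr do rewrite sqr_normc dft_conj /dft /wsum mulr_suml.
rewrite exchange_big /= /wsum mulr_sumr raddf_sum /=; apply: eq_bigr => i _.
under eq_bigr do rewrite mulr_sumr.
rewrite exchange_big /= (bigD1 i) //= [X in _ + X]big1 ?addr0 => [|k ki].
  under eq_bigr => m _.
    rewrite mulrACA -expiD -mulrDl addNr mul0r expi0 mulr1.
  over.
  rewrite sumr_const card_ord /= -[LHS]mulr_natl.
  by rewrite [RHS](rmorphM (real_complex R)) (rmorph_nat (real_complex R)) expr2 (rmorphM (real_complex R)).
under eq_bigr => m _.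
  rewrite mulrACA -expiD -mulrDl -intrN -intrD.
over.
rewrite -mulr_sumr expi_dft_sum //; last first.
  by have := ltn_ord i; have := ltn_ord k; lia.
case: eqP => [h|]; last by rewrite mulr0.
by case/eqP: ki; apply: val_inj => /=; lia.
Qed.

End Fourier.

Section Contraction.
Context {R : realType} (r p : nat) (al : int -> R).

Definition step_op (U : int -> R) (j : int) : R :=
  stencil_sum r p (fun l => al l * U (j + l)).

Lemma stencil_sumE (V : nmodType) (F : int -> V) :
  stencil_sum r p F = wsum (- r%:Z) (r + p).+1 F.
Proof. by apply: eq_bigr => i _; rewrite addrC. Qed.

Lemma step_opE U j : step_op U j = wsum (- r%:Z) (r + p).+1 (fun l => al l * U (j + l)).
Proof. exact: stencil_sumE. Qed.

Lemma step_op_dep U V j : (forall i, j - r%:Z <= i <= j + p%:Z -> U i = V i) ->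
  step_op U j = step_op V j.
Proof.
by move=> h; rewrite !step_opE; apply: eq_wsum => l hl; rewrite h //; lia.
Qed.

Lemma step_op_supp s M (U : int -> R) : (forall j, ~~ (s <= j < s + M%:Z) -> U j = 0) ->
  forall j, ~~ (s - p%:Z <= j < s - p%:Z + (M + (r + p))%:Z) -> step_op U j = 0.
Proof.
move=> h j hj; rewrite step_opE; apply: wsum_eq0 => l hl.
by rewrite h ?mulr0 //; lia.
Qed.

Hypothesis symbol : forall theta : R, 0 <= theta <= 2 * pi ->
  `|stencil_sum r p (fun l : int => (al l)%:C%C * expi (l%:~R * theta))| <= 1.

Lemma dft_step_op N s M (U : int -> R) m :
  (forall j, ~~ (s <= j < s + M%:Z) -> U j = 0) -> (M + (r + p) + (r + p) <= N)%N ->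
  dft N (s - p%:Z) (step_op U) m =
  stencil_sum r p (fun l : int => (al l)%:C%C * expi (l%:~R * (m%:R * (2 * pi / N%:R)) : R))
  * dft N (s - p%:Z) U m.
Proof.
move=> hU hN; rewrite stencil_sumE /dft.
set th := m%:R * _.
pose G j : R[i] := (U j)%:C%C * expi (- j%:~R * th).
have G0 j : ~~ (s <= j < s + M%:Z) -> G j = 0.
  by move=> hj; rewrite /G hU // mul0r.
transitivity (wsum (s - p%:Z) N (fun j =>
    wsum (- r%:Z) (r + p).+1 (fun l => (al l)%:C%C * expi (l%:~R * th) * G (j + l)))).
  apply: eq_wsum => j hj; rewrite step_opE /wsum rmorph_sum mulr_suml /=.
  apply: eq_bigr => i _; rewrite rmorphM /= /G -!mulrA; congr (_ * _).
  rewrite [RHS]mulrCA; congr (_ * _); rewrite -expiD; congr expi.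
  rewrite -mulrDl; congr (_ * _); rewrite !intrD; ring.
rewrite /wsum exchange_big /= mulr_suml; apply: eq_bigr => i _.
rewrite -mulr_sumr; congr (_ * _).
transitivity (wsum (s - p%:Z) N (fun j => G (j + (- r%:Z + i%:Z)))); first by [].
rewrite wsum_shift -[RHS]/(wsum (s - p%:Z) N G).
by rewrite (@wsum_widen _ s M) ?[RHS](@wsum_widen _ s M) //; have := ltn_ord i; lia.
Qed.

(** The discrete Fourier transform on a period longer than the supports turns
    the operator into multiplication by its symbol, which has modulus at most
    one; Parseval concludes. *)
Lemma step_op_contraction s M s' M' (U : int -> R) :
  (forall j, ~~ (s <= j < s + M%:Z) -> U j = 0) ->
  wsum s' M' (fun j => step_op U j ^+ 2) <= wsum s M (fun j => U j ^+ 2).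
Proof.
move=> hU; pose N := (M + (r + p) + (r + p)).+1.
have hQ := step_op_supp hU.
apply: (@le_trans _ _ (wsum (s - p%:Z) N (fun j => step_op U j ^+ 2))).
  apply: wsum_supp => j; first exact: sqr_ge0.
  by move=> hj; rewrite hQ ?expr0n //; lia.
rewrite -(@wsum_widen _ s M (s - p%:Z) N) //; first last.
- by move=> j hj; rewrite hU // expr0n.
- lia.
- lia.
have N0 : (0 : R) < N%:R by rewrite ltr0n.
rewrite -(ler_pM2l N0) -lecR -!dft_parseval //.
apply: ler_sum => m _; rewrite (dft_step_op m hU) ?leqnSn // normrM exprMn.
apply: ler_piMl; first exact: exprn_ge0.
apply: exprn_ile1 => //; apply: symbol.
have mN : (m%:R : R) <= N%:R by rewrite ler_nat ltnW.
rewrite mulr_ge0 //=; last by rewrite divr_ge0 ?mulr_ge0 ?pi_ge0 // ltW.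
rewrite mulrA ler_pdivrMr // mulrC ler_wpM2l //.
by rewrite mulr_ge0 ?pi_ge0.
Qed.

End Contraction.

(** * A slowly decreasing cut-off dissipates energy *)

Section Ramp.
Context {R : realType}.

Definition ramp (N : nat) (x : int) : R :=
  if x <= 0 then 0 else if N%:Z <= x then 1 else x%:~R / N%:R.

Lemma ramp_le0 N x : x <= 0 -> ramp N x = 0.
Proof. by rewrite /ramp => ->. Qed.

Lemma ramp_geN N x : (0 < N)%N -> N%:Z <= x -> ramp N x = 1.
Proof. by rewrite /ramp => N0 h; rewrite h; case: ifP => //; lia. Qed.

Lemma ramp_lip N x y : (0 < N)%N ->
  (ramp N x - ramp N y) ^+ 2 <= ((x - y)%:~R / N%:R) ^+ 2.
Proof.
move=> N0.
have sqC (a b : R) : (a - b) ^+ 2 = (b - a) ^+ 2 by ring.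
wlog le_xy : x y / x <= y => [H|].
  have [/H//|/ltW/H] := lerP x y.
  rewrite sqC => /le_trans; apply.
  by rewrite !exprMn !intrD !intrN [(y%:~R - _) ^+ 2]sqC.
have N0' : (0 : R) < N%:R by rewrite ltr0n.
suff [h1 h2] : 0 <= ramp N y - ramp N x /\ ramp N y - ramp N x <= (y - x)%:~R / N%:R.
  rewrite sqC [X in _ <= X]exprMn intrD intrN [(x%:~R - _) ^+ 2]sqC -intrN -intrD -exprMn.
  by rewrite lerXn2r // nnegrE // (le_trans h1).
have le_xy' : x%:~R <= y%:~R :> R by rewrite ler_int.
rewrite intrD intrN mulrBl /ramp -[N%:Z <= x](ler_int R) -[N%:Z <= y](ler_int R).
rewrite -[x <= 0](ler_int R) -[y <= 0](ler_int R) -pmulrn.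
move: le_xy'; set X := x%:~R; set Y := y%:~R; set n := N%:R => h.
have hd z : z / n * n = z by rewrite divfK // gt_eqF.
have := hd X; have := hd Y; move: (X / n) (Y / n) => a b ha hb.
by case: ifP => /= h1; case: ifP => /= h2; do ?case: ifP => /= h3; do ?case: ifP => /= h4;
   move/negbT: h1 || idtac; move/negbT: h2 || idtac; move/negbT: h3 || idtac; split; nra.
Qed.

Lemma ramp01 N x : 0 <= ramp N x <= 1.
Proof.
rewrite /ramp; case: ifP => [|/negbT]; first by rewrite lexx ler01.
case: ifP => [|/negbT]; rewrite -?ltNge ?lexx ?ler01 // => h1 h2.
have N0 : (0 : R) < N%:R by rewrite ltr0n; lia.
rewrite ler_pdivlMr // ler_pdivrMr // mul0r mul1r ler0z -[N%:R]/(N%:~R) ler_int.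
lia.
Qed.

End Ramp.

Section Boundary.
Context {R : realType} (r p : nat) (al : int -> R).
Local Notation Q := (step_op r p al).
Hypothesis symbol : forall theta : R, 0 <= theta <= 2 * pi ->
  `|stencil_sum r p (fun l : int => (al l)%:C%C * expi (l%:~R * theta))| <= 1.

Lemma step_opD U V j : Q (fun i => U i + V i) j = Q U j + Q V j.
Proof.
rewrite /step_op /stencil_sum -big_split /=; apply: eq_bigr => i _; ring.
Qed.

Lemma step_opZ c U j : Q (fun i => c * U i) j = c * Q U j.
Proof.
rewrite /step_op /stencil_sum mulr_sumr; apply: eq_bigr => i _; ring.
Qed.

(** A shift of the window moves values 1 in on the left and values 0 in on the
    right, so that only the length of the shift remains. *)
Lemma wsum_step_telescope N (psi : int -> R) i :
  (forall j, j <= p%:Z -> psi j = 1) -> (forall j, (p + N)%:Z <= j -> psi j = 0) ->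
  (i <= r + p)%N ->
  wsum 1 (p + N + r) psi - wsum 1 (p + N + r) (fun j => psi (j + (- r%:Z + i%:Z))) =
  i%:R - r%:R.
Proof.
move=> psi1 psi0.
have step i' : (i' <= r + p)%N ->
    wsum (1 - r%:Z + i'%:Z) (p + N + r) psi = wsum (1 - r%:Z) (p + N + r) psi - i'%:R.
  elim: i' => [|i' IH] hi; first by rewrite addr0 subr0.
  have := wsumSl (1 - r%:Z + i'%:Z) (p + N + r) psi.
  rewrite wsumSr psi0 ?psi1; [|lia..].
  rewrite IH ?(ltnW hi) // addr0 => e; rewrite -[i'.+1]addn1 PoszD addrA natrD; lra.
move=> hi; rewrite wsum_shift addrA step //.
have := step r (leq_addr _ _); rewrite -addrA addNr addr0 => ->; lra.
Qed.

(** For a profile equal to one on the left and decreasing very slowly to zero,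
    the flux created by the operator is that of transport: from
    2 phi_j (phi_j - phi_{j+l}) = phi_j^2 - phi_{j+l}^2 + (phi_j - phi_{j+l})^2
    the squares telescope to the first moment of the coefficients, which is
    negative, and the remainder is as small as the slope. *)
Lemma cutoff_dissipates (mu : R) : 0 < mu ->
  stencil_sum r p al = 1 -> stencil_sum r p (fun l => l%:~R * al l) = - mu ->
  exists (N : nat) (phi : int -> R), [/\ forall j, j <= p%:Z -> phi j = 1,
    forall j, (p + N)%:Z <= j -> phi j = 0 &
    wsum 1 (p + N + r) (fun j => phi j ^+ 2 - Q phi j ^+ 2) <= - (mu / 2)].
Proof.
move=> mu0 mom0 mom1.
pose A : R := \sum_(i < (r + p).+1) `|al (i%:Z - r%:Z)|.
have A0 : 0 <= A by apply: sumr_ge0.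
pose B : R := (1 + p + r)%:R * (r + p)%:R ^+ 2.
have B0 : 0 <= B by rewrite mulr_ge0 // exprn_ge0.
(* The length of the ramp makes the quadratic remainder, of order [A * B / N],
   at most half of the first moment. *)
pose N := (Num.bound (2 * A * B / mu)).+1.
have NP : 2 * A * B <= mu * N%:R.
  rewrite -ler_pdivrMl // mulrC; apply: (@le_trans _ _ (Num.bound (2 * A * B / mu))%:R).
    by apply/ltW/archi_boundP; rewrite divr_ge0 ?mulr_ge0 // ltW.
  by rewrite ler_nat.
have N0 : (0 : R) < N%:R by rewrite ltr0n.
pose phi (j : int) : R := ramp N ((p + N)%:Z - j).
have phi1 j : j <= p%:Z -> phi j = 1 by move=> h; apply: ramp_geN => //; lia.
have phi0 j : (p + N)%:Z <= j -> phi j = 0 by move=> h; apply: ramp_le0; lia.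
exists N, phi; split => //.
apply: (@le_trans _ _ (wsum 1 (p + N + r) (fun j => \sum_(i < (r + p).+1)
   al (i%:Z - r%:Z) * (phi j ^+ 2 - phi (j + (- r%:Z + i%:Z)) ^+ 2
     + (phi j - phi (j + (- r%:Z + i%:Z))) ^+ 2)))).
  apply: le_wsum => j _.
  suff -> : \sum_(i < (r + p).+1) al (i%:Z - r%:Z) * (phi j ^+ 2 -
     phi (j + (- r%:Z + i%:Z)) ^+ 2 + (phi j - phi (j + (- r%:Z + i%:Z))) ^+ 2) =
     2 * phi j * (phi j - Q phi j).
    by have := sqr_ge0 (phi j - Q phi j); nra.
  have e : phi j = \sum_(i < (r + p).+1) al (i%:Z - r%:Z) * phi j.
    by rewrite -mulr_suml [X in X * _]mom0 mul1r.
  rewrite [X in _ * (X - _)]e /step_op /stencil_sum -sumrB mulr_sumr.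
  apply: eq_bigr => i _; rewrite [- r%:Z + _]addrC; ring.
rewrite wsum_exchange.
apply: (@le_trans _ _ (\sum_(i < (r + p).+1) (al (i%:Z - r%:Z) * (i%:R - r%:R)
   + `|al (i%:Z - r%:Z)| * (B / N%:R)))).
  apply: ler_sum => i _; rewrite wsumZ wsumD mulrDr.
  rewrite wsumB (@wsum_step_telescope N (fun j => phi j ^+ 2)) ?lerD2l; last first.
  - by have := ltn_ord i; lia.
  - by move=> j hj; rewrite phi0 // expr0n.
  - by move=> j hj; rewrite phi1 // expr1n.
  apply: (@le_trans _ _ (`|al (i%:Z - r%:Z)| *
     wsum 1 (p + N + r) (fun j => (phi j - phi (j + (- r%:Z + i%:Z))) ^+ 2))).
    by rewrite ler_wpM2r ?ler_norm // wsum_ge0 // => j _; apply: sqr_ge0.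
  rewrite ler_wpM2l //.
  apply: (@le_trans _ _ (wsum 1 (p + N + r) (fun=> ((r + p)%:R / N%:R) ^+ 2))).
    apply: le_wsum => j _; apply: le_trans (ramp_lip _ _ _) _ => //.
    rewrite !exprMn ler_wpM2r ?sqr_ge0 // [(r + p)%:R]pmulrn.
    rewrite -!rmorphXn /= ler_int.
    by have := ltn_ord i; rewrite ltnS => hi; nia.
  rewrite wsum_const exprMn mulrA expr2 [N%:R^-1 ^+ 2]expr2 mulrA ler_pM2r ?invr_gt0 //.
  rewrite ler_pdivrMr // /B expr2 -!natrM ler_nat.
  by rewrite /N; nia.
rewrite big_split /= -mulr_suml -/A.
have -> : \sum_(i < (r + p).+1) al (i%:Z - r%:Z) * (i%:R - r%:R) = - mu.
  rewrite -mom1; apply: eq_bigr => i _; rewrite intrD intrN -!pmulrn; ring.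
suff : A * (B / N%:R) <= mu / 2 by lra.
by rewrite mulrA ler_pdivrMr //; lra.
Qed.

End Boundary.

(** * Boundary inequalities for one time step *)

Section BoundaryEnergy.
Context {R : realType} (r p : nat) (al : int -> R).
Local Notation Q := (step_op r p al).
Hypothesis symbol : forall theta : R, 0 <= theta <= 2 * pi ->
  `|stencil_sum r p (fun l : int => (al l)%:C%C * expi (l%:~R * theta))| <= 1.

Lemma wsum_cauchy s M (V : int -> R) j :
  wsum s M (fun l => al l * V (j + l)) ^+ 2 <=
  wsum s M (fun l => al l ^+ 2) * wsum (j + s) M (fun i => V i ^+ 2).
Proof.
apply: le_trans (sqr_sum_le _ _) _; rewrite /wsum ler_wpM2l //.
  by apply: sumr_ge0 => i _; apply: sqr_ge0.
by apply: ler_sum => i _; rewrite addrA.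
Qed.

Lemma step_op_shift (U : int -> R) j k : Q U (j + k) = Q (fun i => U (i + k)) j.
Proof. by apply: eq_bigr => i _; congr (_ * U _); ring. Qed.

(** The contraction property is applied to [U] prolonged beyond the boundary by
    its boundary value times the cut-off of [cutoff_dissipates]. The energy lost
    in the prolongation pays for the square of the boundary value, up to the
    defect [d] of the prolongation, which is small for nearly constant traces. *)
Lemma boundary_step_neumann (mu : R) : 0 < mu ->
  stencil_sum r p al = 1 -> stencil_sum r p (fun l => l%:~R * al l) = - mu ->
  exists kc : R * R, [/\ 0 < kc.1, 0 <= kc.2 &
  forall (J : nat) (U : int -> R), (forall j, j <= 0 -> U j = 0) ->
    wsum 1 J (fun j => Q U j ^+ 2) + kc.1 * U J%:Z ^+ 2 <=
    wsum 1 J (fun j => U j ^+ 2)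
    + kc.2 * wsum (1 - r%:Z) (r + p) (fun m => (U (J%:Z + m) - U J%:Z) ^+ 2)].
Proof.
move=> mu0 mom0 mom1.
have [N [phi [phi1 phi0]]] := cutoff_dissipates mu0 mom0 mom1.
set M := (p + N + r)%N => phiS.
pose X := wsum 1 M (fun j => phi j ^+ 2); pose Y := wsum 1 M (fun j => Q phi j ^+ 2).
have X0 : 0 <= X by apply: wsum_ge0 => j _; apply: sqr_ge0.
have Y0 : 0 <= Y by apply: wsum_ge0 => j _; apply: sqr_ge0.
(* The cross terms between [c * phi] and the defect are split by Young's
   inequality with weight [th], small enough to leave half of the gain. *)
pose th := mu / (4 * (X + Y + 1)); pose t := th^-1.
have th0 : 0 < th by rewrite divr_gt0 //; lra.
have t0 : 0 < t by rewrite invr_gt0.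
have tht : th * t = 1 by rewrite divff // gt_eqF.
have thXY : th * (X + Y) <= mu / 4.
  by rewrite /th mulrAC ler_pdivrMr ?mulr_gt0 //; nra.
exists (mu / 4, 1 + 2 * t); split => /=; [lra|lra|].
move=> J U U0; set c := U J%:Z.
pose W (j : int) : R := if j <= (J + p)%:Z then U j else c * phi (j - J%:Z).
pose d (m : int) : R := if 1 - r%:Z <= m <= p%:Z then U (J%:Z + m) - c else 0.
have Wsupp j : ~~ (1 <= j < 1 + (J + M)%:Z) -> W j = 0.
  move=> hj; rewrite /W; case: ifP => h; first by rewrite U0 //; lia.
  by rewrite phi0 ?mulr0 //; lia.
have WE m : 1 - r%:Z <= m -> W (m + J%:Z) = c * phi m + d m.
  move=> hm; rewrite /W /d hm /=; case: ifP => h.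
    by rewrite ifT ?phi1; [rewrite addrC; lra|lia|lia].
  by rewrite ifF ?addr0 ?addrK //; lia.
have := step_op_contraction symbol 1 (J + M) Wsupp.
rewrite !(wsum_cat 1 J M).
rewrite (@eq_wsum _ 1 J (fun j => Q W j ^+ 2) (fun j => Q U j ^+ 2)); last first.
  move=> j hj; congr (_ ^+ 2); apply: step_op_dep => i hi; rewrite /W ifT //; lia.
rewrite (@eq_wsum _ 1 J (fun j => W j ^+ 2) (fun j => U j ^+ 2)); last first.
  by move=> j hj; rewrite /W ifT //; lia.
rewrite -!(wsum_shift 1 M J%:Z).
rewrite (@eq_wsum _ 1 M (fun j => W (j + J%:Z) ^+ 2)
  (fun m => (c * phi m + d m) ^+ 2)); last first.
  by move=> m hm; rewrite WE //; lia.
rewrite (@eq_wsum _ 1 M (fun j => Q W (j + J%:Z) ^+ 2)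
  (fun m => (c * Q phi m + Q d m) ^+ 2)); last first.
  move=> m hm; rewrite step_op_shift -step_opZ -step_opD; congr (_ ^+ 2).
  by apply: step_op_dep => i hi; rewrite WE //; lia.
set Dd := wsum (1 - r%:Z) (r + p) _.
have dE : wsum (1 - r%:Z) (r + p) (fun m => d m ^+ 2) = Dd.
  by apply: eq_wsum => m hm; rewrite /d ifT //; lia.
have dsupp m : ~~ (1 - r%:Z <= m < 1 - r%:Z + (r + p)%:Z) -> d m = 0.
  by move=> hm; rewrite /d ifF //; lia.
have hd1 : wsum 1 M (fun m => d m ^+ 2) <= Dd.
  rewrite -dE; apply: wsum_supp => m; first exact: sqr_ge0.
  by move/dsupp ->; rewrite expr0n.
have hd2 : wsum 1 M (fun m => Q d m ^+ 2) <= Dd.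
  by rewrite -dE; apply: step_op_contraction.
have hpt : wsum 1 M (fun m => (c * phi m + d m) ^+ 2) -
    wsum 1 M (fun m => (c * Q phi m + Q d m) ^+ 2) <=
    wsum 1 M (fun m => c ^+ 2 * (phi m ^+ 2 - Q phi m ^+ 2) +
      (th * c ^+ 2 * (phi m ^+ 2 + Q phi m ^+ 2) +
       ((1 + t) * d m ^+ 2 + t * Q d m ^+ 2))).
  rewrite -wsumB; apply: le_wsum => m _.
  move: (phi m) (Q phi m) (d m) (Q d m) => x y e f.
  have h1 : 2 * (c * x * e) <= th * (c * x) ^+ 2 + t * e ^+ 2.
    have : 0 <= t * (th * (c * x) - e) ^+ 2 by rewrite mulr_ge0 ?sqr_ge0 // ltW.
    suff -> : t * (th * (c * x) - e) ^+ 2 = (th * t) * th * (c * x) ^+ 2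
      - 2 * (th * t) * (c * x * e) + t * e ^+ 2 by rewrite tht; lra.
    ring.
  have h2 : - 2 * (c * y * f) <= th * (c * y) ^+ 2 + t * f ^+ 2.
    have : 0 <= t * (th * (c * y) + f) ^+ 2 by rewrite mulr_ge0 ?sqr_ge0 // ltW.
    suff -> : t * (th * (c * y) + f) ^+ 2 = (th * t) * th * (c * y) ^+ 2
      + 2 * (th * t) * (c * y * f) + t * f ^+ 2 by rewrite tht; lra.
    ring.
  have := sqr_ge0 f; nra.
move: phiS; rewrite wsumB -/X -/Y => phiS.
move: hpt; rewrite !wsumD !wsumZ !wsumD -/X -/Y.
have -> : wsum 1 M (fun j => - Q phi j ^+ 2) = - Y.
  by rewrite /Y -[RHS]mulN1r -wsumZ; apply: eq_wsum => j _; rewrite mulN1r.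
have c2 := sqr_ge0 c.
have : c ^+ 2 * (X - Y) <= c ^+ 2 * - (mu / 2).
  by rewrite ler_wpM2l.
have : c ^+ 2 * (th * (X + Y)) <= c ^+ 2 * (mu / 4) by rewrite ler_wpM2l.
have : t * wsum 1 M (fun m => d m ^+ 2) <= t * Dd by rewrite ler_wpM2l // ltW.
have : t * wsum 1 M (fun m => Q d m ^+ 2) <= t * Dd by rewrite ler_wpM2l // ltW.
lra.
Qed.

(** The values of [Q V] beyond the boundary form a triangular system for the last
    values of [V], with [al (- r)] on the diagonal: the value of [Q V] at
    [J + r - m] involves [V] at [J - m] and at larger indices only. *)
Lemma triangular_traces : al (- r%:Z) != 0 -> forall m : nat,
  exists2 C : R, 0 <= C & forall (J : int) (V : int -> R),
   (forall j, J + p%:Z < j -> V j = 0) ->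
   wsum (J + 1 - m%:Z) m (fun j => V j ^+ 2) <=
   C * (wsum (J + 1 + r%:Z - m%:Z) m (fun j => Q V j ^+ 2)
        + wsum (J + 1) p (fun j => V j ^+ 2)).
Proof.
move=> a0; elim=> [|m [C C0 IH]].
  by exists 0 => // J V _; rewrite !wsum0 mul0r.
pose A := wsum (1 - r%:Z) (r + p) (fun l => al l ^+ 2).
have A0 : 0 <= A by apply: wsum_ge0 => j _; apply: sqr_ge0.
pose b := al (- r%:Z) ^- 2.
have b0 : 0 <= b by rewrite invr_ge0 sqr_ge0.
have AC : 0 <= A * (C + 1) by rewrite mulr_ge0 // addr_ge0.
exists (C + b * (2 + 2 * A * (C + 1))).
  by rewrite addr_ge0 // mulr_ge0 //; lra.
move=> J V V0.
set q := wsum _ m.+1 (fun j => Q V j ^+ 2); set g := wsum (J + 1) p _.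
have g0 : 0 <= g by apply: wsum_ge0 => j _; apply: sqr_ge0.
have e1 : wsum (J + 1 - m.+1%:Z) m.+1 (fun j => V j ^+ 2) =
    V (J - m%:Z) ^+ 2 + wsum (J + 1 - m%:Z) m (fun j => V j ^+ 2).
  by rewrite wsumSl; congr (V _ ^+ 2 + wsum _ _ _); lia.
have e2 : q = Q V (J + r%:Z - m%:Z) ^+ 2 +
    wsum (J + 1 + r%:Z - m%:Z) m (fun j => Q V j ^+ 2).
  by rewrite /q wsumSl; congr (Q V _ ^+ 2 + wsum _ _ _); lia.
rewrite e1; have := IH J V V0; rewrite -/g.
set v := wsum _ m (fun j => V j ^+ 2) => hv.
have v0 : 0 <= v by apply: wsum_ge0 => j _; apply: sqr_ge0.
have q0 : 0 <= wsum (J + 1 + r%:Z - m%:Z) m (fun j => Q V j ^+ 2).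
  by apply: wsum_ge0 => j _; apply: sqr_ge0.
move: hv e2 q0; move: (wsum (J + 1 + r%:Z - m%:Z) m _) => q' hv e2 q'0.
have e3 : Q V (J + r%:Z - m%:Z) = al (- r%:Z) * V (J - m%:Z) +
   wsum (1 - r%:Z) (r + p) (fun l => al l * V (J + r%:Z - m%:Z + l)).
  rewrite step_opE wsumSl; congr (al _ * V _ + wsum _ _ _); clear; lia.
have h4 : wsum (1 - r%:Z) (r + p) (fun l => al l * V (J + r%:Z - m%:Z + l)) ^+ 2
    <= A * (v + g).
  apply: le_trans (wsum_cauchy _ _ _ _) _; rewrite -/A ler_wpM2l //.
  apply: (@le_trans _ _ (wsum (J + 1 - m%:Z) (m + p + (r + p)) (fun j => V j ^+ 2))).
    by apply: wsum_sub => [||j _]; [clear; lia|clear; lia|exact: sqr_ge0].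
  rewrite (wsum_cat _ (m + p)) wsum_cat (_ : J + 1 - m%:Z + m%:Z = J + 1); last by clear; lia.
  rewrite [X in _ + X]wsum_eq0 ?addr0 //.
  by move=> j hj; rewrite V0 ?expr0n //; move: hj; clear; lia.
have h5 : V (J - m%:Z) ^+ 2 <= b * (2 * Q V (J + r%:Z - m%:Z) ^+ 2 + 2 * A * (v + g)).
  rewrite /b mulrC ler_pdivlMr ?exprn_even_gt0 //.
  move: e3 h4; set w := wsum _ _ _; set z := al _ ; move: (Q V _) (V _) => x y e3 h4.
  have -> : y ^+ 2 * z ^+ 2 = (x - w) ^+ 2 by rewrite e3; ring.
  have := sqr_ge0 (x + w); nra.
rewrite e2; move: h5; have := sqr_ge0 (Q V (J + r%:Z - m%:Z)).
move: (Q V _ ^+ 2) => x x0 h5.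
have h6 : A * v <= A * (C * (q' + g)) by rewrite ler_wpM2l.
have h7 : b * (2 * x + 2 * A * (v + g)) <= b * (2 * x + 2 * A * (C * (q' + g) + g)).
  by rewrite ler_wpM2l //; lra.
have h8 : 0 <= C * x by rewrite mulr_ge0.
have h9 : 0 <= b * A * (C + 1) * x by rewrite !mulr_ge0 //; lra.
have h10 : 0 <= b * A * q' by rewrite !mulr_ge0.
have h11 : 0 <= b * (q' + g) by rewrite mulr_ge0 //; lra.
have : V (J - m%:Z) ^+ 2 + v <=
    b * (2 * x + 2 * A * (C * (q' + g) + g)) + C * (q' + g) by lra.
move/le_trans; apply.
by rewrite -subr_ge0; set e := (X in 0 <= X); have -> : e = C * x +
  2 * (b * A * (C + 1) * x) + 2 * (b * A * q') + 2 * (b * (q' + g));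
  [rewrite /e; ring | lra].
Qed.

(** For [U] prolonged by zero, the operator spreads energy into the [r] cells
    beyond the boundary. The contraction property counts this energy, and
    [triangular_traces] recovers the last values of [U] from it. *)
Lemma boundary_step_dirichlet : al (- r%:Z) != 0 ->
  exists kc : R * R, [/\ 0 < kc.1, 0 <= kc.2 &
  forall (J : nat) (U : int -> R), (forall j, j <= 0 -> U j = 0) ->
    wsum 1 J (fun j => Q U j ^+ 2)
    + kc.1 * wsum (J%:Z + 1 - r%:Z) r (fun j => U j ^+ 2) <=
    wsum 1 J (fun j => U j ^+ 2) + kc.2 * wsum (J%:Z + 1) p (fun j => U j ^+ 2)].
Proof.
move=> a0; have [C C0 HC] := triangular_traces a0 r.
have C1 : 0 < C + 1 by lra.
exists ((C + 1)^-1, 2); split => //=; first by rewrite invr_gt0.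
move=> J U U0.
pose W (j : int) : R := if j <= (J + p)%:Z then U j else 0.
have Wsupp j : ~~ (1 <= j < 1 + (J + p)%:Z) -> W j = 0.
  move=> hj; rewrite /W; case: ifP => // h; rewrite U0 //; lia.
have := step_op_contraction symbol 1 (J + r) Wsupp.
have := HC J%:Z W; rewrite addrK => HW.
rewrite !wsum_cat ![1 + J%:Z]addrC.
rewrite (@eq_wsum _ 1 J (fun j => Q W j ^+ 2) (fun j => Q U j ^+ 2)); last first.
  move=> j hj; congr (_ ^+ 2); apply: step_op_dep => i hi; rewrite /W ifT //; lia.
rewrite (@eq_wsum _ 1 J (fun j => W j ^+ 2) (fun j => U j ^+ 2)); last first.
  by move=> j hj; rewrite /W ifT //; lia.
have eg : wsum (J%:Z + 1) p (fun j => W j ^+ 2) = wsum (J%:Z + 1) p (fun j => U j ^+ 2).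
  by apply: eq_wsum => j hj; rewrite /W ifT //; lia.
have er : wsum (J%:Z + 1 - r%:Z) r (fun j => W j ^+ 2) =
    wsum (J%:Z + 1 - r%:Z) r (fun j => U j ^+ 2).
  by apply: eq_wsum => j hj; rewrite /W ifT //; lia.
move: HW; rewrite eg er => HW.
have {}HW : wsum (J%:Z + 1 - r%:Z) r (fun j => U j ^+ 2) <=
    C * (wsum (J%:Z + 1) r (fun j => Q W j ^+ 2) + wsum (J%:Z + 1) p (fun j => U j ^+ 2)).
  by apply: HW => j hj; rewrite /W ifF //; lia.
set x := wsum _ r (fun j => Q W j ^+ 2) in HW *; set g := wsum _ p _ in HW *.
have x0 : 0 <= x by apply: wsum_ge0 => j _; apply: sqr_ge0.
have g0 : 0 <= g by apply: wsum_ge0 => j _; apply: sqr_ge0.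
suff : (C + 1)^-1 * wsum (J%:Z + 1 - r%:Z) r (fun j => U j ^+ 2) <= x + g by lra.
by rewrite mulrC ler_pdivrMr //; lra.
Qed.

End BoundaryEnergy.

(** * Backward differences and discrete Gronwall inequality *)

Section Differences.
Context {R : realType}.
Implicit Types (v : int -> R) (i m J : nat) (j : int).

Lemma iter_Dminus_sq i v j :
  iter i Dminus v j ^+ 2 <= 4 ^+ i * wsum (j - i%:Z) i.+1 (fun k => v k ^+ 2).
Proof.
elim: i j => [|i IH] j; first by rewrite mul1r wsumSr wsum0 add0r subr0 addr0.
rewrite iterS {1}/Dminus.
have h1 := IH j; have h2 := IH (j - 1).
have s1 : wsum (j - i%:Z) i.+1 (fun k => v k ^+ 2) <=
    wsum (j - i.+1%:Z) i.+2 (fun k => v k ^+ 2).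
  by apply: wsum_sub => [||k _]; [lia|lia|exact: sqr_ge0].
have s2 : wsum (j - 1 - i%:Z) i.+1 (fun k => v k ^+ 2) <=
    wsum (j - i.+1%:Z) i.+2 (fun k => v k ^+ 2).
  by apply: wsum_sub => [||k _]; [lia|lia|exact: sqr_ge0].
have p4 : 0 <= 4 ^+ i :> R by exact: exprn_ge0.
have := ler_wpM2l p4 s1; have := ler_wpM2l p4 s2.
have := sqr_ge0 (iter i Dminus v j + iter i Dminus v (j - 1)).
rewrite [4 ^+ i.+1]exprS; lra.
Qed.

Lemma sub_iter_Dminus_sq i v j :
  (v j - iter i Dminus v j) ^+ 2 <= 4 ^+ i * wsum (j - i%:Z) i (fun k => v k ^+ 2).
Proof.
elim: i => [|i IH]; first by rewrite subrr expr0n wsum0 mulr0.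
rewrite iterS {1}/Dminus opprB addrCA addrC.
have h1 := iter_Dminus_sq i v (j - 1).
have s1 : wsum (j - i%:Z) i (fun k => v k ^+ 2) <=
    wsum (j - i.+1%:Z) i.+1 (fun k => v k ^+ 2).
  by apply: wsum_sub => [||k _]; [lia|lia|exact: sqr_ge0].
have s2 : wsum (j - 1 - i%:Z) i.+1 (fun k => v k ^+ 2) <=
    wsum (j - i.+1%:Z) i.+1 (fun k => v k ^+ 2).
  by apply: wsum_sub => [||k _]; [lia|lia|exact: sqr_ge0].
have p4 : 0 <= 4 ^+ i :> R by exact: exprn_ge0.
have := ler_wpM2l p4 s1; have := ler_wpM2l p4 s2.
have := sqr_ge0 (v j - iter i Dminus v j - iter i Dminus v (j - 1)).
rewrite [4 ^+ i.+1]exprS; lra.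
Qed.

Lemma iter_DminusD i (v w : int -> R) j :
  iter i Dminus (fun k => v k + w k) j = iter i Dminus v j + iter i Dminus w j.
Proof.
elim: i j => [//|i IH] j; rewrite !iterS {1}/Dminus !IH /Dminus; ring.
Qed.

Lemma wsum_Dminus v j m : wsum (j + 1) m (Dminus v) = v (j + m%:Z) - v j.
Proof.
elim: m => [|m IH]; first by rewrite wsum0 addr0 subrr.
rewrite wsumSr IH /Dminus (_ : j + 1 + m%:Z - 1 = j + m%:Z); last lia.
rewrite (_ : j + 1 + m%:Z = j + m.+1%:Z); [ring|lia].
Qed.

Lemma wsum_sqr_le s m v : wsum s m v ^+ 2 <= m%:R * wsum s m (fun j => v j ^+ 2).
Proof.
have := sqr_sum_le (fun _ : 'I_m => 1) (fun i : 'I_m => v (s + (i : nat)%:Z)).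
under eq_bigr do rewrite mul1r.
by rewrite expr1n sumr_const card_ord.
Qed.

(** The difference of two values is a sum of first differences, at most [r + p]
    of them. *)
Lemma trace_difference (J : int) (r p : nat) v (m : int) : 1 - r%:Z <= m <= p%:Z ->
  (v (J + m) - v J) ^+ 2 <=
  (r + p)%:R * wsum (J + 1 - r%:Z) (r + p) (fun j => Dminus v j ^+ 2).
Proof.
have D0 s n : 0 <= wsum s n (fun j => Dminus v j ^+ 2).
  by apply: wsum_ge0 => k _; exact: sqr_ge0.
move=> hm; have [m0|m0] := lerP 0 m.
  have [n hn] : exists n : nat, m = n%:Z by exists `|m|%N; lia.
  rewrite hn -wsum_Dminus; apply: le_trans (wsum_sqr_le _ _ _) _.
  apply: ler_pM => //; first by rewrite ler_nat; lia.
  by apply: wsum_sub => [||k _]; [lia|lia|exact: sqr_ge0].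
have [n hn] : exists n : nat, J = J + m + n%:Z by exists `|m|%N; lia.
rewrite [in v J]hn -sqrrN opprB -wsum_Dminus; apply: le_trans (wsum_sqr_le _ _ _) _.
apply: ler_pM => //; first by rewrite ler_nat; lia.
by apply: wsum_sub => [||k _]; [lia|lia|exact: sqr_ge0].
Qed.

Lemma wsum_masked J k m (V : int -> R) : (forall j, 0 <= V j) ->
  (forall j, ~~ (1 <= j < 1 + J%:Z) -> V j = 0) ->
  wsum 1 J (fun j => wsum (j + k) m V) <= m%:R * wsum 1 J V.
Proof.
move=> V0 Vs; rewrite {2}/wsum wsum_exchange.
apply: (@le_trans _ _ (\sum_(i < m) wsum 1 J V)); last first.
  by rewrite sumr_const card_ord mulr_natl.
apply: ler_sum => i _.
rewrite (@eq_wsum _ 1 J _ (fun j => V (j + (k + i%:Z)))); last first.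
  by move=> j _; rewrite addrA.
by rewrite wsum_shift; apply: wsum_supp.
Qed.

(** Forgets the ghost values, so that differences taken away from the boundaries
    are bounded by interior values alone. *)
Definition mask J v j : R := if 1 <= j <= J%:Z then v j else 0.

Lemma mask_supp J v j : ~~ (1 <= j < 1 + J%:Z) -> mask J v j ^+ 2 = 0.
Proof. by move=> h; rewrite /mask ifF ?expr0n //; lia. Qed.

Lemma wsum_mask J v : wsum 1 J (fun j => mask J v j ^+ 2) = wsum 1 J (fun j => v j ^+ 2).
Proof. by apply: eq_wsum => j hj; rewrite /mask ifT //; lia. Qed.

Lemma iter_Dminus_mask_sq i J v j : i%:Z < j -> j <= J%:Z ->
  iter i Dminus v j ^+ 2 <= 4 ^+ i * wsum (j - i%:Z) i.+1 (fun k => mask J v k ^+ 2).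
Proof.
move=> h1 h2; rewrite (@eq_wsum _ _ _ _ (fun k => v k ^+ 2)); first exact: iter_Dminus_sq.
by move=> k hk; rewrite /mask ifT //; lia.
Qed.

(** Young's inequality with weight [J]: the factor [1 + 1 / J] is harmless when
    repeated over a number of steps proportional to [J]. *)
Lemma wsum_sqrD_le J (x y : int -> R) : (0 < J)%N ->
  wsum 1 J (fun j => (x j + y j) ^+ 2) <=
  (1 + J%:R^-1) * wsum 1 J (fun j => x j ^+ 2) + (1 + J%:R) * wsum 1 J (fun j => y j ^+ 2).
Proof.
move=> J1; have JJ : (0 : R) < J%:R by rewrite ltr0n.
rewrite -!wsumZ -wsumD; apply: le_wsum => j _; move: (x j) (y j) => {}x {}y.
have : 0 <= J%:R^-1 * (x - J%:R * y) ^+ 2 by rewrite mulr_ge0 ?sqr_ge0 // invr_ge0 ltW.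
suff -> : J%:R^-1 * (x - J%:R * y) ^+ 2 =
  J%:R^-1 * x ^+ 2 - 2 * (J%:R^-1 * J%:R) * (x * y) + J%:R^-1 * J%:R * J%:R * y ^+ 2.
  by rewrite mulVf ?gt_eqF //; lra.
ring.
Qed.

Lemma energy_summation (E c h : nat -> R) (N : nat) : E 0%N = 0 -> (forall n, 0 <= E n) ->
  (forall n, (n < N)%N -> E n.+1 + c n <= E n + h n) ->
  \sum_(n < N) c n <= \sum_(n < N) h n.
Proof.
move=> E0 Epos H.
suff : E N + \sum_(n < N) c n <= \sum_(n < N) h n by have := Epos N; lra.
elim: N H => [|N IH] H; first by rewrite !big_ord0 E0 addr0.
rewrite !big_ord_recr /=; have := H N (ltnSn N).
have := IH (fun n hn => H n (ltnW hn)); lra.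
Qed.

Lemma gronwall (E B : nat -> R) (x : R) N : 0 <= x -> (forall n, 0 <= B n) ->
  (forall n, (n <= N)%N -> E n <= \sum_(m < n) (x * E m + B m)) ->
  E N <= expR (x * N%:R) * \sum_(n < N) B n.
Proof.
move=> x0 B0 H; apply: le_trans (H N (leqnn N)) _.
have B0' n : 0 <= \sum_(m < n) B m by apply: sumr_ge0.
suff : forall n, (n <= N)%N ->
    \sum_(m < n) (x * E m + B m) <= (1 + x) ^+ n * \sum_(m < n) B m.
  move=> /(_ N (leqnn N)) /le_trans; apply; rewrite ler_wpM2r //.
  by rewrite mulrC expRM_natl lerXn2r ?nnegrE ?expR_ge0 ?expR_ge1Dx //; lra.
elim=> [|n IH] hn; first by rewrite !big_ord0 mulr0.
rewrite !big_ord_recr /= exprS.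
have {}IH := IH (ltnW hn); have {}H := H n (ltnW hn).
have h1 : 1 <= (1 + x) ^+ n by rewrite exprn_ege1 //; lra.
have h2 : x * E n <= x * ((1 + x) ^+ n * \sum_(m < n) B m).
  by rewrite ler_wpM2l // (le_trans H).
have h3 : 0 <= ((1 + x) ^+ n - 1) * B n by rewrite mulr_ge0 // subr_ge0.
have h4 : 0 <= x * (1 + x) ^+ n * B n by rewrite !mulr_ge0 // exprn_ge0 //; lra.
lra.
Qed.

End Differences.

(** * Localization near the outflow boundary *)

Section Stability.
Context {R : realType} (r p kb : nat) (al : int -> R).
Local Notation Q := (step_op r p al).
Implicit Types (e : nat -> int -> R) (J n N i : nat).

Definition sqnorm J (v : int -> R) : R := wsum 1 J (fun j => v j ^+ 2).

Definition residual e n (j : int) : R := e n.+1 j - Q (e n) j.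

(** What drives the numerical solution between the levels [n] and [n.+1]: the
    inflow ghost values, the defect in the outflow condition and the residual
    of the scheme, the latter with the weight [J] that comes from absorbing it
    into a growth factor [1 + 1 / J] per time step. *)
Definition forcing J e n : R :=
  wsum (1 - r%:Z) r (fun j => e n j ^+ 2)
  + wsum (J%:Z + 1) p (fun j => iter kb Dminus (e n) j ^+ 2)
  + J%:R * sqnorm J (residual e n).

Lemma sqnorm_ge0 J v : 0 <= sqnorm J v.
Proof. by apply: wsum_ge0 => j _; exact: sqr_ge0. Qed.

Lemma step_op_Dminus i (v : int -> R) : Q (iter i Dminus v) = iter i Dminus (Q v).
Proof.
elim: i => [//|i IH]; rewrite !iterS -IH; apply/funext => j.
rewrite /Dminus /step_op /stencil_sum -sumrB; apply: eq_bigr => l _.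
rewrite mulrBr; congr (_ - _).
by rewrite (_ : j + (l%:Z - r%:Z) - 1 = j - 1 + (l%:Z - r%:Z)) //; lia.
Qed.

Let M1 := (kb + r + p)%N.
(** From this number of cells on, the transition has at least [J / 2] cells. *)
Let J0 := (2 * (M1 + r + p)).+1.

(** The margins exceed the reach of the operator and of [kb] differences, and the
    transition takes place over a number of cells comparable to [J], so that the
    slope is of order [1 / J]. *)
Definition window J (j : int) : R := ramp (J - M1 - r - p) (j - M1%:Z).

Lemma window_left J j : j <= M1%:Z -> window J j = 0.
Proof. by move=> h; apply: ramp_le0; lia. Qed.

Lemma window_right J j : (J0 <= J)%N -> (J - r - p)%:Z <= j -> window J j = 1.
Proof. by move=> h1 h2; apply: ramp_geN; rewrite /J0 in h1; lia. Qed.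

Lemma window_lip J j l : (J0 <= J)%N -> - r%:Z <= l <= p%:Z ->
  (window J j - window J (j + l)) ^+ 2 <= (2 * (r + p)%:R / J%:R) ^+ 2.
Proof.
move=> hJ hl; apply: le_trans (ramp_lip _ _ _) _; first by rewrite /J0 in hJ; lia.
have -> : j - M1%:Z - (j + l - M1%:Z) = - l by lia.
set K := (J - _ - _ - _)%N.
have K0 : (0 : R) < K%:R by rewrite ltr0n /K; rewrite /J0 in hJ; lia.
have JK : J%:R <= 2 * K%:R :> R by rewrite -natrM ler_nat /K; rewrite /J0 in hJ; lia.
have JJ : (0 : R) < J%:R by rewrite ltr0n; lia.
rewrite -[X in X <= _]real_normK ?num_real // lerXn2r ?nnegrE ?divr_ge0 ?mulr_ge0 //.
rewrite normrM normfV (ger0_norm (ltW K0)) ler_pdivrMr // mulrAC ler_pdivlMr //.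
rewrite -intr_norm; have -> : `|- l|%:~R = (`|l|%N)%:R :> R.
  by rewrite normrN -abszE -pmulrn.
have l0 : (`|l|%N)%:R <= (r + p)%:R :> R by rewrite ler_nat; lia.
apply: (@le_trans _ _ ((r + p)%:R * J%:R)); first by rewrite ler_wpM2r // ltW.
have : 0 <= (r + p)%:R * (2 * K%:R - J%:R) :> R by rewrite mulr_ge0 // subr_ge0.
lra.
Qed.

Definition windowed J i e n (j : int) : R := window J j * iter i Dminus (e n) j.

(** Multiplying by the window commutes with the scheme up to a term of size
    [1 / J] carried by interior values only: where the window varies, neither
    boundary is visible. *)
Lemma windowed_residual i : (i <= kb)%N -> exists2 C : R, 0 <= C &
  forall J e n, (J0 <= J)%N ->
    wsum 1 J (fun j => residual (windowed J i e) n j ^+ 2) <=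
    C * (J%:R ^- 2 * sqnorm J (e n) + sqnorm J (residual e n)).
Proof.
move=> ik.
pose A := wsum (- r%:Z) (r + p).+1 (fun l => al l ^+ 2).
have A0 : 0 <= A by apply: wsum_ge0 => l _; exact: sqr_ge0.
have p4 : 0 <= 4 ^+ i :> R by exact: exprn_ge0.
pose C1 : R := 2 * 4 ^+ i * i.+1%:R.
pose C2 : R := 2 * A * (2 * (r + p)%:R) ^+ 2 * 4 ^+ i * ((r + p).+1%:R * i.+1%:R).
have C10 : 0 <= C1 by rewrite !mulr_ge0.
have C20 : 0 <= C2 by rewrite !mulr_ge0 ?sqr_ge0.
exists (C1 + C2); first exact: addr_ge0.
move=> J e n hJ.
have hJ' : (M1 + r + p < J)%N by rewrite /J0 in hJ; lia.
have JJ : (0 : R) < J%:R by rewrite ltr0n; lia.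
have j20 : 0 <= J%:R ^- 2 :> R by rewrite invr_ge0 sqr_ge0.
pose F2 (k : int) := mask J (residual e n) k ^+ 2.
pose e2 (k : int) := mask J (e n) k ^+ 2.
pose lam := (2 * (r + p)%:R / J%:R) ^+ 2 * 4 ^+ i : R.
have lam0 : 0 <= lam by rewrite mulr_ge0 ?sqr_ge0.
apply: (@le_trans _ _ (wsum 1 J (fun j =>
   2 * 4 ^+ i * wsum (j + - i%:Z) i.+1 F2
   + 2 * A * lam * \sum_(l < (r + p).+1) wsum (j + (- r%:Z + l%:Z - i%:Z)) i.+1 e2))).
  apply: le_wsum => j hj.
  (* The commutator of the operator with the multiplication by the window. *)
  have -> : residual (windowed J i e) n j = window J j * iter i Dminus (residual e n) j +
     wsum (- r%:Z) (r + p).+1 (fun l => al l *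
       ((window J j - window J (j + l)) * iter i Dminus (e n) (j + l))).
    rewrite /residual /windowed.
    have eE : e n.+1 = (fun k => (e n.+1 k - Q (e n) k) + Q (e n) k).
      by apply/funext => k; rewrite subrK.
    rewrite [in LHS]eE iter_DminusD -step_op_Dminus mulrDr -addrA; congr (_ + _).
    rewrite !step_opE /wsum mulr_sumr -sumrB; apply: eq_bigr => l _; ring.
  set x := _ * _; set y := wsum _ _ _.
  have hx : x ^+ 2 <= 4 ^+ i * wsum (j + - i%:Z) i.+1 F2.
    have w0 : 0 <= wsum (j + - i%:Z) i.+1 F2 by apply: wsum_ge0 => ? _; exact: sqr_ge0.
    rewrite /x; have [jM|Mj] := lerP j M1%:Z.
      by rewrite window_left // mul0r expr0n mulr_ge0.
    have /andP[c0 c1] := @ramp01 R (J - M1 - r - p) (j - M1%:Z).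
    rewrite exprMn; apply: (@le_trans _ _ (1 * iter i Dminus (residual e n) j ^+ 2)).
      by rewrite ler_wpM2r ?sqr_ge0 // expr_le1.
    rewrite mul1r; apply: iter_Dminus_mask_sq; move: Mj ik hj; rewrite /M1; clear; lia.
  have hy : y ^+ 2 <= A * (lam *
      \sum_(l < (r + p).+1) wsum (j + (- r%:Z + l%:Z - i%:Z)) i.+1 e2).
    apply: le_trans (sqr_sum_le _ _) _; rewrite ler_wpM2l //.
    rewrite mulr_sumr; apply: ler_sum => l _.
    set k := j + (- r%:Z + l%:Z).
    have w0 : 0 <= wsum (k - i%:Z) i.+1 e2 by apply: wsum_ge0 => ? _; exact: sqr_ge0.
    have hl : - r%:Z <= - r%:Z + l%:Z <= p%:Z by have := ltn_ord l; clear; lia.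
    rewrite [j + (_ - _)]addrA -/k.
    have [kin|kout] := boolP ((i%:Z < k) && (k <= J%:Z)).
      have /andP[k1 k2] := kin.
      rewrite exprMn /lam -[X in _ <= X]mulrA; apply: ler_pM; rewrite ?sqr_ge0 //.
        exact: window_lip.
      exact: iter_Dminus_mask_sq.
    suff -> : window J j - window J k = 0 by rewrite mul0r expr0n mulr_ge0.
    rewrite /k in kout *; have [h1|h1] := lerP k i%:Z.
      by rewrite !window_left ?subrr //; move: h1 hl ik; rewrite /k /M1; clear; lia.
    by rewrite !window_right ?subrr //; move: kout h1 hl hj; rewrite /k; clear; lia.
  have := sqr_ge0 (x - y); lra.
rewrite wsumD !wsumZ.
rewrite [X in _ + 2 * A * lam * X](wsum_exchange (I := 'I_(r + p).+1)).
have h1 : wsum 1 J (fun j => wsum (j + - i%:Z) i.+1 F2) <= i.+1%:R * sqnorm J (residual e n).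
  rewrite /sqnorm -wsum_mask; apply: wsum_masked => k; first exact: sqr_ge0.
  exact: mask_supp.
have h2 : \sum_(l < (r + p).+1)
    wsum 1 J (fun j => wsum (j + (- r%:Z + l%:Z - i%:Z)) i.+1 e2) <=
    (r + p).+1%:R * (i.+1%:R * sqnorm J (e n)).
  apply: (@le_trans _ _ (\sum_(l < (r + p).+1) (i.+1%:R * sqnorm J (e n)))).
    apply: ler_sum => l _; rewrite /sqnorm -wsum_mask.
    by apply: wsum_masked => k; [exact: sqr_ge0|exact: mask_supp].
  rewrite sumr_const card_ord -[X in X <= _]mulr_natl.
  exact: lexx.
have g1 : 2 * 4 ^+ i * wsum 1 J (fun j => wsum (j + - i%:Z) i.+1 F2) <=
    C1 * sqnorm J (residual e n).
  by rewrite /C1 -[X in _ <= X]mulrA ler_wpM2l // mulr_ge0.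
have g2 : 2 * A * lam * (\sum_(l < (r + p).+1)
    wsum 1 J (fun j => wsum (j + (- r%:Z + l%:Z - i%:Z)) i.+1 e2)) <=
    C2 * (J%:R ^- 2 * sqnorm J (e n)).
  apply: le_trans (ler_wpM2l _ h2) _; first by rewrite !mulr_ge0.
  rewrite le_eqVlt; apply/orP; left; apply/eqP; rewrite /C2 /lam [(_ / _) ^+ 2]exprMn exprVn; ring.
have := mulr_ge0 C10 (mulr_ge0 j20 (sqnorm_ge0 J (e n))).
have := mulr_ge0 C20 (sqnorm_ge0 J (residual e n)).
lra.
Qed.

Lemma windowed_sqnorm i : (i <= kb)%N -> exists2 C : R, 0 <= C &
  forall J e n, (J0 <= J)%N ->
    wsum 1 J (fun j => windowed J i e n j ^+ 2) <= C * sqnorm J (e n).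
Proof.
move=> ik; have p4 : 0 <= 4 ^+ i :> R by exact: exprn_ge0.
exists (4 ^+ i * i.+1%:R); first by rewrite mulr_ge0.
move=> J e n hJ.
apply: (@le_trans _ _ (wsum 1 J (fun j =>
  4 ^+ i * wsum (j + - i%:Z) i.+1 (fun k => mask J (e n) k ^+ 2)))).
  apply: le_wsum => j hj.
  have w0 : 0 <= wsum (j + - i%:Z) i.+1 (fun k => mask J (e n) k ^+ 2).
    by apply: wsum_ge0 => ? _; exact: sqr_ge0.
  rewrite /windowed; have [jM|Mj] := lerP j M1%:Z.
    by rewrite window_left // mul0r expr0n mulr_ge0.
  have /andP[c0 c1] := @ramp01 R (J - M1 - r - p) (j - M1%:Z).
  rewrite exprMn; apply: (@le_trans _ _ (1 * iter i Dminus (e n) j ^+ 2)).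
    by rewrite ler_wpM2r ?sqr_ge0 // expr_le1.
  rewrite mul1r; apply: iter_Dminus_mask_sq; rewrite /M1 in Mj; lia.
rewrite wsumZ -mulrA ler_wpM2l // /sqnorm -wsum_mask.
by apply: wsum_masked => k; [exact: sqr_ge0|exact: mask_supp].
Qed.

(** A dissipative boundary inequality for the half-line becomes, after summation
    in time, a bound on the boundary terms [c] by the boundary data [g]; since
    the initial data vanish, no growth in time is incurred. *)
Lemma windowed_boundary_bound i (c g : nat -> (int -> R) -> R) (kappa K : R) :
  (i <= kb)%N -> 0 < kappa -> 0 <= K ->
  (forall J U, 0 <= c J U) -> (forall J U, 0 <= g J U) ->
  (forall J U, (forall j, j <= 0 -> U j = 0) ->
    wsum 1 J (fun j => Q U j ^+ 2) + kappa * c J U <=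
    wsum 1 J (fun j => U j ^+ 2) + K * g J U) ->
  exists2 C : R, 0 <= C & forall J e N, (J0 <= J)%N ->
    (forall j, 1 <= j <= J%:Z -> e 0%N j = 0) ->
    \sum_(n < N) c J (windowed J i e n) <=
    C * \sum_(n < N) (g J (windowed J i e n) + J%:R^-1 * sqnorm J (e n)
                      + J%:R * sqnorm J (residual e n)).
Proof.
move=> ik kap0 K0 c0 g0 H.
have [C1 C10 H1] := windowed_residual ik; have [C2 C20 H2] := windowed_sqnorm ik.
pose C := 2 * K + 2 * C1 + C2.
have C0 : 0 <= C by rewrite /C; lra.
exists (C / kappa); first by rewrite divr_ge0 // ltW.
move=> J e N hJ e0.
have J1 : (1 : R) <= J%:R by rewrite ler1n; lia.
have JJ : (0 : R) < J%:R by lra.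
set W := windowed J i e.
have left n j : j <= 0 -> W n j = 0.
  by move=> hj; rewrite /W /windowed window_left ?mul0r //; lia.
rewrite mulrAC ler_pdivlMr // mulrC mulr_sumr [X in _ <= X]mulr_sumr.
apply: (@energy_summation _ (fun n => sqnorm J (W n))
  (fun n => kappa * c J (W n)) (fun n => C * (g J (W n) + J%:R^-1 * sqnorm J (e n)
                      + J%:R * sqnorm J (residual e n)))).
- apply: wsum_eq0 => j hj; rewrite /W /windowed.
  have [jM|Mj] := lerP j M1%:Z; first by rewrite window_left // mul0r expr0n.
  suff -> : iter i Dminus (e 0%N) j = 0 by rewrite mulr0 expr0n.
  apply/eqP; rewrite -sqrf_eq0 eq_le sqr_ge0 andbT.
  apply: le_trans (iter_Dminus_sq _ _ _) _; rewrite wsum_eq0 ?mulr0 // => k hk.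
  by rewrite e0 ?expr0n //; rewrite /M1 in Mj; lia.
- by move=> n; exact: sqnorm_ge0.
move=> n _.
have hG := H1 J e n hJ; have hE := H2 J e n hJ; have hB := H J (W n) (left n).
set G := wsum 1 J (fun j => residual (windowed J i e) n j ^+ 2) in hG.
have hstep : sqnorm J (W n.+1) <= (1 + J%:R^-1) * wsum 1 J (fun j => Q (W n) j ^+ 2)
    + (1 + J%:R) * G.
  apply: le_trans (wsum_sqrD_le _ _ _); last by move: hJ; rewrite /J0; clear; lia.
  rewrite le_eqVlt; apply/orP; left; apply/eqP; apply: eq_wsum => j _.
  by rewrite /residual -/W addrCA subrr addr0.
have hc := mulr_ge0 (ltW kap0) (c0 J (W n)); have hg := g0 J (W n).
have he := sqnorm_ge0 J (e n); have hr := sqnorm_ge0 J (residual e n).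
have Ji : 0 <= J%:R^-1 :> R by rewrite invr_ge0 ltW.
have Ji1 : J%:R^-1 <= 1 :> R by rewrite invf_le1.
move: hG hE hB hstep; rewrite -/W -/(sqnorm J (W n)).
set q := wsum 1 J (fun j => Q (W n) j ^+ 2).
have q0 : 0 <= q by apply: wsum_ge0 => j _; exact: sqr_ge0.
have G0 : 0 <= G by apply: wsum_ge0 => j _; exact: sqr_ge0.
have e0' := sqnorm_ge0 J (W n).
move: e0' hc hg he hr => e0' hc hg he hr hG hE hB hstep.
have a1 : (1 + J%:R^-1) * (q + kappa * c J (W n)) <=
    (1 + J%:R^-1) * (sqnorm J (W n) + K * g J (W n)).
  by rewrite ler_wpM2l //; lra.
have a2 : J%:R^-1 * sqnorm J (W n) <= J%:R^-1 * (C2 * sqnorm J (e n)).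
  by rewrite ler_wpM2l.
have a3 : 0 <= J%:R^-1 * (kappa * c J (W n)) by rewrite mulr_ge0.
have a4 : J%:R^-1 * (K * g J (W n)) <= K * g J (W n).
  by rewrite ler_piMl // mulr_ge0.
have a5 : (1 + J%:R) * G <= 2 * J%:R * G by rewrite ler_wpM2r //; lra.
have a6 : 2 * J%:R * G <= 2 * J%:R *
    (C1 * (J%:R ^- 2 * sqnorm J (e n) + sqnorm J (residual e n))).
  by rewrite ler_wpM2l //; lra.
have a7 : 2 * J%:R * (C1 * (J%:R ^- 2 * sqnorm J (e n) + sqnorm J (residual e n))) =
   2 * C1 * (J%:R^-1 * sqnorm J (e n)) + 2 * C1 * (J%:R * sqnorm J (residual e n)).
  by field; rewrite gt_eqF.
have b1 := mulr_ge0 Ji he; have b2 := mulr_ge0 (ltW JJ) hr.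
have k1 := mulr_ge0 K0 hg; have k2 := mulr_ge0 K0 b1; have k3 := mulr_ge0 K0 b2.
have k4 := mulr_ge0 C10 hg; have k5 := mulr_ge0 C10 b1; have k6 := mulr_ge0 C10 b2.
have k7 := mulr_ge0 C20 hg; have k8 := mulr_ge0 C20 b1; have k9 := mulr_ge0 C20 b2.
rewrite /C; lra.
Qed.

End Stability.

(** * Traces at the outflow boundary *)

Section OutflowTraces.
Context {R : realType} (r p kb : nat) (al : int -> R).
Local Notation Q := (step_op r p al).
Implicit Types (e : nat -> int -> R) (J n N i : nat).
Hypothesis symbol : forall theta : R, 0 <= theta <= 2 * pi ->
  `|stencil_sum r p (fun l : int => (al l)%:C%C * expi (l%:~R * theta))| <= 1.
Variable mu : R.
Hypothesis mu0 : 0 < mu.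
Hypothesis mom0 : stencil_sum r p al = 1.
Hypothesis mom1 : stencil_sum r p (fun l => l%:~R * al l) = - mu.
Hypothesis al0 : al (- r%:Z) != 0.

Local Notation frc := (forcing r p kb al).
Local Notation rsd := (residual r p al).
Let J0 := (2 * ((kb + r + p) + r + p)).+1.

Definition outflow_trace i J e n : R :=
  wsum (J%:Z + 1 - r%:Z) (r + p) (fun j => iter i Dminus (e n) j ^+ 2).

(** The forcing together with the part of the energy that the localization near
    the boundary injects at each time step. *)
Definition drive J e n : R := J%:R^-1 * sqnorm J (e n) + frc J e n.

Lemma forcing_ge0 J e n : 0 <= frc J e n.
Proof.
by rewrite !addr_ge0 ?mulr_ge0 ?sqnorm_ge0 //; apply: wsum_ge0 => j _; exact: sqr_ge0.
Qed.

Lemma drive_ge0 J e n : 0 <= drive J e n.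
Proof. by rewrite addr_ge0 ?forcing_ge0 // mulr_ge0 ?sqnorm_ge0 // invr_ge0. Qed.

Lemma drive_ge J e n :
  J%:R^-1 * sqnorm J (e n) + J%:R * sqnorm J (rsd e n) <= drive J e n.
Proof.
rewrite lerD2l lerDr addr_ge0 //; apply: wsum_ge0 => j _; exact: sqr_ge0.
Qed.

Lemma windowed_near i J e n (j : int) : (J0 <= J)%N -> J%:Z - r%:Z <= j ->
  windowed r p kb J i e n j = iter i Dminus (e n) j.
Proof. by move=> hJ hj; rewrite /windowed window_right ?mul1r //; lia. Qed.

(** For the differences of order [kb] the outflow condition prescribes the ghost
    values themselves, the defect in the condition being part of the forcing;
    this is the situation of [boundary_step_dirichlet]. *)
Lemma outflow_trace_top : exists2 C : R, 0 <= C & forall J e N, (J0 <= J)%N ->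
  (forall j, 1 <= j <= J%:Z -> e 0%N j = 0) ->
  \sum_(n < N) outflow_trace kb J e n <= C * \sum_(n < N) drive J e n.
Proof.
have [[kap K] /= [kap0 K0 H]] := boundary_step_dirichlet symbol al0.
have [||C C0 HC] := @windowed_boundary_bound R r p kb al kb
   (fun J U => wsum (J%:Z + 1 - r%:Z) r (fun j => U j ^+ 2))
   (fun J U => wsum (J%:Z + 1) p (fun j => U j ^+ 2)) kap K (leqnn _) kap0 K0 _ _ H.
- by move=> J U; apply: wsum_ge0 => j _; exact: sqr_ge0.
- by move=> J U; apply: wsum_ge0 => j _; exact: sqr_ge0.
exists (C + 1); first by lra.
move=> J e N hJ e0; have {}HC := HC J e N hJ e0.
have D0 : 0 <= \sum_(n < N) drive J e n by apply: sumr_ge0 => n _; exact: drive_ge0.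
have E n : outflow_trace kb J e n =
    wsum (J%:Z + 1 - r%:Z) r (fun j => windowed r p kb J kb e n j ^+ 2) +
    wsum (J%:Z + 1) p (fun j => windowed r p kb J kb e n j ^+ 2).
  rewrite /outflow_trace wsum_cat (_ : J%:Z + 1 - r%:Z + r%:Z = J%:Z + 1); last lia.
  by congr (_ + _); apply: eq_wsum => j hj; rewrite windowed_near //; lia.
have F n : wsum (J%:Z + 1) p (fun j => windowed r p kb J kb e n j ^+ 2) =
    wsum (J%:Z + 1) p (fun j => iter kb Dminus (e n) j ^+ 2).
  by apply: eq_wsum => j hj; rewrite windowed_near //; lia.
under eq_bigr do rewrite E F.
rewrite big_split /= mulrDl mul1r; apply: lerD.
  apply: le_trans HC _; rewrite ler_wpM2l //; apply: ler_sum => n _.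
  rewrite F /drive /forcing.
  have : 0 <= wsum (1 - r%:Z) r (fun j => e n j ^+ 2).
    by apply: wsum_ge0 => j _; exact: sqr_ge0.
  lra.
apply: ler_sum => n _; apply: le_trans (_ : frc J e n <= _).
  rewrite /forcing.
  have : 0 <= wsum (1 - r%:Z) r (fun j => e n j ^+ 2).
    by apply: wsum_ge0 => j _; exact: sqr_ge0.
  have : 0 <= J%:R * sqnorm J (rsd e n) by rewrite mulr_ge0 ?sqnorm_ge0.
  lra.
by rewrite lerDr mulr_ge0 ?sqnorm_ge0 // invr_ge0.
Qed.

(** Near the outflow boundary, the [i]-th difference is constant up to its own
    difference, so that control of the order [i.+1] gives control of the order
    [i] by the dissipation of nearly constant states. *)
Lemma outflow_trace_step i : (i < kb)%N ->
  exists2 C : R, 0 <= C & forall J e N, (J0 <= J)%N ->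
  (forall j, 1 <= j <= J%:Z -> e 0%N j = 0) ->
  \sum_(n < N) outflow_trace i J e n <=
    C * \sum_(n < N) (outflow_trace i.+1 J e n + drive J e n).
Proof.
move=> ik.
have [[kap K] /= [kap0 K0 H]] := boundary_step_neumann symbol mu0 mom0 mom1.
pose g J (U : int -> R) :=
  wsum (1 - r%:Z) (r + p) (fun m => (U (J%:Z + m) - U J%:Z) ^+ 2).
have [||C C0 HC] := @windowed_boundary_bound R r p kb al i
   (fun J U => U J%:Z ^+ 2) g kap K (ltnW ik) kap0 K0 _ _ H.
- by move=> J U; exact: sqr_ge0.
- by move=> J U; apply: wsum_ge0 => j _; exact: sqr_ge0.
pose m := (r + p)%:R : R; have m0 : 0 <= m by exact: ler0n.
pose B := C * (m * m + 1); have B0 : 0 <= B by rewrite mulr_ge0 // addr_ge0 ?mulr_ge0.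
have mB : 0 <= m * B by exact: mulr_ge0.
have mm : 0 <= m * m by exact: mulr_ge0.
exists (2 * (m * m) + 2 * m * B); first by lra.
move=> J e N hJ e0; have {}HC := HC J e N hJ e0.
have gE n : g J (windowed r p kb J i e n) <= m * m * outflow_trace i.+1 J e n.
  rewrite /g; apply: (@le_trans _ _ (wsum (1 - r%:Z) (r + p) (fun=>
      m * outflow_trace i.+1 J e n))).
    apply: le_wsum => l hl; rewrite !windowed_near //; [|move: hl; clear; lia..].
    by apply: trace_difference; move: hl; clear; lia.
  by rewrite wsum_const mulrA.
have tr0 q n : 0 <= outflow_trace q J e n.
  by apply: wsum_ge0 => j _; exact: sqr_ge0.
pose S := \sum_(n < N) (outflow_trace i.+1 J e n + drive J e n).
have hS : \sum_(n < N) windowed r p kb J i e n J%:Z ^+ 2 <= B * S.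
  apply: le_trans HC _; rewrite /B -mulrA ler_wpM2l // /S mulr_sumr.
  apply: ler_sum => n _.
  have := gE n; have := drive_ge J e n; have := drive_ge0 J e n; have := tr0 i.+1 n.
  move=> a1 a2 a3 a4.
  have : 0 <= m * m * drive J e n by rewrite !mulr_ge0.
  lra.
have trE n : outflow_trace i J e n <=
    2 * (m * m) * (outflow_trace i.+1 J e n + drive J e n)
    + 2 * m * windowed r p kb J i e n J%:Z ^+ 2.
  rewrite windowed_near //; last by clear; lia.
  apply: (@le_trans _ _ (wsum (1 - r%:Z) (r + p) (fun=>
      2 * (m * outflow_trace i.+1 J e n) + 2 * iter i Dminus (e n) J%:Z ^+ 2))).
    rewrite /outflow_trace (_ : J%:Z + 1 - r%:Z = 1 - r%:Z + J%:Z); last by clear; lia.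
    rewrite -wsum_shift; apply: le_wsum => l hl.
    have := @trace_difference R J%:Z r p (iter i Dminus (e n)) l.
    rewrite (_ : J%:Z + 1 - r%:Z = 1 - r%:Z + J%:Z); last by clear; lia.
    rewrite [J%:Z + l]addrC => /(_ _)/le_trans h; have {}h := h _ _ (lexx _).
    have {}h : (iter i Dminus (e n) (l + J%:Z) - iter i Dminus (e n) J%:Z) ^+ 2 <=
       m * wsum (1 - r%:Z + J%:Z) (r + p) (fun j => iter i.+1 Dminus (e n) j ^+ 2).
      by apply: h; move: hl; clear; lia.
    move: h; set x := iter i _ _ _; set y := iter i _ _ _ => h.
    have := sqr_ge0 (x - 2 * y); lra.
  rewrite wsum_const -/m.
  have : 0 <= m * m * drive J e n by rewrite !mulr_ge0 ?drive_ge0.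
  lra.
apply: le_trans (ler_sum _ (fun (n : 'I_N) _ => trE n)) _.
rewrite big_split /= -!mulr_sumr -/S [X in _ <= X]mulrDl -[2 * m * B * S]mulrA.
by rewrite lerD2l ler_wpM2l // mulr_ge0.
Qed.

(** Downward induction on the order, from [outflow_trace_top] by
    [outflow_trace_step]. *)
Lemma outflow_trace_bound i : (i <= kb)%N ->
  exists2 C : R, 0 <= C & forall J e N, (J0 <= J)%N ->
  (forall j, 1 <= j <= J%:Z -> e 0%N j = 0) ->
  \sum_(n < N) outflow_trace i J e n <= C * \sum_(n < N) drive J e n.
Proof.
move=> ik; rewrite -(subKn ik); elim: (kb - i)%N => [|q [C C0 IH]].
  by rewrite subn0; exact: outflow_trace_top.
have [qk|kq] := ltnP q kb; last first.
  rewrite (_ : (kb - q.+1)%N = (kb - q)%N); first by exists C.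
  by move: kq; clear; lia.
have [|C' C'0 H] := @outflow_trace_step (kb - q.+1); first by move: qk; clear; lia.
exists (C' * (C + 1)); first by rewrite mulr_ge0 //; lra.
move=> J e N hJ e0; apply: le_trans (H J e N hJ e0) _; rewrite -mulrA ler_wpM2l //.
rewrite big_split /= mulrDl mul1r lerD2r.
by have := IH J e N hJ e0; rewrite subnSK.
Qed.

End OutflowTraces.

(** * Stability *)

Section StabilityEstimate.
Context {R : realType} (r p kb : nat) (al : int -> R).
Local Notation Q := (step_op r p al).
Implicit Types (e : nat -> int -> R) (J n N i : nat).

(** The outflow condition determines the ghost values successively from interior
    values, up to its defect. The constant multiplies the whole interior energy,
    which is affordable only for the finitely many small values of [J]. *)
Lemma ghost_values_le m : exists2 C : R, 0 <= C & forall J (v : int -> R),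
  kb%:Z - r%:Z <= J%:Z ->
  wsum (J%:Z + 1) m (fun j => v j ^+ 2) <=
  C * (wsum (1 - r%:Z) (r + J) (fun j => v j ^+ 2)
       + wsum (J%:Z + 1) m (fun j => iter kb Dminus v j ^+ 2)).
Proof.
elim: m => [|m [C C0 IH]]; first by exists 0 => // J v _; rewrite wsum0 mul0r.
have p4 : 0 <= 4 ^+ kb :> R by exact: exprn_ge0.
have pC : 0 <= 4 ^+ kb * C by rewrite mulr_ge0.
exists (C + 2 + 2 * 4 ^+ kb * (C + 1)); first by lra.
move=> J v hJ; rewrite !wsumSr; have {}IH := IH J v hJ.
have := sub_iter_Dminus_sq kb v (J%:Z + 1 + m%:Z).
set x := v _; set y := iter _ _ _ _ => h.
have : wsum (J%:Z + 1 + m%:Z - kb%:Z) kb (fun k => v k ^+ 2) <=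
   wsum (1 - r%:Z) (r + J + m) (fun j => v j ^+ 2).
  by apply: wsum_sub => [||j _]; [move: hJ; clear; lia..|exact: sqr_ge0].
rewrite wsum_cat (_ : 1 - r%:Z + (r + J)%:Z = J%:Z + 1); last by clear; lia.
move: IH h; set a := wsum (1 - r%:Z) _ _; set b := wsum _ m _; set d := wsum _ m _.
set w := wsum _ kb _ => IH h hw.
have a0 : 0 <= a by apply: wsum_ge0 => j _; exact: sqr_ge0.
have d0 : 0 <= d by apply: wsum_ge0 => j _; exact: sqr_ge0.
have hx : x ^+ 2 <= 2 * y ^+ 2 + 2 * (x - y) ^+ 2 by have := sqr_ge0 (x - 2 * y); lra.
have k1 : 4 ^+ kb * w <= 4 ^+ kb * (a + C * (a + d)) by rewrite ler_wpM2l //; lra.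
have y0 := sqr_ge0 y.
have := mulr_ge0 p4 d0; have := mulr_ge0 p4 y0; have := mulr_ge0 pC y0.
have := mulr_ge0 C0 y0; lra.
Qed.

Hypothesis symbol : forall theta : R, 0 <= theta <= 2 * pi ->
  `|stencil_sum r p (fun l : int => (al l)%:C%C * expi (l%:~R * theta))| <= 1.
Variable mu : R.
Hypothesis mu0 : 0 < mu.
Hypothesis mom0 : stencil_sum r p al = 1.
Hypothesis mom1 : stencil_sum r p (fun l => l%:~R * al l) = - mu.
Hypothesis al0 : al (- r%:Z) != 0.

(** For large [J] the ghost values are among the traces of order 0. For small [J]
    the interior energy is at most a constant times [1 / J] times itself, and
    the direct elimination of [ghost_values_le] is enough. *)
Lemma ghost_values_bound : exists2 C : R, 0 <= C & forall J e N, (0 < J)%N ->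
  kb%:Z - r%:Z <= J%:Z -> (forall j, 1 <= j <= J%:Z -> e 0%N j = 0) ->
  \sum_(n < N) wsum (J%:Z + 1) p (fun j => e n j ^+ 2) <=
  C * \sum_(n < N) drive r p kb al J e n.
Proof.
pose J0 := (2 * ((kb + r + p) + r + p)).+1.
have [C1 C10 H1] := outflow_trace_bound symbol mu0 mom0 mom1 al0 (leq0n kb).
have [C2 C20 H2] := ghost_values_le p.
exists (C1 + C2 * J0%:R); first by rewrite addr_ge0 // mulr_ge0.
move=> J e N J1 hJ e0.
have D0 : 0 <= \sum_(n < N) drive r p kb al J e n.
  by apply: sumr_ge0 => n _; exact: drive_ge0.
rewrite mulrDl; have [hJ0|hJ0] := leqP J0 J.
  apply: le_trans (_ : _ <= C1 * \sum_(n < N) drive r p kb al J e n) _; last first.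
    by rewrite lerDl mulr_ge0 // mulr_ge0.
  apply: le_trans (H1 J e N hJ0 e0); apply: ler_sum => n _.
  by apply: wsum_sub => [||j _]; [clear; lia|clear; lia|exact: sqr_ge0].
apply: le_trans (_ : _ <= C2 * J0%:R * \sum_(n < N) drive r p kb al J e n) _; last first.
  by rewrite lerDr mulr_ge0.
rewrite mulr_sumr; apply: ler_sum => n _.
apply: le_trans (H2 J (e n) hJ) _; rewrite -mulrA ler_wpM2l // /drive /forcing.
rewrite wsum_cat (_ : 1 - r%:Z + r%:Z = 1); last by clear; lia.
rewrite -[wsum 1 J _]/(sqnorm J (e n)).
have h1 : 0 <= wsum (1 - r%:Z) r (fun j => e n j ^+ 2).
  by apply: wsum_ge0 => j _; exact: sqr_ge0.
have h2 : 0 <= wsum (J%:Z + 1) p (fun j => iter kb Dminus (e n) j ^+ 2).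
  by apply: wsum_ge0 => j _; exact: sqr_ge0.
have h3 := sqnorm_ge0 J (e n); have h4 := sqnorm_ge0 J (residual r p al e n).
have JJ : (0 : R) < J%:R by rewrite ltr0n.
have J01 : (1 : R) <= J0%:R by rewrite ler1n.
have h5 : sqnorm J (e n) <= J0%:R * (J%:R^-1 * sqnorm J (e n)).
  rewrite mulrA ler_peMl // ler_pdivlMr // mul1r ler_nat; exact: ltnW.
move: h5; set z := J%:R^-1 * _ => h5.
have h6 : 0 <= (J0%:R - 1) * wsum (1 - r%:Z) r (fun j => e n j ^+ 2).
  by rewrite mulr_ge0 // subr_ge0.
have h7 : 0 <= (J0%:R - 1) * wsum (J%:Z + 1) p (fun j => iter kb Dminus (e n) j ^+ 2).
  by rewrite mulr_ge0 // subr_ge0.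
have h8 : 0 <= J0%:R * (J%:R * sqnorm J (residual r p al e n)).
  by rewrite !mulr_ge0.
lra.
Qed.

(** One step of the contraction property costs the energy of the ghost values.
    Their sum in time is bounded by the forcing and by the sum of the energies
    divided by [J], which the discrete Gronwall inequality turns into the
    exponential of [N / J]. *)
Lemma stability : exists2 C : R, 0 <= C & forall J e N, (0 < J)%N ->
  kb%:Z - r%:Z <= J%:Z -> (forall j, 1 <= j <= J%:Z -> e 0%N j = 0) ->
  sqnorm J (e N) <=
  C * expR (C * N%:R / J%:R) * \sum_(n < N) forcing r p kb al J e n.
Proof.
have [C C0 HC] := ghost_values_bound.
exists (2 + 2 * C); first by lra.
move=> J e N J1 hJ e0.
have JJ : (0 : R) < J%:R by rewrite ltr0n.
have Ji : 0 <= J%:R^-1 :> R by rewrite invr_ge0 ltW.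
have Ji1 : J%:R^-1 <= 1 :> R by rewrite invf_le1 // ler1n.
have J1' : (1 : R) <= J%:R by rewrite ler1n.
pose gh n := wsum (J%:Z + 1) p (fun j => e n j ^+ 2).
pose F n := forcing r p kb al J e n.
have F0 n : 0 <= F n by exact: forcing_ge0.
have step n : sqnorm J (e n.+1) <= sqnorm J (e n) +
    (J%:R^-1 * sqnorm J (e n) + 2 * F n + 2 * gh n).
  (* Only the ghost and interior values enter the update of interior cells. *)
  pose U j := if 1 - r%:Z <= j <= J%:Z + p%:Z then e n j else 0.
  have Us j : ~~ (1 - r%:Z <= j < 1 - r%:Z + (r + J + p)%:Z) -> U j = 0.
    by move=> h; rewrite /U ifF //; move: h; clear; lia.
  have := step_op_contraction symbol 1 J Us.
  rewrite (@eq_wsum _ (1 - r%:Z) (r + J + p) (fun j => U j ^+ 2) (fun j => e n j ^+ 2)); last first.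
    by move=> j hj; rewrite /U ifT //; move: hj; clear; lia.
  rewrite (@eq_wsum _ 1 J (fun j => Q U j ^+ 2) (fun j => Q (e n) j ^+ 2)); last first.
    move=> j hj; congr (_ ^+ 2); apply: step_op_dep => i hi.
    by rewrite /U ifT //; move: hj hi; clear; lia.
  rewrite (wsum_cat _ (r + J)) wsum_cat (_ : 1 - r%:Z + r%:Z = 1); last by clear; lia.
  rewrite (_ : 1 - r%:Z + (r + J)%:Z = J%:Z + 1); last by clear; lia.
  rewrite -/(gh n) -/(sqnorm J (e n)) => hQ.
  have : sqnorm J (e n.+1) <= (1 + J%:R^-1) * wsum 1 J (fun j => Q (e n) j ^+ 2)
      + (1 + J%:R) * sqnorm J (residual r p al e n).
    apply: le_trans (wsum_sqrD_le _ _ J1); rewrite le_eqVlt; apply/orP; left; apply/eqP.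
    by apply: eq_wsum => j _; rewrite /residual addrCA subrr addr0.
  rewrite /F /forcing.
  have : 0 <= wsum (J%:Z + 1) p (fun j => iter kb Dminus (e n) j ^+ 2).
    by apply: wsum_ge0 => j _; exact: sqr_ge0.
  have : 0 <= wsum (1 - r%:Z) r (fun j => e n j ^+ 2).
    by apply: wsum_ge0 => j _; exact: sqr_ge0.
  have g0 : 0 <= gh n by apply: wsum_ge0 => j _; exact: sqr_ge0.
  move: hQ (sqnorm_ge0 J (residual r p al e n)) (sqnorm_ge0 J (e n)).
  set q := wsum 1 J _; set y := wsum (1 - r%:Z) _ _; set z := sqnorm J (e n).
  set x := sqnorm J (residual r p al e n); set w := wsum _ _ _ => hQ x0 z0 y0 w0 h.
  have k1 : (1 + J%:R^-1) * q <= (1 + J%:R^-1) * (y + z + gh n).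
    by rewrite ler_wpM2l //; lra.
  have k2 : 0 <= (1 - J%:R^-1) * (y + gh n) by rewrite mulr_ge0 //; lra.
  have k3 : (1 + J%:R) * x <= 2 * J%:R * x by rewrite ler_wpM2r //; lra.
  lra.
have tot n : sqnorm J (e n) <=
    \sum_(m < n) (J%:R^-1 * sqnorm J (e m) + 2 * F m + 2 * gh m).
  elim: n => [|n IH].
    rewrite big_ord0 le_eqVlt; apply/orP; left; apply/eqP.
    by apply: wsum_eq0 => j hj; rewrite e0 ?expr0n //; move: hj; clear; lia.
  by rewrite big_ord_recr /=; have := step n; lra.
have := @gronwall R (fun n => sqnorm J (e n)) (fun n => (2 + 2 * C) * F n)
  ((2 + 2 * C) / J%:R) N.
rewrite -mulr_sumr mulrA [expR _ * _]mulrC [_ / _ * N%:R]mulrAC; apply.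
- by rewrite divr_ge0 //; lra.
- by move=> n; rewrite mulr_ge0 //; lra.
move=> n _; apply: le_trans (tot n) _.
rewrite big_split /= -[X in _ + X <= _]mulr_sumr.
apply: le_trans (_ : _ <= \sum_(m < n) (J%:R^-1 * sqnorm J (e m) + 2 * F m) +
    2 * (C * \sum_(m < n) drive r p kb al J e m)) _.
  by rewrite lerD2l ler_wpM2l //; exact: HC.
rewrite !mulr_sumr -big_split /=; apply: ler_sum => m _; rewrite /drive -/(F m).
have := F0 m; have := mulr_ge0 Ji (sqnorm_ge0 J (e m)); lra.
Qed.

End StabilityEstimate.

(** * Calculus on the line *)

Section Calculus.
Context {R : realType}.
Local Notation mu := (@lebesgue_measure R).
Implicit Types (f g : R -> R) (x y : R).

Lemma is_derive_continuous f x d : is_derive x 1 f d -> {for x, continuous f}.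
Proof. by move=> H; apply: differentiable_continuous; apply/derivable1_diffP; exact: ex_derive. Qed.

Lemma is_derive_quadratic f x C :
  (forall h, `|f (h + x) - f x| <= C * h ^+ 2) -> is_derive x 1 f 0.
Proof.
move=> H; have C0 : 0 <= C.
  by have := H 1; rewrite expr1n mulr1; apply: le_trans.
suff L : h^-1 *: (f (h *: (1 : R) + x) - f x) @[h --> 0^'] --> (0 : R).
  apply: DeriveDef; first by apply/cvg_ex; exists 0.
  by apply: cvg_lim L.
apply/cvgr0Pnorm_le => e e0.
near=> h.
have h0 : h != 0 by near: h; exact: nbhs_dnbhs_neq.
rewrite normrZ normfV ler_pdivrMl ?normr_gt0 // [h *: _]mulr1.
apply: le_trans (H h) _; rewrite -real_normK ?num_real // expr2 mulrCA ler_pM2l ?normr_gt0 //.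
have he : `|h| <= e / (C + 1).
  near: h; apply: dnbhs0_le; rewrite divr_gt0 //; lra.
move: he; rewrite ler_pdivlMr; last by lra.
have := normr_ge0 h; nra.
Unshelve. all: by end_near. Qed.

Lemma continuous_integrable_itv f (a b : R) : (forall x, {for x, continuous f}) ->
  mu.-integrable `[a, b] (EFin \o f).
Proof.
move=> cf; apply: continuous_compact_integrable; first exact: segment_compact.
by apply: continuous_subspaceT.
Qed.

(** The primitive is built from integrals with a base point far to the left of
    the argument, integrals over reversed intervals being zero by convention. *)
Lemma exists_primitive f c : (forall x, {for x, continuous f}) ->
  exists2 F, F 0 = c & forall x, is_derive x 1 F (f x).
Proof.
move=> cf.
pose P (a x : R) : R := \int[mu]_(t in `[a, x]) f t.
have PB a b x : a <= b -> b <= x -> P a x = P a b + P b x.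
  move=> ab bx; have := @Rintegral_itvB R f (BLeft a) (BRight x) b.
  rewrite Rintegral_itv_obnd_cbnd; last first.
    by apply: integrableS (continuous_integrable_itv b x cf) => //; exact: subset_itv_oc_cc.
  move=> /(_ (continuous_integrable_itv a x cf)); rewrite !bnd_simp => /(_ ab bx).
  by rewrite /P => <-; rewrite addrC subrK.
have D a x : a < x -> is_derive x 1 (P a) (f x).
  move=> ax; have [] := @continuous_FTC1 R f (BLeft a) x (x + 1).
  - by lra.
  - exact: continuous_integrable_itv.
  - exact: ax.
  - exact: cf.
  by move=> d1; rewrite derive1E => d2; apply: DeriveDef d1 d2.
pose N x : R := - (`|x| + 1).
have P00 a : P a a = 0 by rewrite /P set_itv1 Rintegral_set1.
exists (fun x => c + (P (N x) x - P (N x) 0)).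
  by rewrite subrr addr0.
have E (a b x : R) : a <= b -> b <= x -> b <= 0 -> P a x - P a 0 = P b x - P b 0.
  by move=> ab bx b0; rewrite (PB a b x) // (PB a b 0) //; rewrite opprD addrACA subrr add0r.
move=> x; pose a := - (`|x| + 2).
have ax : a < x by rewrite /a; have := ler_norm (- x); rewrite normrN; lra.
apply: (@near_eq_is_derive _ _ _ (fun y => c - P a 0 + P a y)).
  near=> y; have yx : `|y - x| < 1.
    by near: y; apply/nbhs_ballP; exists 1 => //= y; rewrite /ball/= distrC.
  have h1 := ler_norm (- y); have h2 := normr_ge0 y.
  have h3 : `|y| <= `|x| + `|y - x|.
    by rewrite -[y in `|y| <= _](subrK x) addrC; exact: ler_normD.
  rewrite normrN in h1.
  by rewrite -(E a (N y) y) /N /a //; lra.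
have DP := D a x ax.
by have := is_deriveD (is_derive_cst (c - P a 0) x (1 : R)) DP; rewrite add0r.
Unshelve. all: by end_near. Qed.

Lemma derive_bound f (df : R -> R) a b K : a <= b ->
  (forall x, a <= x <= b -> is_derive x 1 f (df x)) ->
  (forall x, a <= x <= b -> `|df x| <= K) -> `|f b - f a| <= K * (b - a).
Proof.
move=> ab D B.
have [||c] := @MVT_segment R f df a b ab.
- by move=> x; rewrite in_itv /= => /andP[h1 h2]; apply: D; rewrite !ltW.
- apply: derivable_within_continuous => x; rewrite in_itv /= => h.
  by have := D x h => ?; exact: ex_derive.
rewrite in_itv /= => h ->; rewrite normrM [`|b - a|]ger0_norm ?subr_ge0 //.
by rewrite ler_wpM2r ?subr_ge0 // B.
Qed.

End Calculus.

(** * A smooth step *)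

Section Smooth.
Context {R : realType}.
Implicit Types (f g : R -> R) (x y : R) (n m : nat).

(** Smoothness counted by the number of derivatives, for proofs by induction on
    it. *)
Definition nsmooth n f := forall m, (m < n)%N -> forall x, derivable (derive1n m f) x 1.

Lemma derive1_is_derive f f' : (forall x, is_derive x 1 f (f' x)) -> derive1 f = f'.
Proof. by move=> H; apply/funext => x; rewrite derive1E; exact: derive_val. Qed.

Lemma nsmoothS n f f' : (forall x, is_derive x 1 f (f' x)) -> nsmooth n f' -> nsmooth n.+1 f.
Proof.
move=> D S [|m] mn x; first by have := D x => ?; exact: ex_derive.
by rewrite /derive1n iterSr (derive1_is_derive D); exact: S.
Qed.

Lemma nsmooth_derive n f : nsmooth n.+1 f ->
  (forall x, is_derive x 1 f (derive1 f x)) /\ nsmooth n (derive1 f).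
Proof.
move=> S; split=> [x|m mn x].
  by apply: DeriveDef; [exact: (S 0%N)|rewrite derive1E].
by have := S m.+1 mn x; rewrite /derive1n iterSr.
Qed.

Lemma nsmoothW n f : nsmooth n.+1 f -> nsmooth n f.
Proof. by move=> S m mn; apply: S; exact: ltnW. Qed.

Lemma nsmooth0 f : nsmooth 0 f.
Proof. by move=> m; rewrite ltn0. Qed.

Lemma nsmooth_cst n (c : R) : nsmooth n (fun=> c).
Proof.
elim: n c => [|n IH] c; [exact: nsmooth0|]; by apply: (@nsmoothS _ _ (fun=> 0)).
Qed.

Lemma nsmoothD n f g : nsmooth n f -> nsmooth n g -> nsmooth n (fun x => f x + g x).
Proof.
elim: n f g => [|n IH] f g; first by move=> _ _; exact: nsmooth0.
move=> /nsmooth_derive[df sf] /nsmooth_derive[dg sg].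
by apply: (@nsmoothS _ _ (fun x => derive1 f x + derive1 g x)); exact: IH.
Qed.

Lemma nsmoothM n f g : nsmooth n f -> nsmooth n g -> nsmooth n (fun x => f x * g x).
Proof.
elim: n f g => [|n IH] f g sf sg; first exact: nsmooth0.
have [df df'] := nsmooth_derive sf; have [dg dg'] := nsmooth_derive sg.
have D x : is_derive x 1 (fun x => f x * g x) (f x * derive1 g x + g x * derive1 f x).
  exact: is_deriveM (df x) (dg x).
apply: (nsmoothS D).
exact: nsmoothD (IH _ _ (nsmoothW sf) dg') (IH _ _ (nsmoothW sg) df').
Qed.

Lemma nsmooth_affine n f (c d : R) : nsmooth n f -> nsmooth n (fun x => f (c * x + d)).
Proof.
elim: n f => [|n IH] f sf; first exact: nsmooth0.
have [df df'] := nsmooth_derive sf.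
have D x : is_derive x 1 (fun x => f (c * x + d)) (derive1 f (c * x + d) * c).
  have := @is_derive1_comp R f (fun x => c * x + d) x (derive1 f (c * x + d)) c (df _).
  apply; have := is_deriveD (is_deriveZ c (is_derive_id x (1 : R))) (is_derive_cst d x (1 : R)).
  by rewrite addr0 [c *: 1]mulr1.
apply: (nsmoothS D); by apply: nsmoothM; [exact: IH|exact: nsmooth_cst].
Qed.

(** The derivatives of [exp (- 1 / x)], extended by 0, are linear combinations of
    the functions of this family. *)
Definition flat n x : R := if 0 < x then x^-1 ^+ n * expR (- x^-1) else 0.

Lemma flat_le0 n x : x <= 0 -> flat n x = 0.
Proof. by rewrite /flat leNgt => /negbTE ->. Qed.

Lemma flat_gt0 n x : 0 < x -> 0 < flat n x.
Proof. by move=> h; rewrite /flat h mulr_gt0 ?exprn_gt0 ?invr_gt0 ?expR_gt0. Qed.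

Lemma flat_ge0 n x : 0 <= flat n x.
Proof.
by have [/(flat_gt0 n)/ltW//|h] := ltP 0 x; rewrite flat_le0.
Qed.

Lemma flatS n x : flat n x = x * flat n.+1 x.
Proof.
rewrite /flat; case: ifP => [h|]; last by rewrite mulr0.
by rewrite exprS !mulrA divff ?mul1r ?gt_eqF.
Qed.

Lemma flat_le n x : flat n x <= n%:R ^+ n.
Proof.
have [h|h] := ltP 0 x; last by rewrite flat_le0 // exprn_ge0.
rewrite /flat h; have y0 : 0 < x^-1 by rewrite invr_gt0.
move: (x^-1) y0 => y y0; case: n => [|n].
  by rewrite !expr0 mul1r -expR0 ler_expR oppr_le0 ltW.
rewrite expRN ler_pdivrMr ?expR_gt0 //.
have -> : y = n.+1%:R * (y / n.+1%:R) by rewrite mulrC divfK.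
rewrite exprMn expRM_natl ler_wpM2l ?exprn_ge0 // lerXn2r ?nnegrE ?expR_ge0 //.
  by rewrite divr_ge0 // ltW.
by apply: le_trans (expR_ge1Dx _); rewrite lerDr.
Qed.

Lemma flat_derive n x : is_derive x 1 (flat n) (flat n.+2 x - n%:R * flat n.+1 x).
Proof.
have [x0|x0|x0] := ltgtP x 0.
- rewrite !flat_le0 ?(ltW x0) // mulr0 subr0.
  apply: (@near_eq_is_derive _ _ _ (fun=> 0) (flat n) x 1 0 _ (is_derive_cst (0 : R) x (1 : R))).
  by near=> y; rewrite flat_le0 // ltW //; near: y; exact: lt_nbhsl.
- apply: (@near_eq_is_derive _ _ _ (fun y => y^-1 ^+ n * expR (- y^-1))).
    by near=> y; rewrite /flat ifT //; near: y; exact: lt_nbhsr.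
  have xn0 : x != 0 by rewrite gt_eqF.
  have dV : is_derive x 1 (fun y : R => y^-1) (- x ^- 2).
    by have := is_deriveV xn0 (is_derive_id x (1 : R)); rewrite [_ *: 1]mulr1.
  have dN : is_derive x 1 (fun y : R => - y^-1) (x ^- 2).
    by have := is_deriveN dV; rewrite opprK.
  have dE := @is_derive1_comp R expR (fun y : R => - y^-1) x _ _ (is_derive_expR (- x^-1)) dN.
  have := is_deriveM (@is_deriveX R R (fun y : R => y^-1) n x 1 _ dV) dE.
  rewrite exprfctE => H; apply: (is_derive_eq H).
  rewrite /flat x0 /= -[x ^- 2]exprVn /GRing.scale /=.
  move: (x^-1) => u; move: (expR _) => e.
  by case: n H => [|n] _ /=; [rewrite !expr0; ring|rewrite !exprS; ring].
- rewrite x0 !flat_le0 // mulr0 subr0.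
  (* At the origin: [flat n x = x ^ 2 * flat n.+2 x] with a bounded factor. *)
  apply: (@is_derive_quadratic _ _ _ (n.+2%:R ^+ n.+2)) => h.
  rewrite addr0 [flat n 0]flat_le0 // subr0 ger0_norm ?flat_ge0 //.
  rewrite flatS flatS mulrA -expr2 mulrC ler_wpM2r ?sqr_ge0 //; exact: flat_le.
Unshelve. all: by end_near. Qed.

Lemma flat_smooth m n : nsmooth m (flat n).
Proof.
elim: m n => [|m IH] n; first exact: nsmooth0.
have D x : is_derive x 1 (flat n) (flat n.+2 x + - n%:R * flat n.+1 x).
  by rewrite mulNr; exact: flat_derive.
apply: (nsmoothS D); apply: (nsmoothD (IH _)).
by apply: nsmoothM; [exact: nsmooth_cst|exact: IH].
Qed.

(** A smooth transition from 0 to 1: the normalized primitive of the standard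
    bump [flat 0 x * flat 0 (1 - x)]. *)
Lemma exists_smooth_step : exists S B : R -> R, exists K : R,
  [/\ forall n, nsmooth n S, forall x, is_derive x 1 S (B x),
      (forall x, x <= 0 -> S x = 0) /\ (forall x, 1 <= x -> S x = 1),
      (forall x, x <= 0 -> B x = 0) /\ (forall x, 1 <= x -> B x = 0) &
      (forall x, {for x, continuous B}) /\ forall x, 0 <= B x <= K].
Proof.
pose b x : R := flat 0 x * flat 0 (-1 * x + 1).
have sb n : nsmooth n b.
  by apply: nsmoothM; [exact: flat_smooth|apply: nsmooth_affine; exact: flat_smooth].
have bc x : {for x, continuous b}.
  by have [D _] := nsmooth_derive (sb 1%N); apply: is_derive_continuous (D x).
have b0 x : x <= 0 -> b x = 0 by move=> h; rewrite /b flat_le0 ?mul0r.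
have b1 x : 1 <= x -> b x = 0.
  by move=> h; rewrite /b [flat 0 (_ + _)]flat_le0 ?mulr0 //; lra.
have bge x : 0 <= b x by rewrite mulr_ge0 ?flat_ge0.
have ble x : b x <= 1.
  have := flat_le 0 x; have := flat_le 0 (-1 * x + 1).
  rewrite expr0 => h1 h2; rewrite -[1]mulr1; apply: ler_pM => //; exact: flat_ge0.
have [F F0 dF] := exists_primitive 0 bc.
have Fcst x y : x <= y -> (forall z, x <= z <= y -> b z = 0) -> F y = F x.
  move=> xy h; apply/eqP; rewrite -subr_eq0 -normr_le0.
  rewrite -[X in _ <= X](mul0r (y - x)); apply: (derive_bound xy (df := b)) => z hz.
  by rewrite h // normr0.
have Fl x : x <= 0 -> F x = 0.
  by move=> h; rewrite -F0; apply/esym/Fcst => // z /andP[_ h2]; exact: b0.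
have Fr x : 1 <= x -> F x = F 1.
  by move=> h; apply: Fcst => // z /andP[h2 _]; exact: b1.
have Fm x y : x <= y -> F x <= F y.
  move=> xy; have cF : {within `[x, y], continuous F}.
    by apply: derivable_within_continuous => z _; have := dF z => ?; exact: ex_derive.
  have [c _] := @MVT_segment R F b x y xy (fun z _ => dF z) cF.
  by move=> e; rewrite -subr_ge0 e mulr_ge0 // subr_ge0.
(* Were the total mass zero, the primitive of the bump would vanish everywhere,
   whereas its derivative at [1 / 2] is positive. *)
have F1 : 0 < F 1.
  rewrite lt_neqAle -{2}F0 Fm // andbT; apply/eqP => e.
  have Fz z : F z = 0.
    have [h|h] := lerP z 1; last by rewrite Fr // ltW.
    by apply/eqP; rewrite eq_le {1}e Fm //=; have [/Fl->//|/ltW/Fm] := lerP z 0; rewrite F0.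
  have Fe : F = fun=> 0 by apply/funext.
  have := derive_val (is_derive := dF 2^-1); rewrite Fe derive_cst => /esym.
  by apply/eqP; rewrite gt_eqF // mulr_gt0 // flat_gt0 //; lra.
have Fi : 0 <= (F 1)^-1 by rewrite invr_ge0 ltW.
exists (fun x => (F 1)^-1 * F x), (fun x => (F 1)^-1 * b x), (F 1)^-1; split.
- move=> n; apply: nsmoothM; first exact: nsmooth_cst.
  by case: n => [//|n]; exact: (nsmoothS dF).
- by move=> x; have := is_deriveZ (F 1)^-1 (dF x).
- by split=> x h; [rewrite (Fl x) // mulr0|rewrite (Fr x) // mulVf // gt_eqF].
- by split=> x h; [rewrite b0 // mulr0|rewrite b1 // mulr0].
split=> x; first by apply: continuousM; [exact: cst_continuous|exact: bc].
by rewrite mulr_ge0 //= ler_piMr.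
Qed.

End Smooth.

(** * Local integrals and Lebesgue points *)

Section LocalIntegrals.
Context {R : realType}.
Local Notation mu := (@lebesgue_measure R).
Implicit Types (f g w : R -> R) (a b c d e x : R).

Lemma ae_imply (P Q : R -> Prop) : (forall x, P x -> Q x) ->
  {ae mu, forall x, P x} -> {ae mu, forall x, Q x}.
Proof. exact: (@filterS _ _ (ae_filter_ringOfSetsType mu)). Qed.

Lemma ae_imply2 (P Q P' : R -> Prop) : (forall x, P x -> Q x -> P' x) ->
  {ae mu, forall x, P x} -> {ae mu, forall x, Q x} -> {ae mu, forall x, P' x}.
Proof. exact: (@filterS2 _ _ (ae_filter_ringOfSetsType mu)). Qed.

Lemma Rintegral_supp (D E : set R) g : E `<=` D -> (forall x, D x -> ~ E x -> g x = 0) ->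
  \int[mu]_(x in D) g x = \int[mu]_(x in E) g x.
Proof.
move=> ED g0; rewrite Rintegral_mkcond [RHS]Rintegral_mkcond; congr Rintegral.
apply/funext => x; rewrite /patch.
have [Dx|nD] := pselect (D x); have [Ex|nE] := pselect (E x).
- by rewrite !mem_set.
- by rewrite mem_set // memNset // g0.
- by case: nD; exact: ED.
- by rewrite !memNset.
Qed.

Lemma loc_integrable_itv a b f c e : locally_integrable `]a, b[ f -> a < c -> e < b ->
  mu.-integrable `[c, e] (EFin \o f).
Proof.
move=> [mf _ lf] ac eb.
have sub : `[c, e]%classic `<=` `]a, b[%classic.
  move=> x /=; rewrite !in_itv /= => /andP[h1 h2].
  by rewrite (lt_le_trans ac h1) (le_lt_trans h2 eb).
apply/integrableP; split.
  apply/measurable_EFinP; apply: measurable_funS mf => //.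
exact: lf sub (@segment_compact _ _ _).
Qed.

Lemma EFin_Rintegral (D : set R) f : measurable D -> mu.-integrable D (EFin \o f) ->
  (\int[mu]_(x in D) f x)%:E = (\int[mu]_(x in D) (f x)%:E)%E.
Proof. by move=> mD fi; rewrite /Rintegral fineK //; exact: (@integrable_fin_num _ _ _ mu D mD _ fi). Qed.

Lemma bounded_integrable_mul (D : set R) f g K : measurable D ->
  mu.-integrable D (EFin \o f) -> measurable_fun D g -> (forall x, D x -> `|g x| <= K) ->
  mu.-integrable D (EFin \o (fun x => f x * g x)).
Proof.
move=> mD fi mg gK.
have fK : mu.-integrable D (EFin \o (fun x => K * f x)).
  exact: (@integrableZl _ _ _ mu D mD K _ fi).
apply: (@le_integrable _ _ _ mu D mD _ _ _ _ fK).
  apply/measurable_EFinP; apply: measurable_funM => //.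
  by apply/measurable_EFinP; exact: measurable_int fi.
move=> x Dx /=; rewrite lee_fin !normrM mulrC.
have K0 : 0 <= K by apply: le_trans (gK x Dx).
by rewrite (ger0_norm K0) ler_wpM2r // gK.
Qed.

Lemma continuous_measurable_set (D : set R) g : (forall x, {for x, continuous g}) ->
  measurable_fun D g.
Proof.
by move=> cg; apply: measurable_funTS; exact: continuous_measurable_fun.
Qed.

(** The definition of a Lebesgue point with the measure [2 * r] of the ball
    multiplied out. *)
Lemma lebesgue_pt_bound f x : lebesgue_pt f x -> forall eps : R, 0 < eps ->
  exists2 r0 : R, 0 < r0 & forall r, 0 < r -> r < r0 ->
    (\int[mu]_(y in ball x r) `|(f y - f x)%:E| <= (eps * r)%:E)%E.
Proof.
rewrite /lebesgue_pt => /fine_cvgP[fin /cvgrPdist_lt cv] eps e0.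
have e2 : 0 < eps / 2 by rewrite divr_gt0.
have := cv _ e2; move: fin => /= H1 H2; have := filterI H1 H2.
rewrite near_simpl => -[r0 /= r00 H]; exists r0 => // r rp rr0.
have [|F] := H r _ rp; first by rewrite /= sub0r normrN gtr0_norm.
rewrite sub0r normrN ger0_norm ?fine_ge0 ?davg_ge0 // => lt.
have := lt; rewrite -lte_fin fineK // /davg /iavg (lebesgue_measure_ball _ (ltW rp)).
have r2 : 0 < r *+ 2 by rewrite mulrn_wgt0.
rewrite inver gt_eqF // muleC lte_pdivrMr // => /ltW /le_trans; apply.
by rewrite -EFinM lee_fin le_eqVlt; apply/orP; left; apply/eqP; rewrite -mulr_natr; field.
Qed.

End LocalIntegrals.

(** * Approximate unit masses *)

Section WeakDerivatives.
Context {R : realType}.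
Local Notation mu := (@lebesgue_measure R).
Implicit Types (f g w : R -> R) (a b c d e x : R).

Lemma Rintegral_derive f F a b : a <= b -> (forall x, {for x, continuous f}) ->
  (forall x, is_derive x 1 F (f x)) -> \int[mu]_(x in `[a, b]) f x = F b - F a.
Proof.
rewrite le_eqVlt => /predU1P[<-|ab] cf dF.
  by rewrite set_itv1 Rintegral_set1 subrr.
have cF x : {for x, continuous F} by exact: is_derive_continuous (dF x).
rewrite /Rintegral (@continuous_FTC2 R f F) //.
- by apply: continuous_subspaceT.
- split; first by move=> x _; have := dF x => ?; exact: ex_derive.
    by apply: cvg_at_right_filter; exact: cF.
  by apply: cvg_at_left_filter; exact: cF.
by move=> x _; rewrite derive1E; exact: derive_val.
Qed.

Lemma mul_bump_integrable a b f c e g K : locally_integrable `]a, b[ f -> a < c -> e < b ->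
  (forall x, {for x, continuous g}) -> (forall x, `|g x| <= K) ->
  mu.-integrable `[c, e] (EFin \o (fun x => f x * g x)).
Proof.
move=> lf ac eb cg gK; apply: (@bounded_integrable_mul _ _ _ _ K) => //.
  exact: loc_integrable_itv lf ac eb.
exact: continuous_measurable_set.
Qed.

Lemma continuous_affine_comp g c d : (forall x, {for x, continuous g}) ->
  forall x, {for x, continuous (fun x => g (c * x + d))}.
Proof.
move=> cg x; apply: (@continuous_comp _ _ _ (fun x => c * x + d) g); last exact: cg.
apply: is_derive_continuous (_ : is_derive x 1 _ (c * 1 + 0)).
Qed.

Lemma is_derive_affine_comp g (v : R) c d x : is_derive (c * x + d) 1 g v ->
  is_derive x 1 (fun x => g (c * x + d)) (c * v).
Proof.
move=> dg; have := @is_derive1_comp R g (fun x => c * x + d) x v c dg.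
rewrite [v * c]mulrC; apply.
have := is_deriveD (is_deriveZ c (is_derive_id x (1 : R))) (is_derive_cst d x (1 : R)).
by rewrite addr0 [c *: 1]mulr1.
Qed.

Variables (S B : R -> R) (K : R).
Hypothesis S_smooth : forall n, nsmooth n S.
Hypothesis S_derive : forall x, is_derive x 1 S (B x).
Hypothesis S_step : (forall x, x <= 0 -> S x = 0) /\ (forall x, 1 <= x -> S x = 1).
Hypothesis B_supp : (forall x, x <= 0 -> B x = 0) /\ (forall x, 1 <= x -> B x = 0).
Hypothesis B_bound : (forall x, {for x, continuous B}) /\ forall x, 0 <= B x <= K.

(** [step_at dl c] passes from 0 to 1 on the interval from [c] to [c + dl]; its
    derivative [bump_at dl c] is an approximation of the unit mass at [c]. *)
Definition step_at dl c x : R := S (dl^-1 * x + - (dl^-1 * c)).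
Definition bump_at dl c x : R := dl^-1 * B (dl^-1 * x + - (dl^-1 * c)).

Lemma step_at_derive dl c x : is_derive x 1 (step_at dl c) (bump_at dl c x).
Proof. exact: is_derive_affine_comp. Qed.

Lemma bump_at_continuous dl c x : {for x, continuous (bump_at dl c)}.
Proof.
apply: continuousM; first exact: cst_continuous.
by apply: continuous_affine_comp; exact: B_bound.1.
Qed.

Lemma bump_at_bound dl c x : 0 < dl -> `|bump_at dl c x| <= K / dl.
Proof.
move=> d0; rewrite normrM normfV (gtr0_norm d0) mulrC ler_wpM2r ?invr_ge0 ?(ltW d0) //.
by have /andP[h1 h2] := B_bound.2 (dl^-1 * x + - (dl^-1 * c)); rewrite ger0_norm.
Qed.

Lemma step_at_le dl c x : 0 < dl -> x <= c -> step_at dl c x = 0 /\ bump_at dl c x = 0.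
Proof.
move=> d0 xc; have h : dl^-1 * x + - (dl^-1 * c) <= 0.
  by rewrite -mulrBr mulr_ge0_le0 ?subr_le0 // invr_ge0 ltW.
by rewrite /step_at /bump_at S_step.1 // B_supp.1 // mulr0.
Qed.

Lemma step_at_ge dl c x : 0 < dl -> c + dl <= x -> step_at dl c x = 1 /\ bump_at dl c x = 0.
Proof.
move=> d0 xc; have h : 1 <= dl^-1 * x + - (dl^-1 * c).
  by rewrite -mulrBr ler_pdivlMl // mulr1; lra.
by rewrite /step_at /bump_at S_step.2 // B_supp.2 // mulr0.
Qed.

Lemma step_at_01 dl c x : 0 <= step_at dl c x <= 1.
Proof.
have mono x1 y1 : x1 <= y1 -> S x1 <= S y1.
  move=> xy; have cS : {within `[x1, y1], continuous S}.
    by apply: derivable_within_continuous => z _; have := S_derive z => ?; exact: ex_derive.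
  have [z _ e] := @MVT_segment R S B x1 y1 xy (fun z _ => S_derive z) cS.
  by rewrite -subr_ge0 e mulr_ge0 ?subr_ge0 //; have /andP[] := B_bound.2 z.
rewrite /step_at; move: (_ + _) => y; apply/andP; split.
  have [h|/ltW h] := lerP y 0; first by rewrite S_step.1.
  by rewrite -(S_step.1 0 (lexx 0)) mono.
have [h|/ltW h] := lerP 1 y; first by rewrite S_step.2.
by rewrite -(S_step.2 1 (lexx 1)) mono.
Qed.

(** The mass of the bump is 1 and its height is of order [1 / dl], so that the
    error is a mean of the oscillation of [f] around its Lebesgue point [c]. *)
Lemma bump_at_approx a b f c : locally_integrable `]a, b[ f -> a < c -> c < b ->
  lebesgue_pt f c -> forall eps : R, 0 < eps ->
  exists2 d0 : R, 0 < d0 & forall dl, 0 < dl -> dl < d0 ->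
    `|\int[mu]_(x in `]a, b[) (f x * bump_at dl c x) - f c| <= eps.
Proof.
move=> lf ac cb fc eps e0.
have K0 : 0 <= K by have /andP[] := B_bound.2 0; exact: le_trans.
have K1 : 0 < 2 * K + 1 by lra.
have [r0 r00 Hr] := lebesgue_pt_bound fc (divr_gt0 e0 K1).
exists (Num.min (r0 / 2) (Num.min ((c - a) / 2) ((b - c) / 2))).
  by rewrite !lt_min !divr_gt0 // subr_gt0.
move=> dl d0; rewrite !lt_min => /and3P[h1 h2 h3].
pose I := `[c, c + dl]%classic.
have mI : measurable I by exact: measurable_itv.
have sub : `[c, (c + dl)] `<=` `]a, b[%classic.
  by move=> x /=; rewrite !in_itv /= => /andP[? ?]; apply/andP; split; lra.
rewrite (@Rintegral_supp _ _ I); last first.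
- move=> x _ nI; have [h|h] := lerP x c.
    by rewrite (step_at_le d0 h).2 mulr0.
  have [h'|h'] := lerP (c + dl) x; first by rewrite (step_at_ge d0 h').2 mulr0.
  by case: nI; rewrite /I /= in_itv /= !ltW.
- exact: sub.
have fI : mu.-integrable I (EFin \o f) by apply: loc_integrable_itv lf _ _; lra.
have bb x : `|bump_at dl c x| <= K / dl by exact: bump_at_bound.
have bI : mu.-integrable I (EFin \o bump_at dl c).
  by apply: continuous_integrable_itv; exact: bump_at_continuous.
have fbI : mu.-integrable I (EFin \o (fun x => f x * bump_at dl c x)).
  by apply: mul_bump_integrable lf _ _ (@bump_at_continuous dl c) bb; lra.
have cbI : mu.-integrable I (EFin \o (fun x => f c * bump_at dl c x)).
  exact: (@integrableZl _ _ _ mu I mI (f c) _ bI).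
have one : \int[mu]_(x in I) bump_at dl c x = 1.
  have ccd : c <= c + dl by rewrite lerDl ltW.
  rewrite (@Rintegral_derive _ _ _ _ ccd (@bump_at_continuous dl c) (@step_at_derive dl c)).
  by rewrite (step_at_ge d0 (lexx _)).1 (step_at_le d0 (lexx _)).1 subr0.
have -> : f c = \int[mu]_(x in I) (f c * bump_at dl c x).
  by rewrite (@RintegralZl _ _ _ mu I _ _ mI bI) one mulr1.
rewrite -(@RintegralB _ _ _ mu I _ _ mI fbI cbI).
have dI : mu.-integrable I (EFin \o (fun x => f x * bump_at dl c x - f c * bump_at dl c x)).
  exact: (@integrableB _ _ _ mu I mI _ _ fbI cbI).
apply: le_trans (@le_normr_Rintegral _ _ _ mu I _ mI dI) _.
have ffI : mu.-integrable I (EFin \o (fun x => f x - f c)).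
  have cI : mu.-integrable I (EFin \o (fun=> f c)).
    by apply: continuous_integrable_itv => x; exact: cst_continuous.
  exact: (@integrableB _ _ _ mu I mI _ _ fI cI).
have affI : mu.-integrable I (EFin \o (fun x => `|f x - f c|)).
  exact: (@integrable_norm _ _ _ mu I _ ffI).
have KffI : mu.-integrable I (EFin \o (fun x => K / dl * `|f x - f c|)).
  exact: (@integrableZl _ _ _ mu I mI (K / dl) _ affI).
apply: (@le_trans _ _ (\int[mu]_(x in I) (K / dl * `|f x - f c|))).
  apply: (@le_Rintegral _ _ _ mu I _ _ mI _ KffI).
    exact: (@integrable_norm _ _ _ mu I _ dI).
  move=> x _ /=; rewrite -mulrBl normrM mulrC ler_wpM2r //.
rewrite (@RintegralZl _ _ _ mu I _ _ mI affI).
have : \int[mu]_(x in I) `|f x - f c| <= eps / (2 * K + 1) * (2 * dl).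
  rewrite -lee_fin (EFin_Rintegral mI affI).
  have h2d : 2 * dl < r0 by lra.
  have h2d0 : 0 < 2 * dl by lra.
  apply: le_trans (Hr _ h2d0 h2d).
  apply: ge0_subset_integral => //.
  - exact: measurable_ball.
  - do 2 apply: measurableT_comp => //.
    apply: measurable_funB => //.
    case: lf => mf _ _; apply: measurable_funS mf => //.
    rewrite ball_itv => x /=; rewrite !in_itv /= => /andP[? ?]; apply/andP; split; lra.
  - move=> x; rewrite /I ball_itv /= !in_itv /= => /andP[? ?]; apply/andP; split; lra.
move=> h; apply: le_trans (ler_wpM2l _ h) _; first by rewrite divr_ge0 // ltW.
have -> : K / dl * (eps / (2 * K + 1) * (2 * dl)) = eps * (2 * K / (2 * K + 1)).
  by field; rewrite !gt_eqF.
by rewrite ler_piMr ?(ltW e0) // ler_pdivrMr //; lra.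
Qed.

End WeakDerivatives.

(** * Increments of a function with a weak derivative *)

Section WeakIncrement.
Context {R : realType}.
Local Notation mu := (@lebesgue_measure R).
Implicit Types (f g w : R -> R) (a b c d e x : R).

Variables (S B : R -> R) (K : R).
Hypothesis S_smooth : forall n, nsmooth n S.
Hypothesis S_derive : forall x, is_derive x 1 S (B x).
Hypothesis S_step : (forall x, x <= 0 -> S x = 0) /\ (forall x, 1 <= x -> S x = 1).
Hypothesis B_supp : (forall x, x <= 0 -> B x = 0) /\ (forall x, 1 <= x -> B x = 0).
Hypothesis B_bound : (forall x, {for x, continuous B}) /\ forall x, 0 <= B x <= K.

Definition plateau dl c d x : R := step_at S dl c x - step_at S dl d x.

Lemma plateau_derive1 dl c d :
  derive1n 1 (plateau dl c d) = (fun x => bump_at B dl c x - bump_at B dl d x).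
Proof.
apply: derive1_is_derive => x.
exact: is_deriveB (step_at_derive S_derive dl c x) (step_at_derive S_derive dl d x).
Qed.

Lemma plateau_out dl c d x : 0 < dl -> c <= d -> x <= c \/ d + dl <= x -> plateau dl c d x = 0.
Proof.
move=> d0 cd [h|h]; rewrite /plateau.
  rewrite (step_at_le S_step B_supp d0 h).1 (step_at_le S_step B_supp d0 (le_trans h cd)).1.
  by rewrite subrr.
have h' : c + dl <= x by lra.
by rewrite (step_at_ge S_step B_supp d0 h).1 (step_at_ge S_step B_supp d0 h').1 subrr.
Qed.

Lemma plateau_test a b dl c d : 0 < dl -> a < c -> c <= d -> d + dl < b ->
  test_function a b (plateau dl c d).
Proof.
move=> d0 ac cd db; split.
  move=> m; have : nsmooth m.+1 (plateau dl c d); last by apply.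
  apply: nsmoothD; first exact: nsmooth_affine.
  have -> : (fun x => - step_at S dl d x) = (fun x => -1 * step_at S dl d x).
    by apply/funext => x; rewrite mulN1r.
  by apply: nsmoothM; [exact: nsmooth_cst|exact: nsmooth_affine].
exists `[c, d + dl]%classic; split; first exact: segment_compact.
  by move=> x /=; rewrite !in_itv /= => /andP[? ?]; apply/andP; split; lra.
move=> x nx; apply: plateau_out => //.
have [h|h] := lerP x c; first by left.
by right; rewrite leNgt; apply/negP => h'; apply: nx; rewrite /= in_itv /= !ltW.
Qed.

Lemma plateau_bound dl c d x : `|plateau dl c d x| <= 1.
Proof.
have /andP[h1 h2] := step_at_01 S_derive S_step B_bound dl c x.
have /andP[h3 h4] := step_at_01 S_derive S_step B_bound dl d x.
by rewrite /plateau ler_norml; apply/andP; split; lra.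
Qed.

Lemma plateau_continuous dl c d x : {for x, continuous (plateau dl c d)}.
Proof.
apply: is_derive_continuous.
Qed.

(** Dominated convergence, with [w] itself as a bound since the plateau takes
    values between 0 and 1. *)
Lemma plateau_integral_cvg a b w c d dl0 : locally_integrable `]a, b[ w ->
  a < c -> c < d -> 0 < dl0 -> d + dl0 < b ->
  \int[mu]_(x in `]a, b[) (w x * plateau (dl0 / n.+1%:R) c d x) @[n --> \oo]
  --> \int[mu]_(x in `[c, d]) w x.
Proof.
move=> lw ac cd d0 db; pose dl n : R := dl0 / n.+1%:R.
have dl_gt0 n : 0 < dl n by rewrite divr_gt0.
have dl_le n : dl n <= dl0 by rewrite ler_pdivrMr // ler_peMr ?ler1n ?(ltW d0).
pose D := `[c, d + dl0]%classic; have mD : measurable D by exact: measurable_itv.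
pose h x : R := w x * \1_(`]c, d]%classic) x.
have wD : mu.-integrable D (EFin \o w) by apply: loc_integrable_itv lw _ _.
have mw : measurable_fun D w by apply/measurable_EFinP; exact: measurable_int wD.
have hw x : `]c, d]%classic x -> h x = w x.
  by move=> cdx; rewrite /h indicE mem_set // mulr1.
have h0 x : ~ `]c, d]%classic x -> h x = 0.
  by move=> cdx; rewrite /h indicE memNset // mulr0.
have hint : \int[mu]_(x in D) h x = \int[mu]_(x in `[c, d]) w x.
  have sub : `]c, d]%classic `<=` D.
    by move=> x; rewrite /D /= !in_itv /= => /andP[? ?]; apply/andP; split; lra.
  rewrite (Rintegral_supp sub); last by move=> x _; exact: h0.
  rewrite -Rintegral_itv_obnd_cbnd; last first.
    apply: (@integrableS _ _ _ mu D _ _ mD _ sub wD); exact: measurable_itv.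
  by apply: eq_Rintegral => x /set_mem; exact: hw.
have eqD n : \int[mu]_(x in `]a, b[) (w x * plateau (dl n) c d x) =
    \int[mu]_(x in D) (w x * plateau (dl n) c d x).
  apply: Rintegral_supp.
    by move=> x; rewrite /D /= !in_itv /= => /andP[? ?]; apply/andP; split; lra.
  move=> x _ nD; rewrite (plateau_out (dl_gt0 n) (ltW cd)) ?mulr0 //.
  have [hx|hx] := lerP x c; first by left.
  right; rewrite leNgt; apply/negP => h'; apply: nD; rewrite /D /= in_itv /= ltW //=.
  by have := dl_le n; lra.
have mh : measurable_fun D h.
  by apply: measurable_funM => //; exact: measurable_indic.
have [] := @dominated_convergence _ _ R mu D mD
  (fun n => EFin \o (fun x => w x * plateau (dl n) c d x)) (EFin \o h)
  (EFin \o (fun x => `|w x|)).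
- move=> n; apply/measurable_EFinP; apply: measurable_funM => //.
  by apply: continuous_measurable_set => x; exact: plateau_continuous.
- exact/measurable_EFinP.
- apply: aeW => x Dx; apply: cvg_near_cst.
  have [[x1 x2]|[[x1 x2]|[x1 x2]]] : (x <= c /\ True) \/ ((c < x /\ x <= d) \/ (d < x /\ True)).
    have [?|?] := lerP x c; first by left.
    by right; have [?|?] := lerP x d; [left|right].
  + apply: nearW => n /=; rewrite (plateau_out (dl_gt0 n) (ltW cd)); last by left.
    by rewrite mulr0 h0 //= in_itv /= ltNge x1.
  + near=> n; have hn : dl n <= x - c.
      near: n; exists (Num.bound (dl0 / (x - c))) => // n /= hn.
      have xc : 0 < x - c by rewrite subr_gt0.
      rewrite /dl ler_pdivrMr // mulrC -ler_pdivrMr //.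
      apply: le_trans (ltW (archi_boundP _)) _; first by rewrite divr_ge0 // ltW.
      by rewrite ler_nat (leq_trans hn).
    rewrite /= hw; last by rewrite /= in_itv /= x1 x2.
    have h1 : c + dl n <= x by lra.
    rewrite /plateau (step_at_ge S_step B_supp (dl_gt0 n) h1).1.
    by rewrite (step_at_le S_step B_supp (dl_gt0 n) x2).1 subr0 mulr1.
  + near=> n; have hn : dl n <= x - d.
      near: n; exists (Num.bound (dl0 / (x - d))) => // n /= hn.
      have xd : 0 < x - d by rewrite subr_gt0.
      rewrite /dl ler_pdivrMr // mulrC -ler_pdivrMr //.
      apply: le_trans (ltW (archi_boundP _)) _; first by rewrite divr_ge0 // ltW.
      by rewrite ler_nat (leq_trans hn).
    rewrite /= (plateau_out (dl_gt0 n) (ltW cd)) ?mulr0 //; last by right; lra.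
    by rewrite h0 //= in_itv /= [x <= d]leNgt x1 andbF.
- exact: (@integrable_norm _ _ _ mu D _ wD).
- apply: aeW => x n Dx /=; rewrite lee_fin normrM ler_piMr //; exact: plateau_bound.
move=> hI _ C; rewrite -hint (_ : (fun n : nat => _) =
    (fun n => \int[mu]_(x in D) (w x * plateau (dl n) c d x))); last exact/funext.
by apply: fine_cvg; rewrite (EFin_Rintegral mD hI); exact: C.
Unshelve. all: by end_near. Qed.

(** Testing against [plateau dl c d], a smoothed indicator of the interval from
    [c] to [d], and letting [dl] tend to 0. *)
Lemma weak_increment a b f w c d : is_weak_derivative a b 1 f w ->
  a < c -> c < d -> d < b -> lebesgue_pt f c -> lebesgue_pt f d ->
  f d - f c = \int[mu]_(x in `[c, d]) w x.
Proof.
move=> [lf lw H] ac cd db fc fd.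
pose dl0 := (b - d) / 2; have d0 : 0 < dl0 by rewrite divr_gt0 // subr_gt0.
have ddb : d + dl0 < b by rewrite /dl0; lra.
pose dl n : R := dl0 / n.+1%:R.
have dl_gt0 n : 0 < dl n by rewrite divr_gt0.
have dl_le n : dl n <= dl0 by rewrite ler_pdivrMr // ler_peMr ?ler1n ?(ltW d0).
have small (e : R) : 0 < e -> \forall n \near \oo, dl n < e.
  move=> e0; exists (Num.bound (dl0 / e)) => // n /= hn.
  rewrite /dl ltr_pdivrMr // mulrC -ltr_pdivrMr //.
  apply: lt_le_trans (archi_boundP _) _; first by rewrite divr_ge0 // ltW.
  by rewrite ler_nat (leq_trans hn).
have approx x : a < x -> x <= d -> lebesgue_pt f x ->
    \int[mu]_(t in `]a, b[) (f t * bump_at B (dl n) x t) @[n --> \oo] --> f x.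
  move=> ax xd fx; apply/cvgrPdist_le => e e0.
  have [r0 r00 Hr] := bump_at_approx S_derive S_step B_supp B_bound lf ax
     (le_lt_trans xd db) fx e0.
  near=> n; rewrite distrC; apply: Hr => //.
  by near: n; exact: small.
have eqn n : \int[mu]_(t in `]a, b[) (f t * bump_at B (dl n) c t)
    - \int[mu]_(t in `]a, b[) (f t * bump_at B (dl n) d t) =
    - \int[mu]_(t in `]a, b[) (w t * plateau (dl n) c d t).
  have := H _ (plateau_test (dl_gt0 n) ac (ltW cd) _).
  rewrite expr1 mulN1r => <-; last by have := dl_le n; lra.
  rewrite plateau_derive1.
  pose D := `[c, d + dl n]%classic; have mD : measurable D by exact: measurable_itv.
  have sub : D `<=` `]a, b[%classic.
    by move=> x; rewrite /D /= !in_itv /= => /andP[? ?]; have := dl_le n; move=> ?; apply/andP; split; lra.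
  have out x t : c <= x -> x <= d -> ~ D t -> bump_at B (dl n) x t = 0.
    move=> cx xd nD; have [h|h] := lerP t x; first exact: (step_at_le S_step B_supp (dl_gt0 n) h).2.
    apply: (step_at_ge S_step B_supp (dl_gt0 n) _).2; rewrite leNgt; apply/negP => h'.
    by apply: nD; rewrite /D /= in_itv /=; apply/andP; split; lra.
  have iD x : c <= x -> x <= d ->
      mu.-integrable D (EFin \o (fun t => f t * bump_at B (dl n) x t)).
    move=> cx xd; apply: (mul_bump_integrable (K := K / dl n) lf ac).
    - by have := dl_le n; lra.
    - by move=> t; exact: (bump_at_continuous B_bound).
    - by move=> t; exact: (bump_at_bound B_bound).
  rewrite !(Rintegral_supp sub); first last.
  - by move=> t _ nD; rewrite (out c) ?mulr0 // ltW.
  - by move=> t _ nD; rewrite (out d) ?mulr0 // ltW.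
  - by move=> t _ nD; rewrite (out c) ?(out d) ?subrr ?mulr0 // ltW.
  rewrite -(@RintegralB _ _ _ mu D _ _ mD (iD c (lexx c) (ltW cd)) (iD d (ltW cd) (lexx d))).
  by congr Rintegral; apply/funext => t; rewrite mulrBr.
have L1 := cvgB (approx c ac (ltW cd) fc) (approx d (lt_trans ac cd) (lexx d) fd).
have L2 := cvgN (plateau_integral_cvg lw ac cd d0 ddb).
suff E : f c - f d = - \int[mu]_(x in `[c, d]) w x by rewrite -[f d - f c]opprB E opprK.
apply: (@cvg_unique _ (@Rhausdorff R) _ _ _ _ (L1 _)).
have -> : (fun n : nat => \int[mu]_(t in `]a, b[) (f t * bump_at B (dl n) c t)) -
   (fun n : nat => \int[mu]_(t in `]a, b[) (f t * bump_at B (dl n) d t)) =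
   - (fun n : nat => \int[mu]_(x in `]a, b[) (w x * plateau (dl0 / n.+1%:R) c d x)).
  by apply/funext => n; exact: eqn.
exact: L2.
Unshelve. all: by end_near. Qed.

End WeakIncrement.

(** * The fundamental lemma of the calculus of variations *)

Section Uniqueness.
Context {R : realType}.
Local Notation mu := (@lebesgue_measure R).
Implicit Types (f g w : R -> R) (a b c d e x : R).

Lemma lebesgue_pt_local f g x (r0 : R) : 0 < r0 -> (forall y, ball x r0 y -> f y = g y) ->
  lebesgue_pt f x -> lebesgue_pt g x.
Proof.
move=> r00 fg; rewrite /lebesgue_pt; apply: cvg_trans; apply: near_eq_cvg.
near=> r; rewrite /davg /iavg; congr (_ * _)%E.
apply: eq_integral => y /set_mem xy /=; rewrite !fg //; first exact: ballxx.
by apply: le_ball xy; near: r; exact: nbhs_right_le.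
Unshelve. all: by end_near. Qed.

(** Lebesgue differentiation holds for integrable functions on the line; it is
    applied to the restrictions of [f] to an exhausting sequence of compact
    intervals, a Lebesgue point being a local notion. *)
Lemma ae_lebesgue_pt a b f : locally_integrable `]a, b[ f ->
  {ae mu, forall x, a < x < b -> lebesgue_pt f x}.
Proof.
move=> lf; pose e n : R := n.+1%:R^-1.
have e0 n : 0 < e n by rewrite invr_gt0.
pose fn n := f \_ `[a + e n, b - e n].
have : {ae mu, forall x n, lebesgue_pt (fn n) x}.
  apply/ae_foralln => n; apply: lebesgue_differentiation.
  apply: open_integrable_locally; first exact: openT.
  rewrite -restrict_EFin; apply/integrable_restrict => //; rewrite setTI.
  by apply: loc_integrable_itv lf _ _; have := e0 n; lra.
apply: ae_imply => x H /andP[ax xb].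
pose m := Num.min (x - a) (b - x).
have m0 : 0 < m by rewrite lt_min !subr_gt0 ax xb.
have [n hn] : exists n, e n <= m / 2.
  exists (Num.bound (2 / m)).
  rewrite /e -[m / 2]invrK lef_pV2 ?posrE // ?invr_gt0 ?divr_gt0 //.
  rewrite invf_div; apply: le_trans (ltW (archi_boundP _)) _; first by rewrite divr_ge0 // ltW.
  by rewrite ler_nat.
apply: (@lebesgue_pt_local (fn n) f x (m / 2) _ _ (H n)); first by rewrite divr_gt0.
move=> y; rewrite ball_itv /= in_itv /= => /andP[h1 h2].
have [h3 h4] : m <= x - a /\ m <= b - x by rewrite /m !ge_min !lexx orbT.
rewrite /fn /patch mem_set //= in_itv /=; apply/andP; split; lra.
Qed.

Lemma lebesgue_pt_cst (v x : R) : lebesgue_pt (cst v) x.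
Proof.
apply: (@continuous_lebesgue_pt _ _ _ setT) => //; last exact: cst_continuous.
exact: open_nbhsT.
Qed.

(** By [weak_increment] the integrals of [w] over intervals are increments of the
    zero function, hence the means of [w] around a Lebesgue point vanish. *)
Lemma weak_derivative_of_zero a b w : is_weak_derivative a b 1 (cst 0) w ->
  {ae mu, forall x, a < x < b -> w x = 0}.
Proof.
move=> H; have [_ lw _] := H.
have [S [B [K [h1 h2 h3 h4 h5]]]] := @exists_smooth_step R.
apply: ae_imply (ae_lebesgue_pt lw) => x Lx axb.
have {Lx} := Lx axb; case/andP: axb => ax xb wx.
apply/eqP; rewrite -normr_le0; apply/ler_addgt0Pr => eps e0; rewrite add0r.
have [r0 r00 Hr] := lebesgue_pt_bound wx e0.
pose m := Num.min (Num.min (x - a) (b - x)) r0.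
have m0 : 0 < m by rewrite !lt_min !subr_gt0 ax xb.
have [[n1 n2] n3] : (m <= x - a /\ m <= b - x) /\ m <= r0.
  by rewrite /m !ge_min !lexx !orbT.
pose r := m / 4; have r1 : 0 < r by rewrite divr_gt0.
have r20 : 0 < 2 * r by lra.
have rr0 : 2 * r < r0 by rewrite /r; lra.
pose I := `[x - r, x + r]%classic; have mI : measurable I by exact: measurable_itv.
have wI : mu.-integrable I (EFin \o w).
  by apply: loc_integrable_itv lw _ _; rewrite /r; lra.
have I0 : \int[mu]_(y in I) w y = 0.
  rewrite -(weak_increment h1 h2 h3 h4 h5 H (c := x - r) (d := x + r)) ?subrr //.
  - by rewrite /r; lra.
  - by lra.
  - by rewrite /r; lra.
  - exact: lebesgue_pt_cst.
  - exact: lebesgue_pt_cst.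
have cI : mu.-integrable I (EFin \o (fun=> w x)).
  by apply: continuous_integrable_itv => y; exact: cst_continuous.
have dI : mu.-integrable I (EFin \o (fun y => w y - w x)).
  exact: (@integrableB _ _ _ mu I mI _ _ wI cI).
have muI : fine (mu I) = r * 2.
  rewrite lebesgue_measure_itv /= lte_fin ifT /=; last by lra.
  by rewrite opprD opprK addrACA subrr add0r; ring.
have e1 : \int[mu]_(y in I) (w y - w x) = - (w x * (r * 2)).
  rewrite (@RintegralB _ _ _ mu I _ _ mI wI cI) I0 sub0r.
  by rewrite (@Rintegral_cst _ _ _ mu I mI) muI.
have adI : mu.-integrable I (EFin \o (fun y => `|w y - w x|)).
  exact: (@integrable_norm _ _ _ mu I _ dI).
have : `|w x| * (r * 2) <= eps * (2 * r).
  rewrite -[r * 2]ger0_norm; last by rewrite mulr_ge0 // ltW.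
  rewrite -normrM -normrN -e1.
  apply: le_trans (@le_normr_Rintegral _ _ _ mu I _ mI dI) _.
  rewrite -lee_fin (EFin_Rintegral mI adI).
  apply: le_trans (Hr _ r20 rr0); apply: ge0_subset_integral => //.
  - exact: measurable_ball.
  - do 2 apply: measurableT_comp => //.
    apply: measurable_funB => //; case: lw => mw _ _; apply: measurable_funS mw => //.
    rewrite ball_itv => y /=; rewrite !in_itv /= /r => /andP[? ?]; apply/andP; split; lra.
  - move=> y; rewrite /I ball_itv /= !in_itv /= => /andP[? ?]; apply/andP; split; lra.
by have := normr_ge0 (w x); nra.
Qed.

End Uniqueness.

(** * Weak derivatives are unique *)

Section WeakUnique.
Context {R : realType}.
Local Notation mu := (@lebesgue_measure R).
Implicit Types (f g w phi : R -> R) (a b c d e x : R).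

Lemma test_function_derive a b phi : test_function a b phi -> test_function a b (derive1 phi).
Proof.
move=> [sm [K [cK Kab phi0]]]; split.
  by move=> m x; have := sm m.+1 x; rewrite /derive1n iterSr.
exists K; split => // x nKx; rewrite derive1E -(derive_cst (0 : R) x (1 : R)).
apply: near_eq_derive; have oK : open (~` K).
  by apply: closed_openC; apply: compact_closed cK; exact: Rhausdorff.
have : nbhs x (~` K) by apply: open_nbhs_nbhs; split.
by apply: filterS => y; exact: phi0.
Qed.

Lemma test_function_continuous a b phi x : test_function a b phi -> {for x, continuous phi}.
Proof.
move=> [sm _]; apply: differentiable_continuous; apply/derivable1_diffP.
exact: (sm 0%N x).
Qed.

Lemma mul_test_integrable a b f phi : locally_integrable `]a, b[ f ->
  test_function a b phi -> mu.-integrable `]a, b[ (EFin \o (fun x => f x * phi x)).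
Proof.
move=> [mf _ lf] tf; have cphi x := @test_function_continuous a b phi x tf.
have [_ [K [cK Kab phi0]]] := tf.
have mK : measurable K by exact: compact_measurable.
have fK : mu.-integrable K (EFin \o f).
  apply/integrableP; split; last exact: lf.
  by apply/measurable_EFinP; apply: measurable_funS mf.
have [M hM] : exists M, forall x, K x -> `|phi x| <= M.
  have cI : compact (phi @` K).
    by apply: continuous_compact cK; exact: continuous_subspaceT.
  have [M [_ HM]] := compact_bounded cI.
  exists (M + 1) => x Kx; apply: (HM (M + 1)); first by rewrite ltrDl.
  by exists x.
have fpK : mu.-integrable K (EFin \o (fun x => f x * phi x)).
  apply: (bounded_integrable_mul mK fK _ hM); exact: continuous_measurable_set.
have e : (EFin \o (fun x => f x * phi x)) \_ K = (EFin \o (fun x => f x * phi x)) \_ `]a, b[.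
  apply/funext => x; rewrite /patch.
  have [Kx|nK] := pselect (K x); first by rewrite !mem_set //; exact: Kab.
  by rewrite memNset //; case: ifP => //= _; rewrite phi0 // mulr0.
rewrite -[K]setTI in fpK.
have := (@integrable_restrict _ _ _ mu K mK setT measurableT _).1 fpK.
rewrite e => h.
have mab : measurable `]a, b[%classic by exact: measurable_itv.
by have := (@integrable_restrict _ _ _ mu _ mab setT measurableT _).2 h; rewrite setTI.
Qed.

(** The difference of two weak derivatives is a weak derivative of zero, which
    may be taken of order 1 since the left-hand side vanishes anyway. *)
Lemma weak_derivative_unique a b m f w1 w2 : is_weak_derivative a b m f w1 ->
  is_weak_derivative a b m f w2 -> {ae mu, forall x, a < x < b -> w1 x = w2 x}.
Proof.
move=> [_ l1 H1] [_ l2 H2].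
suff H : is_weak_derivative a b 1 (cst 0) (fun x => w1 x - w2 x).
  apply: ae_imply (weak_derivative_of_zero H) => x h /h /eqP.
  by rewrite subr_eq0 => /eqP.
split.
- apply: open_integrable_locally; first exact: interval_open.
  exact: (@integrable0 _ _ _ mu).
- exact: locally_integrableD l1 (locally_integrableN l2).
move=> phi tphi; under eq_Rintegral do rewrite mul0r.
rewrite [LHS](_ : _ = 0); last first.
  by rewrite /Rintegral integral0.
have mD : measurable `]a, b[%classic by exact: measurable_itv.
have := H1 phi tphi; rewrite (H2 phi tphi) => /eqP.
rewrite (inj_eq (mulfI _)) ?signr_eq0 // => /eqP e.
rewrite (_ : \int[mu]_(x in _) _ = \int[mu]_(x in `]a, b[) (w1 x * phi x - w2 x * phi x)).
  rewrite (@RintegralB _ _ _ mu _ _ _ mD (mul_test_integrable l1 tphi) (mul_test_integrable l2 tphi)).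
  by rewrite e subrr mulr0.
by congr Rintegral; apply/funext => x; rewrite mulrBl.
Qed.

Lemma weak_derivative_succ a b m f w w' : is_weak_derivative a b m f w ->
  is_weak_derivative a b m.+1 f w' -> is_weak_derivative a b 1 w w'.
Proof.
move=> [lf lw H] [_ lw' H']; split=> // phi tphi.
have := H _ (test_function_derive tphi); have := H' _ tphi.
rewrite /derive1n iterSr => -> e.
rewrite -[LHS](signrMK m) -e exprS mulN1r mulNr mulrN signrMK.
by rewrite expr1 mulN1r.
Qed.

Lemma weak_derivative_self a b f : locally_integrable `]a, b[ f -> is_weak_derivative a b 0 f f.
Proof. by move=> lf; split=> // phi _; rewrite expr0 mul1r. Qed.

End WeakUnique.

(** * Continuous representatives *)

Section Representative.
Context {R : realType}.
Local Notation mu := (@lebesgue_measure R).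
Implicit Types (f g w v : R -> R) (a b c d e x y : R).

Lemma ae_itv_witness (P : R -> Prop) c d : {ae mu, forall x, P x} -> c < d ->
  exists2 x, c < x < d & P x.
Proof.
move=> aP cd; apply: contrapT => nP.
have : mu `]c, d[%classic = 0.
  apply: (measure_negligible _ _); first exact: measurable_itv.
  apply: negligibleS aP => x /=; rewrite in_itv /= => cxd Px.
  by apply: nP; exists x.
rewrite lebesgue_measure_itv /= lte_fin cd -EFinD => /eqP.
by rewrite eqe subr_eq0 => /eqP dc; move: cd; rewrite dc ltxx.
Qed.

Lemma within_continuousP v a b : {within `[a, b], continuous v} ->
  forall x, a <= x <= b -> forall eps : R, 0 < eps ->
  exists2 dl : R, 0 < dl & forall y, a <= y <= b -> `|y - x| < dl -> `|v y - v x| < eps.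
Proof.
move=> cv x axb eps e0.
have := (@subspace_continuousP R `[a, b]%classic R v).1 cv x.
rewrite /= in_itv /= => /(_ axb) /cvgrPdist_lt /(_ eps e0).
rewrite near_withinE => -[dl /= dl0 H]; exists dl => // y ayb yx.
by rewrite distrC; apply: H => //=; rewrite /ball_ /= distrC.
Qed.

Lemma continuous_ae_eq v1 v2 a b : a < b -> {within `[a, b], continuous v1} ->
  {within `[a, b], continuous v2} -> {ae mu, forall x, a < x < b -> v1 x = v2 x} ->
  forall x, a <= x <= b -> v1 x = v2 x.
Proof.
move=> ab c1 c2 e x axb; apply/eqP; rewrite -subr_eq0 -normr_le0.
apply/ler_addgt0Pr => eps e0; rewrite add0r.
have e2 : 0 < eps / 2 by rewrite divr_gt0.
have [d1 d10 H1] := within_continuousP c1 axb e2.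
have [d2 d20 H2] := within_continuousP c2 axb e2.
pose lo := Num.max a (x - Num.min d1 d2); pose hi := Num.min b (x + Num.min d1 d2).
have m0 : 0 < Num.min d1 d2 by rewrite lt_min d10.
have lohi : lo < hi.
  case/andP: axb => ax xb.
  by rewrite /lo /hi lt_min !gt_max; apply/andP; split; apply/andP; split; lra.
have [y /andP[ly yh] Py] := ae_itv_witness e lohi.
move: ly yh; rewrite /lo /hi lt_min gt_max => /andP[ay l1] /andP[yb l2].
have ayb : a <= y <= b by rewrite !ltW.
have yx : `|y - x| < Num.min d1 d2 by rewrite ltr_norml; apply/andP; split; lra.
move: yx; rewrite lt_min => /andP[yx1 yx2].
have := H1 y ayb yx1; have := H2 y ayb yx2; rewrite Py ?ay ?yb // => h1 h2.
have -> : v1 x - v2 x = - (v2 y - v1 x) + (v2 y - v2 x) by ring.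
apply: le_trans (ler_normD _ _) _; rewrite normrN; lra.
Qed.

Lemma integrable_oo_cc a b f : mu.-integrable `]a, b[ (EFin \o f) ->
  mu.-integrable `[a, b] (EFin \o f).
Proof.
move=> /integrableP[mf fi]; have mfo := mf.
move/measurable_EFinP : mf => /measurable_fun_itv_cc mf.
apply/integrableP; split; first exact/measurable_EFinP.
rewrite -integral_itv_obnd_cbnd; last first.
  do 2 apply: measurableT_comp => //.
  exact: (@measurable_fun_itv_oc _ _ _ true false f mf).
rewrite -integral_itv_bndo_bndc //.
by do 2 apply: measurableT_comp => //; exact/measurable_EFinP.
Qed.

Lemma Rintegral_oo_cc a b f : mu.-integrable `]a, b[ (EFin \o f) ->
  \int[mu]_(x in `[a, b]) f x = \int[mu]_(x in `]a, b[) f x.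
Proof.
move=> fi; rewrite -Rintegral_itv_obnd_cbnd; last first.
  have sub : `]a, b]%classic `<=` `[a, b]%classic by exact: subset_itv_oc_cc.
  apply: (@integrableS _ _ _ mu `[a, b]%classic _ _ _ _ sub); try exact: measurable_itv.
  exact: integrable_oo_cc.
by rewrite -Rintegral_itv_bndo_bndc.
Qed.

(** The primitive of the weak derivative, normalized by the value of [f] at one
    Lebesgue point. *)
Lemma weak_representative a b f w : a < b -> is_weak_derivative a b 1 f w ->
  mu.-integrable `]a, b[ (EFin \o w) ->
  exists v, [/\ {within `[a, b], continuous v}, {ae mu, forall x, a < x < b -> v x = f x} &
    forall x y, a <= x -> x <= y -> y <= b -> v y - v x = \int[mu]_(t in `[x, y]) w t].
Proof.
move=> ab H wi; have [S [B [K [s1 s2 s3 s4 s5]]]] := @exists_smooth_step R.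
have [lf _ _] := H; have aeL := ae_lebesgue_pt lf.
have [c acb Lc] := ae_itv_witness aeL ab; have {}Lc := Lc acb.
have wI := integrable_oo_cc wi.
pose W x : R := \int[mu]_(t in `[a, x]) w t.
have Winc x y : a <= x -> x <= y -> y <= b -> W y - W x = \int[mu]_(t in `[x, y]) w t.
  move=> ax xy yb.
  have sub1 : `[a, y]%classic `<=` `[a, b]%classic by apply: subset_itvl; rewrite bnd_simp.
  have i1 : mu.-integrable `[a, y] (EFin \o w).
    by apply: (@integrableS _ _ _ mu `[a, b]%classic _ _ _ _ sub1) => //; exact: measurable_itv.
  have sub2 : `]x, y]%classic `<=` `[a, y]%classic by apply: subset_itvr; rewrite bnd_simp.
  have i2 : mu.-integrable `]x, y] (EFin \o w).
    by apply: (@integrableS _ _ _ mu `[a, y]%classic _ _ _ _ sub2) => //; exact: measurable_itv.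
  by rewrite /W (@Rintegral_itvB R w (BLeft a) (BRight y) x) ?bnd_simp // Rintegral_itv_obnd_cbnd.
exists (fun x => f c - W c + W x); split.
- have cW := parameterized_integral_continuous (ltW ab) wI.
  apply: (@within_continuousD R R R); first by apply: continuous_subspaceT => x; exact: cst_continuous.
  exact: cW.
- apply: ae_imply aeL => x Lx axb; have {}Lx := Lx axb.
  case/andP: axb => ax xb; case/andP: acb => ac cb.
  have [xc|cx|->] := ltgtP x c; last by rewrite subrK.
    have := weak_increment s1 s2 s3 s4 s5 H ax xc cb Lx Lc.
    by rewrite -Winc ?ltW // => e; lra.
  have := weak_increment s1 s2 s3 s4 s5 H ac cx xb Lc Lx.
  by rewrite -Winc ?ltW // => e; lra.
- by move=> x y ax xy yb; rewrite -Winc // opprD addrACA subrr add0r.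
Qed.

End Representative.

(** * Sobolev functions on an interval *)

Section SquareIntegrable.
Context {R : realType}.
Local Notation mu := (@lebesgue_measure R).
Implicit Types (f g w v : R -> R) (a b c d e x y : R).

(** The norm is that of the extension by zero; its square is the integral over
    the interval. *)
Lemma Lnorm2E a b w : measurable_fun `]a, b[ w ->
  ('N[mu]_2%:E[EFin \o (w \_ `]a, b[)] `^ 2 = \int[mu]_(x in `]a, b[) (w x ^+ 2)%:E)%E.
Proof.
move=> mw; rewrite poweR_Lnorm //.
rewrite [RHS]integral_mkcond; apply: eq_integral => x _.
rewrite /comp /patch; case: ifP => _ /=; rewrite powR_mulrn ?normr_ge0 //.
  by rewrite real_normK // num_real.
by rewrite normr0 expr0n.
Qed.

Lemma square_integrable_ae a b w1 w2 : measurable_fun `]a, b[ w1 -> square_integrable a b w2 ->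
  {ae mu, forall x, a < x < b -> w1 x = w2 x} -> square_integrable a b w1.
Proof.
move=> m1 [m2 n2] e; split=> //; move: n2; rewrite /finite_norm.
suff -> : ('N[mu]_2%:E[EFin \o (w2 \_ `]a, b[)] = 'N[mu]_2%:E[EFin \o (w1 \_ `]a, b[)])%E by [].
have E : ('N[mu]_2%:E[EFin \o (w2 \_ `]a, b[)] `^ 2 =
    'N[mu]_2%:E[EFin \o (w1 \_ `]a, b[)] `^ 2)%E.
  rewrite !Lnorm2E //; apply: ge0_ae_eq_integral.
  - exact: measurable_itv.
  - by apply/measurable_EFinP; exact: measurable_funX.
  - by apply/measurable_EFinP; exact: measurable_funX.
  - by move=> x _; rewrite lee_fin sqr_ge0.
  - by move=> x _; rewrite lee_fin sqr_ge0.
  by apply: ae_imply e => x h; rewrite /= in_itv /= => /h ->.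
have := congr1 (fun z => (z `^ 2^-1)%E) E.
by rewrite -!poweRrM divff // !poweRe1 // Lnorm_ge0.
Qed.

Lemma square_integrable_facts a b w : square_integrable a b w ->
  let N := fine ('N[mu]_2%:E[EFin \o (w \_ `]a, b[)]) in
  [/\ mu.-integrable `]a, b[ (EFin \o w), mu.-integrable `[a, b] (EFin \o w),
      mu.-integrable `[a, b] (EFin \o (fun x => w x ^+ 2)) &
      \int[mu]_(x in `[a, b]) w x ^+ 2 = N ^+ 2].
Proof.
move=> [mw nw] N; have mD : measurable `]a, b[%classic by exact: measurable_itv.
have mw2 : measurable_fun `]a, b[ (fun x => w x ^+ 2) by exact: measurable_funX.
have NE : (\int[mu]_(x in `]a, b[) (w x ^+ 2)%:E = (N ^+ 2)%:E)%E.
  rewrite -Lnorm2E // -[X in (X `^ _)%E]fineK ?poweR_EFin; last first.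
    by rewrite ge0_fin_numE ?Lnorm_ge0.
  by rewrite powR_mulrn // fine_ge0 // Lnorm_ge0.
have w2i : mu.-integrable `]a, b[ (EFin \o (fun x => w x ^+ 2)).
  apply/integrableP; split; first exact/measurable_EFinP.
  rewrite (_ : (\int[mu]_(x in _) _)%E = (N ^+ 2)%:E) ?ltry //.
  by rewrite -NE; apply: eq_integral => x _ /=; rewrite ger0_norm ?sqr_ge0.
have onei : mu.-integrable `]a, b[ (EFin \o (fun=> (1 : R))).
  have sub : `]a, b[%classic `<=` `[a, b]%classic by exact: subset_itv_oo_cc.
  have mC : measurable `[a, b]%classic by exact: measurable_itv.
  apply: (@integrableS _ _ _ mu `[a, b]%classic _ _ mC mD sub).
  by apply: continuous_integrable_itv => x; exact: cst_continuous.
have sumi : mu.-integrable `]a, b[ (EFin \o (fun x => 1 + w x ^+ 2)).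
  exact: (@integrableD _ _ _ mu _ mD _ _ onei w2i).
have wi : mu.-integrable `]a, b[ (EFin \o w).
  apply: (@le_integrable _ _ _ mu _ mD _ _ _ _ sumi); first exact/measurable_EFinP.
  move=> x _ /=; rewrite lee_fin [X in _ <= X]ger0_norm; last by rewrite addr_ge0 ?sqr_ge0.
  have := sqr_ge0 (`|w x| - 1); rewrite -[w x ^+ 2]real_normK ?num_real //.
  have := normr_ge0 (w x); nra.
split=> //; [exact: integrable_oo_cc|exact: integrable_oo_cc|].
rewrite Rintegral_oo_cc //; apply/EFin_inj.
by rewrite EFin_Rintegral.
Qed.

(** Cauchy-Schwarz against the constant one, from the nonnegativity of the
    integral of the square of [w - mean of w]. *)
Lemma Rintegral_sqr_le a b w : a <= b -> mu.-integrable `[a, b] (EFin \o w) ->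
  mu.-integrable `[a, b] (EFin \o (fun x => w x ^+ 2)) ->
  (\int[mu]_(x in `[a, b]) w x) ^+ 2 <= (b - a) * \int[mu]_(x in `[a, b]) w x ^+ 2.
Proof.
rewrite le_eqVlt => /predU1P[<-|ab] wi w2i.
  by rewrite set_itv1 !Rintegral_set1 expr0n mulr0.
set I := \int[mu]_(x in _) w x; set J := \int[mu]_(x in _) _.
have mD : measurable `[a, b]%classic by exact: measurable_itv.
pose m := I / (b - a); have l0 : 0 < b - a by rewrite subr_gt0.
have ci (v : R) : mu.-integrable `[a, b] (EFin \o (fun=> v)).
  by apply: continuous_integrable_itv => x; exact: cst_continuous.
have mwi : mu.-integrable `[a, b] (EFin \o (fun x => (2 * m) * w x)).
  exact: (@integrableZl _ _ _ mu _ mD (2 * m) _ wi).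
have di : mu.-integrable `[a, b] (EFin \o (fun x => w x ^+ 2 - 2 * m * w x)).
  exact: (@integrableB _ _ _ mu _ mD _ _ w2i mwi).
have : 0 <= \int[mu]_(x in `[a, b]) (w x ^+ 2 - 2 * m * w x + m ^+ 2).
  apply: Rintegral_ge0 => x _; have := sqr_ge0 (w x - m); nra.
rewrite (@RintegralD _ _ _ mu _ _ _ mD di (ci _)) (@RintegralB _ _ _ mu _ _ _ mD w2i mwi).
rewrite (@RintegralZl _ _ _ mu _ _ _ mD wi) (@Rintegral_cst _ _ _ mu _ mD).
have muD : fine (mu `[a, b]%classic) = b - a.
  by rewrite lebesgue_measure_itv /= lte_fin ab.
rewrite muD -/I -/J => h.
have e : J - 2 * m * I + m ^+ 2 * (b - a) = J - I ^+ 2 / (b - a).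
  by rewrite /m; field; rewrite gt_eqF.
move: h; rewrite e subr_ge0 ler_pdivrMr // mulrC //.
Qed.

End SquareIntegrable.

Section SobolevRegular.
Context {R : realType}.
Local Notation mu := (@lebesgue_measure R).
Variables (a b : R) (k : nat) (f : R -> R).
Hypothesis ab : a < b.
Hypothesis Sf : sobolev a b k.+1 f.

Let w m := weak_derivative a b m f.
Let F m := pointwise_derivative a b m f.
Let H := sobolev_norm a b k.+1 f.

Lemma sobolev_weak m : (m <= k.+1)%N ->
  is_weak_derivative a b m f (w m) /\ square_integrable a b (w m).
Proof.
move=> mk; have [w' dw' sw'] := Sf mk.
have dw : is_weak_derivative a b m f (w m).
  exact: (@xgetPex _ (cst 0) [set w | is_weak_derivative a b m f w] (ex_intro _ w' dw')).
split=> //; apply: square_integrable_ae sw' (weak_derivative_unique dw dw').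
by case: dw => _ [].
Qed.

Lemma sobolev_norm_ge0 : 0 <= H.
Proof. exact: sqrtr_ge0. Qed.

Lemma sobolev_norm_ge m : (m <= k.+1)%N ->
  \int[mu]_(x in `[a, b]) w m x ^+ 2 <= H ^+ 2.
Proof.
move=> mk; have [_ /square_integrable_facts[_ _ _ ->]] := sobolev_weak mk.
rewrite /H /sobolev_norm sqr_sqrtr; last by apply: sumr_ge0 => i _; exact: sqr_ge0.
have mk' : (m < k.+2)%N by [].
rewrite (bigD1 (Ordinal mk')) //= lerDl; apply: sumr_ge0 => i _; exact: sqr_ge0.
Qed.

Lemma sobolev_representative m : (m <= k)%N ->
  [/\ {within `[a, b], continuous F m}, {ae mu, forall x, a < x < b -> F m x = w m x} &
    forall x y, a <= x -> x <= y -> y <= b ->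
      F m y - F m x = \int[mu]_(t in `[x, y]) w m.+1 t].
Proof.
move=> mk; have [dw _] := sobolev_weak (leqW mk).
have mk1 : (m.+1 <= k.+1)%N by [].
have [dw1 sw1] := sobolev_weak mk1.
have [wi _ _ _] := square_integrable_facts sw1.
have [v [cv vw vinc]] := weak_representative ab (weak_derivative_succ dw dw1) wi.
have [cF Fw] : {within `[a, b], continuous F m} /\ ae_eq mu `]a, b[%classic (F m) (w m).
  apply: (@xgetPex _ (cst 0) [set v : R -> R | {within `[a, b], continuous v} /\
                        ae_eq mu `]a, b[%classic v (w m)]).
  exists v; split=> //; apply: ae_imply vw => x h; rewrite /= in_itv /=; exact: h.
have Fw' : {ae mu, forall x, a < x < b -> F m x = w m x}.
  by apply: ae_imply Fw => x h axb; apply: h; rewrite /= in_itv.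
split=> // x y ax xy yb; rewrite -vinc //.
have Fv : {ae mu, forall z, a < z < b -> F m z = v z}.
  by apply: ae_imply2 Fw' vw => z h1 h2 azb; rewrite h1 // h2.
have e := continuous_ae_eq ab cF cv Fv.
by rewrite (e x) ?(e y) // ?ax ?(le_trans ax xy) ?(le_trans xy yb).
Qed.

Lemma weak_integrable_sub m x y : (m <= k.+1)%N -> a <= x -> y <= b ->
  mu.-integrable `[x, y] (EFin \o w m) /\
  mu.-integrable `[x, y] (EFin \o (fun t => w m t ^+ 2)).
Proof.
move=> mk ax yb; have [_ /square_integrable_facts[_ i1 i2 _]] := sobolev_weak mk.
have sub : `[x, y]%classic `<=` `[a, b]%classic.
  by move=> z /=; rewrite !in_itv /= => /andP[? ?]; apply/andP; split; lra.
by split; apply: (@integrableS _ _ _ mu `[a, b]%classic _ _ _ _ sub) => //; exact: measurable_itv.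
Qed.

(** The square of [F m x = F m y + (F m x - F m y)] is averaged over [y]. The
    dependence on the length of the interval is kept explicit, because one of
    the intervals is the time interval, on which constants may not depend. *)
Lemma sobolev_sup m x : (m <= k)%N -> a <= x <= b ->
  F m x ^+ 2 <= 2 * ((b - a)^-1 + (b - a)) * H ^+ 2.
Proof.
have aux (i h l : R) : i <= h -> 2 * i + 2 * (l * h) * l <= 2 * h + 2 * l * (l * h) by lra.
have aux2 (u v z : R) : (u - v) ^+ 2 <= z -> u ^+ 2 <= 2 * v ^+ 2 + 2 * z.
  by have := sqr_ge0 (u - 2 * v); lra.
move=> mk axb; have [cF Fw Finc] := sobolev_representative mk.
have l0 : 0 < b - a by rewrite subr_gt0.
have [i1 i2] := weak_integrable_sub (leqW mk) (lexx a) (lexx b).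
have mk1 : (m.+1 <= k.+1)%N by [].
have inc y z : a <= y -> y <= z -> z <= b -> (F m z - F m y) ^+ 2 <= (b - a) * H ^+ 2.
  move=> ay yz zb; rewrite Finc //.
  have [j1 j2] := weak_integrable_sub mk1 ay zb.
  apply: le_trans (Rintegral_sqr_le yz j1 j2) _.
  have h0 : 0 <= \int[mu]_(t in `[y, z]) w m.+1 t ^+ 2.
    by apply: Rintegral_ge0 => t _; exact: sqr_ge0.
  have h1 : \int[mu]_(t in `[y, z]) w m.+1 t ^+ 2 <= H ^+ 2.
    apply: le_trans (sobolev_norm_ge mk1).
    have [k1 k2] := weak_integrable_sub mk1 (lexx a) (lexx b).
    rewrite -lee_fin !EFin_Rintegral //.
    apply: ge0_subset_integral => //.
    - by case/integrableP: k2.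
    - by move=> t _; rewrite lee_fin sqr_ge0.
    by move=> t /=; rewrite !in_itv /= => /andP[? ?]; apply/andP; split; lra.
  by apply: ler_pM => //; lra.
have key : (b - a) * F m x ^+ 2 <= 2 * H ^+ 2 + 2 * (b - a) * ((b - a) * H ^+ 2).
  have mD : measurable `[a, b]%classic by exact: measurable_itv.
  have ci (v : R) : mu.-integrable `[a, b] (EFin \o (fun=> v)).
    by apply: continuous_integrable_itv => t; exact: cst_continuous.
  have Zi : mu.-integrable `[a, b] (EFin \o (fun t => 2 * w m t ^+ 2)).
    exact: (@integrableZl _ _ _ mu _ mD 2 _ i2).
  have Di : mu.-integrable `[a, b] (EFin \o (fun t => 2 * w m t ^+ 2 + 2 * ((b - a) * H ^+ 2))).
    exact: (@integrableD _ _ _ mu _ mD _ _ Zi (ci _)).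
  have muD : fine (mu `[a, b]%classic) = b - a.
    by rewrite lebesgue_measure_itv /= lte_fin ab.
  have e1 : (b - a) * F m x ^+ 2 = \int[mu]_(t in `[a, b]) F m x ^+ 2.
    by rewrite (@Rintegral_cst _ _ _ mu _ mD) muD mulrC.
  have e2 : \int[mu]_(t in `[a, b]) (2 * w m t ^+ 2 + 2 * ((b - a) * H ^+ 2)) =
     2 * \int[mu]_(t in `[a, b]) w m t ^+ 2 + 2 * ((b - a) * H ^+ 2) * (b - a).
    rewrite (@RintegralD _ _ _ mu _ _ _ mD Zi (ci _)) (@RintegralZl _ _ _ mu _ _ _ mD i2).
    by rewrite (@Rintegral_cst _ _ _ mu _ mD) muD.
  apply: (@le_trans _ _ (\int[mu]_(t in `[a, b])
      (2 * w m t ^+ 2 + 2 * ((b - a) * H ^+ 2)))); last first.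
    rewrite e2; apply: aux; exact: (sobolev_norm_ge (leqW mk)).
  have sub : `]a, b[%classic `<=` `[a, b]%classic by exact: subset_itv_oo_cc.
  have mO : measurable `]a, b[%classic by exact: measurable_itv.
  have Do := @integrableS _ _ _ mu _ _ _ mD mO sub Di.
  have Co := @integrableS _ _ _ mu _ _ _ mD mO sub (ci (F m x ^+ 2)).
  rewrite e1 (Rintegral_oo_cc Do) (Rintegral_oo_cc Co) -lee_fin !EFin_Rintegral //.
  apply: ae_ge0_le_integral => //.
  - by move=> t _; rewrite lee_fin sqr_ge0.
  - have nn : 0 <= 2 * ((b - a) * H ^+ 2).
      by rewrite mulr_ge0 // mulr_ge0 ?sqr_ge0 // ltW.
    by move=> t _; rewrite lee_fin addr_ge0 // mulr_ge0 ?sqr_ge0.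
  - by case/integrableP: Do.
  apply: ae_imply Fw => t h /=; rewrite in_itv /= => atb; rewrite lee_fin.
  have := h atb; case/andP: atb => at_ tb <-; case/andP: axb => ax xb.
  have hd : (F m x - F m t) ^+ 2 <= (b - a) * H ^+ 2.
    have [xt|tx] := lerP x t.
      by rewrite -sqrrN opprB; apply: inc => //; exact: ltW.
    by apply: inc => //; exact: ltW.
  exact: aux2.
rewrite -ler_pdivlMl // in key; apply: le_trans key _.
rewrite le_eqVlt; apply/orP; left; apply/eqP; field; rewrite gt_eqF //.
Qed.

(** The function [P] is the primitive of the square of the last derivative, and
    the bound on increments is the Cauchy-Schwarz inequality. Its increments over
    disjoint cells add up to at most the squared norm, which a plain Hoelder
    bound would not give. *)
Lemma sobolev_modulus : exists P : R -> R, [/\ P a = 0, P b <= H ^+ 2,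
  forall x y, a <= x -> x <= y -> y <= b -> P x <= P y &
  forall x y, a <= x -> x <= y -> y <= b -> (F k y - F k x) ^+ 2 <= (y - x) * (P y - P x)].
Proof.
have [cF Fw Finc] := sobolev_representative (leqnn k).
pose P x : R := \int[mu]_(t in `[a, x]) w k.+1 t ^+ 2.
have Pinc x y : a <= x -> x <= y -> y <= b ->
    P y - P x = \int[mu]_(t in `[x, y]) w k.+1 t ^+ 2.
  move=> ax xy yb; have [_ i1] := weak_integrable_sub (leqnn _) (lexx a) yb.
  have [_ i2] := weak_integrable_sub (leqnn _) ax yb.
  rewrite /P (@Rintegral_itvB R _ (BLeft a) (BRight y) x) ?bnd_simp //.
  rewrite Rintegral_itv_obnd_cbnd //.
  have sub : `]x, y]%classic `<=` `[x, y]%classic by exact: subset_itv_oc_cc.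
  apply: (@integrableS _ _ _ mu `[x, y]%classic _ _ _ _ sub) => //; exact: measurable_itv.
exists P; split.
- by rewrite /P set_itv1 Rintegral_set1.
- exact: (sobolev_norm_ge (leqnn _)).
- move=> x y ax xy yb; rewrite -subr_ge0 Pinc //.
  by apply: Rintegral_ge0 => t _; exact: sqr_ge0.
move=> x y ax xy yb; rewrite Finc // Pinc //.
have [i1 i2] := weak_integrable_sub (leqnn _) ax yb.
exact: Rintegral_sqr_le.
Qed.

Lemma sobolev_increment m x y : (m < k)%N -> a <= x -> x <= y -> y <= b ->
  F m y - F m x = \int[mu]_(t in `[x, y]) F m.+1 t.
Proof.
move=> mk ax xy yb; have [_ _ ->] // := sobolev_representative (ltnW mk).
have [cF Fw _] := sobolev_representative mk.
have [i1 _] := weak_integrable_sub (leqW mk) ax yb.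
have subab : `[x, y]%classic `<=` `[a, b]%classic.
  by move=> z /=; rewrite !in_itv /= => /andP[? ?]; apply/andP; split; lra.
have i2 : mu.-integrable `[x, y] (EFin \o F m.+1).
  apply: continuous_compact_integrable; first exact: segment_compact.
  exact: continuous_subspaceW subab cF.
have sub : `]x, y[%classic `<=` `[x, y]%classic by exact: subset_itv_oo_cc.
have mO : measurable `]x, y[%classic by exact: measurable_itv.
have mC : measurable `[x, y]%classic by exact: measurable_itv.
have o1 := @integrableS _ _ _ mu _ _ _ mC mO sub i1.
have o2 := @integrableS _ _ _ mu _ _ _ mC mO sub i2.
rewrite (Rintegral_oo_cc o1) (Rintegral_oo_cc o2); apply/EFin_inj.
rewrite !EFin_Rintegral //; apply: ae_eq_integral => //.
- by case/integrableP: o1.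
- by case/integrableP: o2.
apply: ae_imply Fw => z h; rewrite /= in_itv /= => /andP[xz zy].
by rewrite h //; apply/andP; split; lra.
Qed.

Lemma sobolev_zero : {ae mu, forall x, a < x < b -> F 0%N x = f x}.
Proof.
have [_ Fw _] := sobolev_representative (leq0n k).
have [dw _] := sobolev_weak (leq0n _); have [lf _ _] := dw.
have := weak_derivative_unique dw (weak_derivative_self lf).
by apply: ae_imply2 Fw => x h1 h2 axb; rewrite h1 // h2.
Qed.

End SobolevRegular.

(** * Null sets under affine maps *)

Section AffineChange.
Context {R : realType}.
Local Notation mu := (@lebesgue_measure R).

(** Both sides are measures in [A] that agree on intervals. *)
Lemma lebesgue_measure_affine (s v : R) (A : set R) : s != 0 -> measurable A ->
  (`|s|%:E * mu ((fun x : R => (s * x + v)%R) @^-1` A) = mu A)%E.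
Proof.
move=> s0 mA; pose phi : measurableTypeR R -> measurableTypeR R := fun x => s * x + v.
have mphi : measurable_fun [set: measurableTypeR R] phi.
  apply: continuous_measurable_fun; apply: (continuous_affine_comp (g := id)).
  by move=> x; exact: cvg_id.
pose nu := mscale (NngNum (normr_ge0 s))
  (@measure_function_pushforward__canonical__measure_function_Measure _ _ _ _ _ mu phi mphi).
suff H : forall X, ocitv X -> lebesgue_measure X = nu X.
  by have := lebesgue_measure_unique H mA; rewrite /nu /mscale /= /pushforward => ->.
move=> _ [[a b]] _ <-; rewrite /nu /mscale /= /pushforward.
have n0 : 0 < `|s| by rewrite normr_gt0.
have [sp|sn|sE] := ltgtP s 0; last by rewrite sE eqxx in s0.
- have -> : phi @^-1` `]a, b]%classic = `[(b - v) / s, (a - v) / s[%classic.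
    apply/seteqP; split => x /=; rewrite !in_itv /= /phi ler_ndivrMr // ltr_ndivlMr //.
      by move=> /andP[? ?]; apply/andP; split; lra.
    by move=> /andP[? ?]; apply/andP; split; lra.
  rewrite !lebesgue_measure_itv /= !lte_fin.
  rewrite ltr_nM2r ?invr_lt0 // ltrD2r; case: ifP => _; last by rewrite mule0.
  rewrite -!EFinD -EFinM; congr EFin; rewrite ltr0_norm //; field; exact: s0.
- have -> : phi @^-1` `]a, b]%classic = `](a - v) / s, (b - v) / s]%classic.
    apply/seteqP; split => x /=; rewrite !in_itv /= /phi ltr_pdivrMr // ler_pdivlMr //.
      by move=> /andP[? ?]; apply/andP; split; lra.
    by move=> /andP[? ?]; apply/andP; split; lra.
  rewrite !lebesgue_measure_itv /= !lte_fin.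
  rewrite ltr_pM2r ?invr_gt0 // ltrD2r; case: ifP => _; last by rewrite mule0.
  rewrite -!EFinD -EFinM; congr EFin; rewrite gtr0_norm //; field; exact: s0.
Qed.

Lemma ae_affine (s v : R) (P : R -> Prop) : s != 0 ->
  {ae mu, forall x, P x} -> {ae mu, forall x, P (s * x + v)}.
Proof.
move=> s0 [N [mN N0 sub]]; exists ((fun x => s * x + v) @^-1` N); split.
- rewrite -[X in measurable X]setTI.
  have m : measurable_fun [set: R] (fun x : R => s * x + v).
    apply: continuous_measurable_fun; apply: (continuous_affine_comp (g := id)).
    by move=> x; exact: cvg_id.
  exact: m measurableT _ mN.
- have := @lebesgue_measure_affine s v N s0 mN; rewrite N0 => /eqP.
  by rewrite mule_eq0 eqe normr_eq0 (negbTE s0) /= => /eqP.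
by move=> x /= nP; apply: sub.
Qed.

End AffineChange.

(** * Gluing the initial and the boundary data *)

Section Modulus.
Context {R : realType}.
Implicit Types (F P : R -> R) (x y z : R).

(** Satisfied by the primitives of square integrable functions, with [P] a
    primitive of the square. It passes to gluings, and the increments of [P] over
    disjoint intervals can be summed. *)
Definition half_modulus F P := forall y z, y <= z ->
  P y <= P z /\ (F z - F y) ^+ 2 <= (z - y) * (P z - P y).

(** The Cauchy-Schwarz inequality in the plane for the vectors with coordinates
    the square roots of [p], [q] and of [A], [B]. *)
Lemma sqr_add_le (al be p q A B : R) : 0 <= p -> 0 <= q -> 0 <= A -> 0 <= B ->
  al ^+ 2 <= p * A -> be ^+ 2 <= q * B -> (al + be) ^+ 2 <= (p + q) * (A + B).
Proof.
move=> p0 q0 A0 B0 ha hb.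
have h : (2 * (al * be)) ^+ 2 <= (p * B + q * A) ^+ 2.
  have h1 : al ^+ 2 * be ^+ 2 <= (p * A) * (q * B) by apply: ler_pM => //; exact: sqr_ge0.
  have := sqr_ge0 (p * B - q * A); lra.
have s0 : 0 <= p * B + q * A by rewrite addr_ge0 ?mulr_ge0.
have : 2 * (al * be) <= p * B + q * A.
  apply: le_trans (ler_norm _) _.
  by rewrite -ler_sqr ?nnegrE // real_normK ?num_real.
lra.
Qed.

Lemma min_clamp y z b : 0 <= b -> 0 <= y -> y <= z ->
  [/\ 0 <= Num.min y b, Num.min y b <= Num.min z b, Num.min z b <= b &
      Num.min z b - Num.min y b <= z - y].
Proof.
by move=> b0 y0 yz; rewrite /Order.min; case: ifP => h1; case: ifP => h2; split; lra.
Qed.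

(** On each side the bound on increments is inherited, and across the origin it
    follows from [sqr_add_le]. Beyond the given intervals the functions are
    prolonged by constants, for which the truncation of the argument is a
    contraction. *)
Lemma glued_half_modulus b1 b2 (q s : R) F1 P1 F2 P2 N1 N2 : 0 <= b1 -> 0 <= b2 -> 0 < q ->
  P1 0 = 0 -> P2 0 = 0 -> P1 b1 <= N1 -> P2 b2 <= N2 ->
  (forall x y, 0 <= x -> x <= y -> y <= b1 -> P1 x <= P1 y) ->
  (forall x y, 0 <= x -> x <= y -> y <= b2 -> P2 x <= P2 y) ->
  (forall x y, 0 <= x -> x <= y -> y <= b1 -> (F1 y - F1 x) ^+ 2 <= (y - x) * (P1 y - P1 x)) ->
  (forall x y, 0 <= x -> x <= y -> y <= b2 -> (F2 y - F2 x) ^+ 2 <= (y - x) * (P2 y - P2 x)) ->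
  F1 0 = s * F2 0 ->
  let h y := if 0 <= y then F1 (Num.min y b1) else s * F2 (Num.min (- (q * y)) b2) in
  exists2 P, half_modulus h P & forall y, - (s ^+ 2 * q * N2) <= P y <= N1.
Proof.
move=> b10 b20 q0 P10 P20 PN1 PN2 mP1 mP2 H1 H2 glue h.
have s2 := sqr_ge0 s.
pose P y := if 0 <= y then P1 (Num.min y b1) else - (s ^+ 2 * q * P2 (Num.min (- (q * y)) b2)).
have c0 : 0 <= s ^+ 2 * q by rewrite mulr_ge0 // ltW.
have right y z : 0 <= y -> y <= z -> P1 (Num.min y b1) <= P1 (Num.min z b1) /\
    (F1 (Num.min z b1) - F1 (Num.min y b1)) ^+ 2 <=
    (z - y) * (P1 (Num.min z b1) - P1 (Num.min y b1)).
  move=> y0 yz; have [k1 k2 k3 k4] := min_clamp b10 y0 yz.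
  have m1 := mP1 _ _ k1 k2 k3; split=> //.
  by apply: le_trans (H1 _ _ k1 k2 k3) _; rewrite ler_wpM2r // subr_ge0.
have left y z : z <= 0 -> y <= z ->
    P2 (Num.min (- (q * z)) b2) <= P2 (Num.min (- (q * y)) b2) /\
    (s * F2 (Num.min (- (q * z)) b2) - s * F2 (Num.min (- (q * y)) b2)) ^+ 2 <=
    (z - y) * (s ^+ 2 * q * (P2 (Num.min (- (q * y)) b2) - P2 (Num.min (- (q * z)) b2))).
  move=> z0 yz.
  have qz : 0 <= - (q * z) by rewrite oppr_ge0 mulr_ge0_le0 // ltW.
  have qyz : - (q * z) <= - (q * y) by rewrite lerN2 ler_wpM2l // ltW.
  have [k1 k2 k3 k4] := min_clamp b20 qz qyz.
  have m2 := mP2 _ _ k1 k2 k3; split=> //.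
  rewrite -mulrBr exprMn -[(F2 _ - F2 _) ^+ 2]sqrrN opprB.
  have := H2 _ _ k1 k2 k3; set d := F2 _ - F2 _; set dp := P2 _ - P2 _ => hd.
  have dp0 : 0 <= dp by rewrite subr_ge0.
  have : d ^+ 2 <= q * (z - y) * dp.
    apply: le_trans hd _; rewrite ler_wpM2r //; lra.
  move/(ler_wpM2l s2) => /le_trans; apply.
  by rewrite le_eqVlt; apply/orP; left; apply/eqP; ring.
exists P; last first.
  move=> y; rewrite /P; case: ifP => [y0|/negbT]; last rewrite -ltNge => y0.
    have [k1 k2 k3 _] := min_clamp b10 y0 (lexx y).
    have h1 := mP1 _ _ (lexx 0) k1 k3; have h2 := mP1 _ _ k1 k3 (lexx b1).
    have N20 : 0 <= N2 by apply: le_trans PN2; rewrite -P20; exact: mP2.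
    have := mulr_ge0 c0 N20 => h3; rewrite P10 in h1.
    by apply/andP; split; lra.
  have qy : 0 <= - (q * y) by rewrite oppr_ge0 mulr_ge0_le0 // ltW.
  have [k1 k2 k3 _] := min_clamp b20 qy (lexx _).
  have h1 := mP2 _ _ (lexx 0) k1 k3; have h2 := mP2 _ _ k1 k3 (lexx b2).
  rewrite P20 in h1; have N10 : 0 <= N1 by apply: le_trans PN1; rewrite -P10; exact: mP1.
  have h3 := mulr_ge0 c0 h1.
  have h4 : s ^+ 2 * q * P2 (Num.min (- (q * y)) b2) <= s ^+ 2 * q * N2.
    by rewrite ler_wpM2l // (le_trans h2).
  by apply/andP; split; lra.
move=> y z yz; rewrite /P /h.
have [y0|y0] := lerP 0 y; first by rewrite (le_trans y0 yz); exact: right.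
have [z0|z0] := lerP 0 z; last first.
  have [l1 l2] := left y z (ltW z0) yz; split.
    by rewrite lerN2 ler_wpM2l.
  apply: le_trans l2 _; rewrite le_eqVlt; apply/orP; left; apply/eqP; ring.
have [r1 r2] := right 0 z (lexx 0) z0; have [l1 l2] := left y 0 (lexx 0) (ltW y0).
have m1 : Num.min 0 b1 = 0 by apply/min_idPl.
have m2 : Num.min (- (q * 0)) b2 = 0 by rewrite mulr0 oppr0; apply/min_idPl.
rewrite m1 P10 in r1 r2; rewrite m2 P20 in l1 l2.
have h0 := mulr_ge0 c0 l1; split; first by lra.
have -> : F1 (Num.min z b1) - s * F2 (Num.min (- (q * y)) b2) =
   (F1 (Num.min z b1) - F1 0) + (s * F2 0 - s * F2 (Num.min (- (q * y)) b2)).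
  by rewrite glue; ring.
have -> : z - y = (z - 0) + (0 - y) by ring.
rewrite opprK -[P1 _ + _](_ : (P1 (Num.min z b1) - 0) +
   (s ^+ 2 * q * (P2 (Num.min (- (q * y)) b2) - 0)) = _); last by ring.
apply: sqr_add_le => //; rewrite ?subr_ge0 ?subr0 // ?mulr_ge0 // ltW //.
Qed.

Lemma half_modulus_continuous F P M : half_modulus F P -> (forall y z, P z - P y <= M) ->
  forall x, {for x, continuous F}.
Proof.
move=> H PM x; apply/cvgrPdist_le => e e0.
have M0 : 0 <= M by have := PM 0 0; rewrite subrr.
have M1 : 0 < M + 1 by lra.
near=> y.
have hy : `|x - y| <= e ^+ 2 / (M + 1).
  near: y; apply: (@cvgr_dist_le _ _ _ _ _ id x) => //.
  by rewrite divr_gt0 // exprn_gt0.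
have key : (F x - F y) ^+ 2 <= `|x - y| * (M + 1).
  have [xy|/ltW yx] := leP x y.
    have [p1 p2] := H _ _ xy; rewrite -sqrrN opprB ler0_norm ?subr_le0 // opprB.
    by apply: le_trans p2 _; rewrite ler_wpM2l ?subr_ge0 //; have := PM x y; lra.
  have [p1 p2] := H _ _ yx; rewrite ger0_norm ?subr_ge0 //.
  by apply: le_trans p2 _; rewrite ler_wpM2l ?subr_ge0 //; have := PM y x; lra.
rewrite -(@ler_pXn2r _ 2) ?nnegrE ?(ltW e0) // real_normK ?num_real //.
by apply: le_trans key _; rewrite -ler_pdivlMr.
Unshelve. all: by end_near. Qed.

(** Primitives of [top] are taken [k] times, the constants of integration being
    the prescribed values at the origin. *)
Lemma exists_tower k (top : R -> R) (c : nat -> R) : (forall x, {for x, continuous top}) ->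
  exists h : nat -> R -> R, [/\ h k = top, forall m, (m < k)%N -> h m 0 = c m &
    forall m x, (m < k)%N -> is_derive x 1 (h m) (h m.+1 x)].
Proof.
elim: k top => [|k IH] top ctop; first by exists (fun=> top).
have [p p0 dp] := exists_primitive (c k) ctop.
have [h [hk h0 dh]] := IH p (fun x => is_derive_continuous (dp x)).
exists (fun m => if (m <= k)%N then h m else top); split.
- by rewrite ltnn.
- move=> m; rewrite ltnS => mk; rewrite mk.
  by move: mk; rewrite leq_eqVlt => /predU1P[->|/h0//]; rewrite hk.
move=> m x; rewrite ltnS => mk; rewrite mk.
move: mk; rewrite leq_eqVlt => /predU1P[->|mk]; last by rewrite mk; exact: dh.
by rewrite ltnn hk.
Qed.

End Modulus.

(** * The transported profile *)

Section TransportIntegral.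
Context {R : realType}.
Local Notation mu := (@lebesgue_measure R).

Lemma ae_neq (c : R) : {ae mu, forall x, x <> c}.
Proof.
exists [set c]; split; first exact: measurable_set1.
- exact: lebesgue_measure_set1.
- by move=> x /= /contrapT.
Qed.

Lemma measurable_transport (a L T t x1 x2 : R) (f g : R -> R) : 0 < a ->
  measurable_fun `]0, L[ f -> measurable_fun `]0, T[ g -> 0 <= t <= T ->
  0 <= x1 -> x1 <= x2 -> x2 <= L ->
  measurable_fun `[x1, x2] (transport_solution a f g t).
Proof.
move=> a0 mf mg /andP[t0 tT] x10 x12 x2L.
have at0 : 0 <= a * t by rewrite mulr_ge0 // ltW.
have maff (c d s v : R) : measurable_fun `]c, d[ (fun x : R => s * x + v).
  apply: continuous_measurable_set; apply: (continuous_affine_comp (g := id)).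
  by move=> x; exact: cvg_id.
have right c d : a * t <= c -> d <= L -> measurable_fun `[c, d] (transport_solution a f g t).
  move=> ac dL; apply: (@measurable_fun_itv_cc R c d false true).
  apply: (@eq_measurable_fun _ _ _ _ _ (f \o (fun x => 1 * x + - (a * t)))).
    move=> x /set_mem /=; rewrite in_itv /= => /andP[cx xd].
    by rewrite /transport_solution mul1r ifT //; lra.
  apply: (@measurable_comp _ _ _ _ _ _ `]0, L[%classic) => //.
  move=> _ [x /= + <-]; rewrite !in_itv /= => /andP[cx xd].
  by apply/andP; split; lra.
have left c d : 0 <= c -> d <= a * t -> measurable_fun `[c, d] (transport_solution a f g t).
  move=> c0 da; apply: (@measurable_fun_itv_cc R c d false true).
  apply: (@eq_measurable_fun _ _ _ _ _ (g \o (fun x => - a^-1 * x + t))).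
    move=> x /set_mem /=; rewrite in_itv /= => /andP[cx xd].
    rewrite /transport_solution ifF; last by apply/negbTE; rewrite -ltNge; lra.
    by congr g; rewrite mulNr addrC mulrC.
  apply: (@measurable_comp _ _ _ _ _ _ `]0, T[%classic) => //.
  move=> _ [x /= + <-]; rewrite !in_itv /= => /andP[cx xd].
  have h1 : a^-1 * x < t by rewrite mulrC ltr_pdivrMr //; lra.
  have h2 : 0 < a^-1 * x by rewrite mulr_gt0 ?invr_gt0 //; lra.
  by apply/andP; split; lra.
have [h|h] := leP (a * t) x1; first exact: right.
have [h'|h'] := leP x2 (a * t); first exact: left.
rewrite (@itv_bndbnd_setU _ _ _ (BRight (a * t))) ?bnd_simp ?(ltW h) ?(ltW h') //.
have sub : `]a * t, x2]%classic `<=` `[a * t, x2]%classic by exact: subset_itv_oc_cc.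
apply/measurable_funU; try exact: measurable_itv.
split; first by apply: left => //; exact: lexx.
apply: (measurable_funS _ sub); first exact: measurable_itv.
exact: right.
Qed.

End TransportIntegral.

Section ExtendedProfile.
Context {R : realType}.
Local Notation mu := (@lebesgue_measure R).
Variables (a L T D : R) (k : nat) (f g : R -> R).
Hypothesis a0 : 0 < a.
Hypothesis L0 : 0 < L.
Hypothesis D0 : 0 <= D.
Hypothesis T1 : 1 <= T.
Hypothesis Sf : sobolev 0 L k.+1 f.
Hypothesis Sg : sobolev 0 T k.+1 g.
Hypothesis compat : forall m : nat, (m <= k)%N ->
  pointwise_derivative 0 L m f 0 = (- a) ^- m * pointwise_derivative 0 T m g 0.

Let F m := pointwise_derivative 0 L m f.
Let G m := pointwise_derivative 0 T m g.
Let T0 : 0 < T. Proof. exact: lt_le_trans T1. Qed.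

(** The derivative of order [k] of the profile that equals [f] to the right of
    the origin and [g (- y / a)] to the left of it. *)
Let top (y : R) := if 0 <= y then F k (Num.min y L)
  else (- a) ^- k * G k (Num.min (- (a^-1 * y)) T).

Variables (A : nat -> R -> R) (P : R -> R) (M : R).
Hypothesis A_top : A k.+1 = top.
Hypothesis A_mod : half_modulus top P.
Hypothesis P_bound : forall y z, P z - P y <= M.
Hypothesis A_val : forall m, (m < k)%N -> A m.+1 0 = F m 0.
Hypothesis A_derive : forall m (x : R), (m <= k)%N -> is_derive x 1 (A m) (A m.+1 x).

Lemma profile_continuous m (x : R) : (m <= k.+1)%N -> {for x, continuous (A m)}.
Proof.
rewrite leq_eqVlt => /predU1P[->|]; last first.
  by rewrite ltnS => mk; apply: is_derive_continuous (A_derive x mk).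
rewrite A_top; exact: half_modulus_continuous A_mod P_bound x.
Qed.

(** Downward induction on the order: both sides have the same value at the origin
    and, by the induction hypothesis, the same derivative. *)
Lemma profile_right m (x : R) : (m <= k)%N -> 0 <= x <= L -> A m.+1 x = F m x.
Proof.
move=> mk; rewrite -(subKn mk); move: (k - m)%N (leq_subr m k) => j {m mk} jk.
elim: j jk x => [|j IH] jk x /andP[x0 xL].
  by rewrite subn0 A_top /top x0; congr F; apply/min_idPl.
have mk : (k - j.+1 < k)%N by rewrite ltn_subrL /=; case: (k) jk.
have e : (k - j.+1).+1 = (k - j)%N by rewrite subnSK.
have h1 := @Rintegral_derive R _ _ 0 x x0 (fun y => @profile_continuous (k - j.+1).+2 y mk)
  (fun y => A_derive y mk).
have h2 := sobolev_increment L0 Sf mk (lexx 0) x0 xL.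
have : A (k - j.+1).+1 x - A (k - j.+1).+1 0 = F (k - j.+1)%N x - F (k - j.+1)%N 0.
  rewrite -h1 [RHS]h2; apply: eq_Rintegral => y /set_mem /=; rewrite in_itv /= => /andP[y0 yx].
  rewrite e; apply: IH; first exact: ltnW.
  by rewrite y0 (le_trans yx).
by rewrite A_val // => /(addIr _).
Qed.

(** As for [profile_right], the values at the origin being equal by the
    compatibility of the data. *)
Lemma profile_left m (t : R) : (m <= k)%N -> 0 <= t <= T -> A m.+1 (- (a * t)) = (- a) ^- m * G m t.
Proof.
move=> mk; rewrite -(subKn mk); move: (k - m)%N (leq_subr m k) => j {m mk} jk.
have an0 : a != 0 by rewrite gt_eqF.
elim: j jk t => [|j IH] jk t /andP[t0 tT].
  rewrite subn0 A_top /top; case: ifP => [h|/negbT _].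
    have at0 : a * t = 0.
      by apply/eqP; rewrite eq_le mulr_ge0 ?(ltW a0) // andbT -oppr_ge0.
    have -> : t = 0 by move/eqP: at0; rewrite mulf_eq0 (negbTE an0) => /eqP.
    rewrite mulr0 oppr0 -[RHS]compat //; congr F; apply/min_idPl; exact: ltW.
  congr (_ * G k _); rewrite mulrN opprK mulKf //; exact/min_idPl.
have mk : (k - j.+1 < k)%N by rewrite ltn_subrL /=; case: (k) jk.
have e : (k - j.+1).+1 = (k - j)%N by rewrite subnSK.
set m := (k - j.+1)%N in mk e *.
have cB (x : R) : {for x, continuous (fun tau => - a * A m.+2 (- a * tau + 0))}.
  apply: continuousM; first exact: cst_continuous.
  by apply: continuous_affine_comp => y; exact: (@profile_continuous m.+2 y mk).
have dB (x : R) : is_derive x 1 (fun tau => A m.+1 (- a * tau + 0)) (- a * A m.+2 (- a * x + 0)).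
  exact: is_derive_affine_comp (A_derive _ mk).
have h1 := Rintegral_derive t0 cB dB.
have h2 := sobolev_increment T0 Sg mk (lexx 0) t0 tT.
have Gi : mu.-integrable `[0, t] (EFin \o G m.+1).
  have [cG _ _] := sobolev_representative T0 Sg mk.
  apply: continuous_compact_integrable; first exact: segment_compact.
  apply: continuous_subspaceW cG => z /=; rewrite !in_itv /= => /andP[z0 zt].
  by rewrite z0 (le_trans zt).
have : A m.+1 (- a * t + 0) - A m.+1 (- a * 0 + 0) = (- a) ^- m * (G m t - G m 0).
  rewrite -h1 [X in _ = _ * X]h2 -(@RintegralZl _ _ _ mu _ _ _ (measurable_itv _) Gi).
  apply: eq_Rintegral => y /set_mem /=; rewrite in_itv /= => /andP[y0 yt].
  rewrite addr0 [- a * y]mulNr e IH ?(ltnW jk) //; last by rewrite y0 (le_trans yt).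
  rewrite -e exprS invfM mulrA mulNr mulrA; congr (_ * _).
  by rewrite invrN mulrN mulfV // mulN1r opprK.
rewrite mulr0 !addr0 mulNr A_val // [F m 0]compat ?(ltnW mk) // mulrBr -/(G m 0).
by move/(addIr _).
Qed.

(** Outside the range of the data only the derivative of top order is known
    directly; each of the lower ones is a bounded value at an end point plus an
    integral over an interval of length at most [D]. *)
Lemma profile_bound K : 0 <= K ->
  (forall m (x : R), (m <= k)%N -> 0 <= x <= L -> `|F m x| <= K) ->
  (forall m (t : R), (m <= k)%N -> 0 <= t <= T -> `|(- a) ^- m * G m t| <= K) ->
  forall m (y : R), (m <= k)%N -> - (a * T) - D <= y <= L + D -> `|A m.+1 y| <= K * (1 + D) ^+ k.
Proof.
move=> K0 FK GK m y mk yb.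
have aT : 0 < a * T by rewrite mulr_gt0.
have D0' := D0; have L0' := L0; have a0' := a0; have T0' := T0.
have core n z : (n <= k)%N -> - (a * T) <= z <= L -> `|A n.+1 z| <= K.
  move=> nk /andP[z1 z2]; have [z0|z0] := leP 0 z.
    by rewrite profile_right ?z0 // FK // z0.
  have -> : z = - (a * (- (z / a))) by rewrite mulrN opprK mulrC divfK // gt_eqF.
  have h : 0 <= - (z / a) <= T.
    rewrite oppr_ge0 pmulr_lle0 ?invr_gt0 // (ltW z0) /= lerNl ler_pdivlMr //; lra.
  by rewrite profile_left // GK.
have D1 : 1 <= 1 + D by rewrite lerDl.
suff H : forall j n z, (n <= k)%N -> (k - n)%N = j -> - (a * T) - D <= z <= L + D ->
    `|A n.+1 z| <= K * (1 + D) ^+ j.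
  apply: le_trans (H _ m y mk erefl yb) _; rewrite ler_wpM2l //.
  by apply: ler_weXn2l => //; exact: leq_subr.
elim=> [|j IH] n z nk nj /andP[z1 z2].
  have -> : n = k by move: nk nj; clear; lia.
  rewrite mulr1 A_top /top; case: ifP => [z0|/negbT].
    have [k1 _ k3 _] := min_clamp (ltW L0) z0 (lexx z).
    by apply: FK => //; rewrite k1 k3.
  rewrite -ltNge => z0; have qz : 0 <= - (a^-1 * z) by rewrite oppr_ge0 mulr_ge0_le0 ?invr_ge0 // ltW.
  have [k1 _ k3 _] := min_clamp (ltW T0) qz (lexx _).
  by apply: GK => //; rewrite k1 k3.
have nk1 : (n.+1 <= k)%N by move: nj; clear; lia.
have IHn w : - (a * T) - D <= w <= L + D -> `|A n.+2 w| <= K * (1 + D) ^+ j.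
  by apply: IH => //; move: nj; clear; lia.
have X0 : 0 <= K * (1 + D) ^+ j by rewrite mulr_ge0 // exprn_ge0 //; lra.
have X1 : K <= K * (1 + D) ^+ j by rewrite ler_peMr // exprn_ege1.
rewrite exprS mulrCA mulrDl mul1r.
have XD : 0 <= D * (K * (1 + D) ^+ j) by rewrite mulr_ge0.
have [zL|zL] := leP z L; last first.
  have b1 : `|A n.+1 z - A n.+1 L| <= K * (1 + D) ^+ j * (z - L).
    apply: (derive_bound (df := A n.+2)); first exact: ltW.
      by move=> w _; exact: A_derive nk1.
    move=> w /andP[w1 w2]; apply: IHn; apply/andP; split; lra.
  have b2 : K * (1 + D) ^+ j * (z - L) <= D * (K * (1 + D) ^+ j).
    by rewrite mulrC ler_wpM2r //; lra.
  have b3 : `|A n.+1 L| <= K by apply: core => //; apply/andP; split; lra.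
  have := ler_normD (A n.+1 z - A n.+1 L) (A n.+1 L); rewrite subrK => b4.
  by apply: le_trans b4 _; lra.
have [zT|zT] := leP (- (a * T)) z.
  by apply: le_trans (core n z nk _) _; [rewrite zT zL|lra].
have b1 : `|A n.+1 (- (a * T)) - A n.+1 z| <= K * (1 + D) ^+ j * (- (a * T) - z).
  apply: (derive_bound (df := A n.+2)); first exact: ltW.
    by move=> w _; exact: A_derive nk1.
  move=> w /andP[w1 w2]; apply: IHn; apply/andP; split; lra.
have b2 : K * (1 + D) ^+ j * (- (a * T) - z) <= D * (K * (1 + D) ^+ j).
  by rewrite mulrC ler_wpM2r //; lra.
have b3 : `|A n.+1 (- (a * T))| <= K by apply: core => //; apply/andP; split; lra.
rewrite distrC in b1.
have := ler_normD (A n.+1 z - A n.+1 (- (a * T))) (A n.+1 (- (a * T))); rewrite subrK => b4.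
by apply: le_trans b4 _; lra.
Qed.

(** The exact solution is [A 1 (x - a t)] almost everywhere, whose primitive in
    [x] is [A 0 (x - a t)]. *)
Lemma transport_integral (t x1 x2 : R) : 0 <= t <= T -> 0 <= x1 -> x1 <= x2 -> x2 <= L ->
  \int[mu]_(x in `[x1, x2]) transport_solution a f g t x = A 0%N (x2 - a * t) - A 0%N (x1 - a * t).
Proof.
move=> tT x10 x12 x2L; have /andP[t0 tT'] := tT.
have cA (x : R) : {for x, continuous (fun x : R => A 1%N (1 * x + - (a * t)))}.
  by apply: continuous_affine_comp => y; exact: profile_continuous.
have dA (x : R) : is_derive x 1 (fun x : R => A 0%N (1 * x + - (a * t))) (A 1%N (1 * x + - (a * t))).
  have := is_derive_affine_comp (A_derive (1 * x + - (a * t)) (leq0n k)).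
  by rewrite mul1r.
have e := Rintegral_derive x12 cA dA; rewrite !mul1r in e.
rewrite -e /Rintegral; congr fine; apply: ae_eq_integral.
- exact: measurable_itv.
- apply/measurable_EFinP; apply: (measurable_transport (L := L) a0 _ _ tT) => //.
    by have [[[mf _ _] _ _] _] := sobolev_weak Sf (leq0n _).
  by have [[[mg _ _] _ _] _] := sobolev_weak Sg (leq0n _).
- apply/measurable_EFinP; exact: continuous_measurable_set.
have af : {ae mu, forall x, 0 < 1 * x + - (a * t) < L ->
    F 0%N (1 * x + - (a * t)) = f (1 * x + - (a * t))}.
  by apply: (@ae_affine _ _ _ (fun y => 0 < y < L -> F 0%N y = f y)); [|exact: (sobolev_zero L0 Sf)].
have ag : {ae mu, forall x, 0 < - a^-1 * x + t < T ->
    G 0%N (- a^-1 * x + t) = g (- a^-1 * x + t)}.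
  apply: (@ae_affine _ _ _ (fun y => 0 < y < T -> G 0%N y = g y)); last exact: (sobolev_zero T0 Sg).
  by rewrite oppr_eq0 invr_eq0 gt_eqF.
have an1 := ae_imply2 (fun x h1 h2 => conj h1 h2) (ae_neq x1) (ae_neq x2).
have an := ae_imply2 (fun x h1 h2 => conj h1 h2) an1 (ae_neq (a * t)).
have afg := ae_imply2 (fun x h1 h2 => conj h1 h2) af ag.
apply: ae_imply2 an afg => x [[n1 n2] n3] [hf hg] /=; rewrite in_itv /= => /andP[xx1 xx2].
congr EFin.
have at0 : 0 <= a * t by rewrite mulr_ge0 // ltW.
have x1x : x1 < x by rewrite lt_neqAle xx1 andbT; apply/eqP => h; apply: n1.
have xx2' : x < x2 by rewrite lt_neqAle xx2 andbT; apply/eqP.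
rewrite /transport_solution; case: ifP => [h|/negbT].
  have atx : a * t < x by rewrite lt_neqAle h andbT; apply/eqP => h'; apply: n3.
  rewrite (@profile_right 0 _ (leq0n k)) ?hf ?mul1r //.
    by apply/andP; split; lra.
  by apply/andP; split; lra.
rewrite -ltNge => xat.
have x0 : 0 < x by lra.
have h1 : a^-1 * x < t by rewrite mulrC ltr_pdivrMr //; lra.
have h2 : 0 < a^-1 * x by rewrite mulr_gt0 ?invr_gt0.
have -> : 1 * x + - (a * t) = - (a * (- a^-1 * x + t)).
  by rewrite mulrDr mulNr mulrN mulVKf ?gt_eqF // mul1r opprD opprK.
rewrite (@profile_left 0 _ (leq0n k)) ?expr0 ?invr1 ?mul1r ?hg //.
- by congr g; rewrite mulNr addrC mulrC.
- by apply/andP; split; lra.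
by apply/andP; split; lra.
Qed.

End ExtendedProfile.

Section ProfileSpec.
Context {R : realType}.
Local Notation mu := (@lebesgue_measure R).

(** [A 0] is a primitive of the profile that is transported at speed [a], and
    [A m.+1] the [m]-th derivative of this profile. *)
Record profile_spec (a L D : R) (k : nat) (T : R) (f g : R -> R) (K : R)
    (A : nat -> R -> R) (P : R -> R) : Prop := ProfileSpec {
  profile_derive : forall m (x : R), (m <= k)%N -> is_derive x 1 (A m) (A m.+1 x);
  profile_modulus : half_modulus (A k.+1) P;
  profile_variation : forall y z, P z - P y <= K ^+ 2;
  profile_sup : forall m (y : R), (m <= k)%N -> - (a * T) - D <= y <= L + D -> `|A m.+1 y| <= K;
  profile_inflow : forall m (t : R), (m <= k)%N -> 0 <= t <= T ->
    A m.+1 (- (a * t)) = (- a) ^- m * pointwise_derivative 0 T m g t;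
  profile_transport : forall t x1 x2 : R, 0 <= t <= T -> 0 <= x1 -> x1 <= x2 -> x2 <= L ->
    \int[mu]_(x in `[x1, x2]) transport_solution a f g t x = A 0%N (x2 - a * t) - A 0%N (x1 - a * t) }.

(** The bounds come from [sobolev_sup]. On the time interval its constant is
    at most [4 * T], as [T] is at least 1, which is the reason for the square
    root of [T]. *)
Lemma exists_profile (a L D : R) (k : nat) : 0 < a -> 0 < L -> 0 <= D ->
  exists2 C : R, 0 <= C & forall (T : R) (f g : R -> R), 1 <= T ->
    sobolev 0 L k.+1 f -> sobolev 0 T k.+1 g ->
    (forall m : nat, (m <= k)%N ->
      pointwise_derivative 0 L m f 0 = (- a) ^- m * pointwise_derivative 0 T m g 0) ->
    exists A P, profile_spec a L D k T f g
      (C * Num.sqrt T * (sobolev_norm 0 L k.+1 f + sobolev_norm 0 T k.+1 g)) A P.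
Proof.
move=> a0 L0 D0.
pose q := a^-1; pose s := (- a) ^- k.
pose c1 := 2 * ((L - 0)^-1 + (L - 0)); pose c2 := 4 * \sum_(m < k.+1) ((- a) ^- m) ^+ 2.
have q0 : 0 < q by rewrite invr_gt0.
have c10 : 0 <= c1 by rewrite /c1 subr0 mulr_ge0 // addr_ge0 ?invr_ge0 // ltW.
have c20 : 0 <= c2 by rewrite mulr_ge0 // sumr_ge0 // => i _; exact: sqr_ge0.
have c3 : 0 <= s ^+ 2 * q by rewrite mulr_ge0 ?sqr_ge0 // ltW.
pose c := c1 + c2 + (1 + s ^+ 2 * q).
have cge0 : 0 <= c by rewrite /c; lra.
have X1 : 1 <= (1 + D) ^+ k by rewrite exprn_ege1 // lerDl.
exists (Num.sqrt c * (1 + D) ^+ k) => [|T f g T1 Sf Sg compat].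
  by rewrite mulr_ge0 ?sqrtr_ge0 // (le_trans ler01).
have T0 : 0 < T by exact: lt_le_trans T1.
set Hf := sobolev_norm 0 L _ f; set Hg := sobolev_norm 0 T _ g.
have Hf0 : 0 <= Hf by exact: sobolev_norm_ge0.
have Hg0 : 0 <= Hg by exact: sobolev_norm_ge0.
pose H := Hf + Hg; rewrite -/H.
have H0 : 0 <= H by rewrite addr_ge0.
have HfH : Hf ^+ 2 <= H ^+ 2 by rewrite ler_sqr ?nnegrE // lerDl.
have HgH : Hg ^+ 2 <= H ^+ 2 by rewrite ler_sqr ?nnegrE // lerDr.
pose K0 := Num.sqrt c * Num.sqrt T * H.
have K00 : 0 <= K0 by rewrite !mulr_ge0 ?sqrtr_ge0.
have K02 : K0 ^+ 2 = c * T * H ^+ 2 by rewrite !exprMn !sqr_sqrtr // ltW.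
have -> : Num.sqrt c * (1 + D) ^+ k * Num.sqrt T * H = K0 * (1 + D) ^+ k by rewrite /K0; ring.
have TH : H ^+ 2 <= T * H ^+ 2 by rewrite ler_peMl // sqr_ge0.
have H20 := sqr_ge0 H.
have toK (u : R) : u ^+ 2 <= c * (T * H ^+ 2) -> `|u| <= K0.
  by move=> h; rewrite -ler_sqr ?nnegrE // real_normK ?num_real // K02 -mulrA.
have FK m (x : R) : (m <= k)%N -> 0 <= x <= L -> `|pointwise_derivative 0 L m f x| <= K0.
  move=> mk xL; apply: toK; apply: le_trans (sobolev_sup L0 Sf mk xL) _.
  apply: ler_pM => //; first exact: sqr_ge0.
    by rewrite -/c1 /c -addrA lerDl; lra.
  exact: le_trans TH.
have GK m (t : R) : (m <= k)%N -> 0 <= t <= T ->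
    `|(- a) ^- m * pointwise_derivative 0 T m g t| <= K0.
  move=> mk tT; apply: toK; rewrite exprMn.
  have am0 := sqr_ge0 ((- a) ^- m).
  have h1 : 2 * ((T - 0)^-1 + (T - 0)) * Hg ^+ 2 <= 4 * (T * H ^+ 2).
    have Ti : T^-1 <= 1 by rewrite invf_le1.
    rewrite subr0 mulrA; apply: ler_pM HgH.
    - by rewrite mulr_ge0 // addr_ge0 ?invr_ge0 // ltW.
    - exact: sqr_ge0.
    by move: Ti T1; clear; lra.
  have h2 := le_trans (sobolev_sup T0 Sg mk tT) h1.
  apply: le_trans (ler_wpM2l am0 h2) _; rewrite [leLHS]mulrA.
  apply: ler_wpM2r; first by rewrite mulr_ge0 // ltW.
  have mk' : (m < k.+1)%N by [].
  have h3 : ((- a) ^- m) ^+ 2 <= \sum_(i < k.+1) ((- a) ^- i) ^+ 2.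
    rewrite (bigD1 (Ordinal mk')) //= lerDl; apply: sumr_ge0 => i _; exact: sqr_ge0.
  rewrite mulrC; have : 4 * ((- a) ^- m) ^+ 2 <= c2 by rewrite ler_wpM2l.
  by rewrite /c; lra.
have [P1 [P10 P1L mP1 iP1]] := sobolev_modulus L0 Sf.
have [P2 [P20 P2T mP2 iP2]] := sobolev_modulus T0 Sg.
have [P hP bP] := glued_half_modulus (s := s) (ltW L0) (ltW T0) q0 P10 P20 P1L P2T mP1 mP2 iP1 iP2
  (compat k (leqnn k)).
have Pvar y z : P z - P y <= c * (T * H ^+ 2).
  have /andP[_ z2] := bP z; have /andP[y1 _] := bP y.
  have h1 : P z - P y <= Hf ^+ 2 + s ^+ 2 * q * Hg ^+ 2.
    by move: z2 y1; rewrite -/Hf -/Hg; clear; lra.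
  have h2 : s ^+ 2 * q * Hg ^+ 2 <= s ^+ 2 * q * H ^+ 2 by rewrite ler_wpM2l.
  have h3 : Hf ^+ 2 + s ^+ 2 * q * Hg ^+ 2 <= (1 + s ^+ 2 * q) * H ^+ 2.
    by rewrite mulrDl mul1r lerD.
  have h4 : (1 + s ^+ 2 * q) * H ^+ 2 <= c * (T * H ^+ 2).
    by apply: ler_pM => //; rewrite /c ?lerDr; lra.
  exact: le_trans h1 (le_trans h3 h4).
have [A [A_top A_val A_der]] := exists_tower k.+1 
  (fun m => if m is n.+1 then pointwise_derivative 0 L n f 0 else 0)
  (half_modulus_continuous hP Pvar).
have A_val' m : (m < k)%N -> A m.+1 0 = pointwise_derivative 0 L m f 0.
  by move=> mk; rewrite A_val.
have X2 : K0 <= K0 * (1 + D) ^+ k by rewrite ler_peMr.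
exists A, P; split.
- by move=> m x mk; exact: A_der.
- by rewrite A_top.
- move=> y z; apply: le_trans (Pvar y z) _; rewrite mulrA -K02 ler_sqr ?nnegrE //.
  exact: le_trans X2.
- move=> m y mk yb.
  exact: (profile_bound a0 L0 D0 T1 Sf Sg compat A_top hP Pvar A_val' _ K00 FK GK).
- by move=> m t mk tT; exact: (profile_left a0 L0 T1 Sg compat A_top hP Pvar A_val' _ mk tT).
move=> t x1 x2 tT x10 x12 x2L.
exact: (transport_integral a0 L0 T1 Sf Sg compat A_top hP Pvar A_val').
Qed.

End ProfileSpec.

(** * Taylor expansion along a tower of derivatives *)

Section Taylor.
Context {R : realType}.
Implicit Types (A : nat -> R -> R) (y z s Z M c : R).

Lemma increment_bound (f df : R -> R) y Z M : (forall x : R, is_derive x 1 f (df x)) ->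
  (forall s, `|s| <= Z -> `|df (y + s)| <= M) ->
  forall z, `|z| <= Z -> `|f (y + z) - f y| <= Z * M.
Proof.
move=> D B z hz.
have M0 : 0 <= M by apply: le_trans (normr_ge0 _) (B _ hz).
have [z0|z0] := leP 0 z.
  have yz : y <= y + z by rewrite lerDl.
  have := @derive_bound R f df y (y + z) M yz (fun x _ => D x).
  rewrite addrAC subrr add0r => h; apply: le_trans (h _) _.
    move=> x /andP[h1 h2]; rewrite -[x](subrK y) addrC; apply: B; apply: le_trans hz.
    by rewrite !ger0_norm ?subr_ge0 // lerBlDl.
  by rewrite mulrC ler_wpM2r // -(ger0_norm z0).
have yz : y + z <= y by rewrite gerDl ltW.
have := @derive_bound R f df (y + z) y M yz (fun x _ => D x).
rewrite opprD addrA subrr add0r distrC => h; apply: le_trans (h _) _.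
  move=> x /andP[h1 h2]; rewrite -[x](subrK y) addrC; apply: B; apply: le_trans hz.
  by rewrite !ler0_norm ?subr_le0 // ?(ltW z0) // lerN2 lerBrDl.
by rewrite mulrC ler_wpM2r // -(ltr0_norm z0).
Qed.

Definition taylor_sum n (c : nat -> R) (s : R) : R := \sum_(m < n) c m * s ^+ m / m`!%:R.

Lemma is_derive_taylor_sum n (c : nat -> R) (s : R) :
  is_derive s 1 (taylor_sum n.+1 c) (taylor_sum n (fun m => c m.+1) s).
Proof.
elim: n => [|n IH].
  have -> : taylor_sum 1 c = cst (c 0%N).
    by apply/funext => x; rewrite /taylor_sum big_ord1 expr0 fact0 mulr1 divr1.
  by rewrite /taylor_sum big_ord0; exact: is_derive_cst.
have -> : taylor_sum n.+2 c = taylor_sum n.+1 c + (c n.+1 / n.+1`!%:R) *: (@id R ^+ n.+1).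
  apply/funext => x; rewrite {1}/taylor_sum big_ord_recr /= /taylor_sum fctE /=; congr (_ + _).
  by rewrite [RHS]/GRing.scale /= exprfctE mulrAC.
rewrite [taylor_sum n.+1 _ s]/taylor_sum big_ord_recr -/(taylor_sum n _ s).
apply: is_deriveD.
apply: is_derive_eq.
rewrite /= /GRing.scale /= mulr1 factS natrM.
have h1 : n.+1%:R != 0 :> R by rewrite pnatr_eq0.
have h2 : n`!%:R != 0 :> R by rewrite pnatr_eq0 -lt0n fact_gt0.
by rewrite -mulr_natl; field; rewrite h2 nat1r.
Qed.

(** The remainder has as its derivative the remainder of one order less of the
    tower without its first member. *)
Lemma taylor_tower n A y Z M :
  (forall m (x : R), (m <= n)%N -> is_derive x 1 (A m) (A m.+1 x)) ->
  (forall s, `|s| <= Z -> `|A n.+1 (y + s)| <= M) ->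
  forall z, `|z| <= Z -> `|A 0%N (y + z) - taylor_sum n.+1 (A ^~ y) z| <= Z ^+ n.+1 * M.
Proof.
elim: n A => [|n IH] A dA bM z hz.
  rewrite /taylor_sum big_ord1 expr0 fact0 mulr1 divr1 expr1.
  exact: (increment_bound (fun x => dA 0%N x (leqnn _)) bM).
pose rho (s : R) := A 0%N (1 * s + y) - taylor_sum n.+2 (A ^~ y) s.
pose drho (s : R) := A 1%N (1 * s + y) - taylor_sum n.+1 (fun m => A m.+1 y) s.
have drhoE (x : R) : is_derive x 1 rho (drho x).
  apply: is_deriveB; last exact: is_derive_taylor_sum.
  by have := is_derive_affine_comp (dA 0%N (1 * x + y) isT); rewrite mul1r.
have := @increment_bound rho drho 0 Z (Z ^+ n.+1 * M) drhoE _ z hz.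
rewrite mulrA -exprS add0r /rho mul1r mulr0 add0r [y + z]addrC.
have -> : taylor_sum n.+2 (A ^~ y) 0 = A 0%N y.
  rewrite /taylor_sum big_ord_recl /= expr0 fact0 mulr1 divr1 big1 ?addr0 // => i _.
  by rewrite expr0n mulr0 mul0r.
rewrite subrr subr0; apply => s hs; rewrite add0r /drho mul1r [s + y]addrC.
by apply: (IH (fun m => A m.+1)) => // m x mn; exact: dA.
Qed.

End Taylor.

(** * Consistency of the scheme *)

Section Consistency.
Context {R : realType}.
Implicit Types (A : nat -> R -> R) (dx c K M nu y s Z : R) (j l : int).

(** The cell averages of the derivative of [B] translated by [c], written as
    differences of values of the primitive [B], so that they make sense in the
    ghost cells as well. *)
Definition average_of (B : R -> R) dx c j : R :=
  Dminus (fun i => B (i%:~R * dx - c)) j / dx.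

Lemma average_ofE B dx c j :
  average_of B dx c j = (B (j%:~R * dx - c) - B (j%:~R * dx - c - dx)) / dx.
Proof.
rewrite /average_of /Dminus; congr (_ / _); congr (_ - B _).
by rewrite rmorphB /=; ring.
Qed.

Lemma is_derive_backward (B B' : R -> R) dx (x : R) : (forall x : R, is_derive x 1 B (B' x)) ->
  is_derive x 1 (fun x => B x - B (x - dx)) (B' x - B' (x - dx)).
Proof.
move=> D; apply: is_deriveB.
have := is_derive_affine_comp (D (1 * x - dx)); rewrite !mul1r => h.
apply: (@is_derive_eq _ _ _ _ _ _ _ _ _ erefl).
by under eq_fun do rewrite -[X in X - dx]mul1r.
Qed.

(** The backward difference of a tower of derivatives is a tower of derivatives,
    with one power of [dx] gained at the top. *)
Lemma iter_Dminus_bound i A dx c j M : 0 <= dx ->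
  (forall m (x : R), (m < i)%N -> is_derive x 1 (A m) (A m.+1 x)) ->
  (forall x, (j - i%:Z)%:~R * dx - c <= x <= j%:~R * dx - c -> `|A i x| <= M) ->
  `|iter i Dminus (fun l => A 0%N (l%:~R * dx - c)) j| <= dx ^+ i * M.
Proof.
move=> dx0; elim: i A M => [|i IH] A M dA bM.
  by rewrite mul1r /=; apply: bM; rewrite subr0 lexx.
rewrite iterSr exprSr -mulrA.
have -> : Dminus (fun l => A 0%N (l%:~R * dx - c)) =
    (fun l => (fun m x => A m x - A m (x - dx)) 0%N (l%:~R * dx - c)).
  apply/funext => l; rewrite /Dminus; congr (_ - A _ _).
  by rewrite rmorphB /=; ring.
apply: (IH (fun m x => A m x - A m (x - dx))) => [m x mi|x /andP[x1 x2]].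
  by apply: is_derive_backward => x'; apply: dA; exact: leqW.
have xx : x - dx <= x by rewrite gerBl.
have := @derive_bound R (A i) (A i.+1) (x - dx) x M xx (fun y _ => dA i y (leqnn _)).
rewrite opprD addrA subrr opprK add0r mulrC; apply => y /andP[y1 y2].
apply: bM; rewrite (le_trans y2 x2) andbT; apply: le_trans y1.
apply: le_trans (lerB x1 (lexx dx)); rewrite -addn1 PoszD opprD addrA rmorphB /= mulrBl mul1r.
by rewrite addrAC.
Qed.

Lemma half_modulus_backward (F P : R -> R) dx y Z s : 0 <= dx -> half_modulus F P -> `|s| <= Z ->
  (F (y + s) - F (y + s - dx)) ^+ 2 <= dx * (P (y + Z) - P (y - Z - dx)).
Proof.
move=> dx0 H; rewrite ler_norml => /andP[s1 s2].
have h0 : y + s - dx <= y + s by rewrite gerBl.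
have h1 : y - Z - dx <= y + s - dx by rewrite lerB // lerD2l.
have h2 : y + s <= y + Z by rewrite lerD2l.
have [_ k0] := H _ _ h0; have [k1 _] := H _ _ h1; have [k2 _] := H _ _ h2.
move: k0; rewrite opprB addrCA subrr addr0 => k0; apply: le_trans k0 _.
by rewrite ler_wpM2l // lerB.
Qed.

Variables (r p : nat) (al : int -> R).

(** The moment conditions say that the scheme is exact on the Taylor polynomial,
    so that only remainders are left. *)
Lemma stencil_taylor k q nu dx (phi : R -> R) (c : nat -> R) E :
  0 <= dx -> 0 <= nu -> nu <= q%:R -> (r <= q)%N -> (p <= q)%N ->
  (forall m : nat, (m <= k)%N ->
     stencil_sum r p (fun l : int => l%:~R ^+ m * al l) = (- nu) ^+ m) ->
  (forall z, `|z| <= q%:R * dx -> `|phi z - taylor_sum k.+1 c z| <= E) ->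
  `|phi (- nu * dx) - stencil_sum r p (fun l => al l * phi (l%:~R * dx))| <=
  (1 + stencil_sum r p (fun l => `|al l|)) * E.
Proof.
move=> dx0 nu0 nuq rq pq mom hE.
pose rho z := phi z - taylor_sum k.+1 c z.
have cancel : stencil_sum r p (fun l => al l * taylor_sum k.+1 c (l%:~R * dx)) =
    taylor_sum k.+1 c (- nu * dx).
  rewrite /stencil_sum /taylor_sum.
  under eq_bigr do rewrite mulr_sumr.
  rewrite exchange_big; apply: eq_bigr => m _ /=.
  rewrite exprMn -(mom m) ?/stencil_sum; last by rewrite -ltnS ltn_ord.
  rewrite mulr_suml mulr_sumr mulr_suml; apply: eq_bigr => i _.
  by rewrite exprMn; ring.
have -> : phi (- nu * dx) - stencil_sum r p (fun l => al l * phi (l%:~R * dx)) =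
    rho (- nu * dx) - stencil_sum r p (fun l => al l * rho (l%:~R * dx)).
  have -> : stencil_sum r p (fun l => al l * rho (l%:~R * dx)) =
     stencil_sum r p (fun l => al l * phi (l%:~R * dx)) - taylor_sum k.+1 c (- nu * dx).
    rewrite -cancel /stencil_sum -sumrB; apply: eq_bigr => i _; exact: mulrBr.
  by rewrite /rho; ring.
apply: le_trans (ler_normB _ _) _; rewrite mulrDl mul1r; apply: lerD.
  by apply: hE; rewrite normrM normrN (ger0_norm nu0) (ger0_norm dx0) ler_wpM2r.
apply: le_trans (ler_norm_sum _ _ _) _; rewrite /stencil_sum mulr_suml.
apply: ler_sum => i _; rewrite normrM ler_wpM2l //; apply: hE.
rewrite normrM (ger0_norm dx0) ler_wpM2r // ler_norml.
have -> : q%:R = (q%:Z)%:~R :> R by [].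
by rewrite -rmorphN /= !ler_int; have := ltn_ord i; move: rq pq; clear; lia.
Qed.

(** [stencil_taylor] is applied to the tower of differences over one cell: this
    gains a difference of the top derivative, which is small, where the
    derivative of the next order does not exist. *)
Lemma residual_bound k q nu A dx c j M :
  0 < dx -> 0 <= nu -> nu <= q%:R -> (r <= q)%N -> (p <= q)%N ->
  (forall m : nat, (m <= k)%N ->
     stencil_sum r p (fun l : int => l%:~R ^+ m * al l) = (- nu) ^+ m) ->
  (forall m (x : R), (m <= k)%N -> is_derive x 1 (A m) (A m.+1 x)) ->
  (forall s, `|s| <= q%:R * dx ->
     `|A k.+1 (j%:~R * dx - c + s) - A k.+1 (j%:~R * dx - c + s - dx)| <= M) ->
  `|average_of (A 0%N) dx (c + nu * dx) j - step_op r p al (average_of (A 0%N) dx c) j| <=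
  (1 + stencil_sum r p (fun l => `|al l|)) * ((q%:R * dx) ^+ k.+1 * M) / dx.
Proof.
move=> dx0 nu0 nuq rq pq mom dA bM.
pose y := j%:~R * dx - c; pose G m x := A m x - A m (x - dx).
have dG m (x : R) : (m <= k)%N -> is_derive x 1 (G m) (G m.+1 x).
  by move=> mk; apply: is_derive_backward => x'; exact: dA.
have tG := taylor_tower dG bM.
have h := stencil_taylor (phi := fun z => G 0%N (y + z)) (ltW dx0) nu0 nuq rq pq mom tG.
have -> : average_of (A 0%N) dx (c + nu * dx) j = G 0%N (y + - nu * dx) / dx.
  rewrite average_ofE /G /y; congr ((A _ _ - A _ _) / _); ring.
have -> : step_op r p al (average_of (A 0%N) dx c) j =
    stencil_sum r p (fun l => al l * G 0%N (y + l%:~R * dx)) / dx.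
  rewrite /step_op /stencil_sum mulr_suml; apply: eq_bigr => i _.
  rewrite average_ofE /G /y mulrA; congr (_ * (A _ _ - A _ _) / _); rewrite rmorphD /=; ring.
rewrite -mulrBl normrM [X in _ * X]ger0_norm ?invr_ge0 ?(ltW dx0) //.
apply: ler_wpM2r => //; by rewrite invr_ge0 (ltW dx0).
Qed.

(** The increments of [P] over the stencils of the cells overlap [q + q + 1]
    times, hence their sum over the cells is bounded independently of the number
    of cells. This gains a factor [dx] over a bound cell by cell. *)
Lemma residual_sum_bound k q nu A (P : R -> R) dx c J K :
  0 < dx -> 0 <= nu -> nu <= q%:R -> (r <= q)%N -> (p <= q)%N ->
  (forall m : nat, (m <= k)%N ->
     stencil_sum r p (fun l : int => l%:~R ^+ m * al l) = (- nu) ^+ m) ->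
  (forall m (x : R), (m <= k)%N -> is_derive x 1 (A m) (A m.+1 x)) ->
  half_modulus (A k.+1) P -> (forall y z, P z - P y <= K ^+ 2) ->
  sqnorm J (fun j => average_of (A 0%N) dx (c + nu * dx) j
                     - step_op r p al (average_of (A 0%N) dx c) j) <=
  ((1 + stencil_sum r p (fun l => `|al l|)) * q%:R ^+ k.+1) ^+ 2 * (q + q).+1%:R
  * (dx ^+ (2 * k).+1 * K ^+ 2).
Proof.
move=> dx0 nu0 nuq rq pq mom dA hP PK.
set S := (1 + _) * _; pose pt j := P (j%:~R * dx - c).
have key j : (average_of (A 0%N) dx (c + nu * dx) j
      - step_op r p al (average_of (A 0%N) dx c) j) ^+ 2 <=
    S ^+ 2 * dx ^+ (2 * k).+1 * wsum (j - q%:Z) (q + q).+1 (Dminus pt).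
  have -> : wsum (j - q%:Z) (q + q).+1 (Dminus pt) = pt (j + q%:Z) - pt (j - q%:Z - 1).
    rewrite (_ : j - q%:Z = (j - q%:Z - 1) + 1); last by rewrite subrK.
    by rewrite wsum_Dminus addrK; congr (pt _ - _); clear; lia.
  set y := j%:~R * dx - c.
  have e1 : pt (j + q%:Z) = P (y + q%:R * dx).
    by rewrite /pt /y rmorphD /=; congr P; ring.
  have e2 : pt (j - q%:Z - 1) = P (y - q%:R * dx - dx).
    by rewrite /pt /y !rmorphB /=; congr P; ring.
  have hM s : `|s| <= q%:R * dx -> `|A k.+1 (y + s) - A k.+1 (y + s - dx)| <=
      Num.sqrt (dx * (pt (j + q%:Z) - pt (j - q%:Z - 1))).
    move=> hs; rewrite -sqrtr_sqr ler_wsqrtr // e1 e2.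
    exact: half_modulus_backward (ltW dx0) hP hs.
  have := residual_bound dx0 nu0 nuq rq pq mom dA hM.
  have D0 : 0 <= pt (j + q%:Z) - pt (j - q%:Z - 1).
    rewrite subr_ge0 e1 e2; apply: (hP _ _ _).1.
    have : 0 <= q%:R * dx by rewrite mulr_ge0 // ltW.
    by move: dx0; clear; lra.
  move: hM; set M := Num.sqrt _ => hM.
  have M2 : M ^+ 2 = dx * (pt (j + q%:Z) - pt (j - q%:Z - 1)).
    by rewrite sqr_sqrtr // mulr_ge0 // ltW.
  have dn : dx != 0 by rewrite gt_eqF.
  have -> : (1 + stencil_sum r p (fun l => `|al l|)) * ((q%:R * dx) ^+ k.+1 * M) / dx =
      S * dx ^+ k * M.
    by rewrite /S exprMn [dx ^+ k.+1]exprSr; field.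
  move=> h; rewrite -real_normK ?num_real //.
  apply: le_trans (_ : (S * dx ^+ k * M) ^+ 2 <= _).
    by rewrite ler_sqr ?nnegrE //; apply: le_trans h.
  rewrite 2!exprMn M2 -[(dx ^+ k) ^+ 2]exprM mulnC [dx ^+ (2 * k).+1]exprSr le_eqVlt; apply/orP; left; apply/eqP; ring.
rewrite /sqnorm; apply: le_trans (le_wsum (fun j _ => key j)) _.
rewrite wsumZ -[leRHS]mulrA -[leRHS](_ : S ^+ 2 * dx ^+ (2 * k).+1 * ((q + q).+1%:R * K ^+ 2) = _);
  last by ring.
apply: ler_wpM2l; first by rewrite mulr_ge0 ?sqr_ge0 // exprn_ge0 // ltW.
have -> : wsum 1 J (fun j => wsum (j - q%:Z) (q + q).+1 (Dminus pt)) =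
    \sum_(i < (q + q).+1) (pt (J%:Z - q%:Z + i%:Z) - pt (- q%:Z + i%:Z)).
  rewrite wsum_exchange; apply: eq_bigr => i _.
  under eq_wsum do rewrite -addrA.
  rewrite (wsum_shift 1 J (- q%:Z + i%:Z) (Dminus pt)) [1 + _]addrC wsum_Dminus.
  by congr (pt _ - _); clear; lia.
apply: le_trans (_ : \sum_(i < (q + q).+1) K ^+ 2 <= _).
  by apply: ler_sum => i _; exact: PK.
by rewrite sumr_const card_ord mulr_natl.
Qed.

(** The ghost values are the cell averages of the Taylor polynomial at the
    boundary point; in the difference of two values of the primitive the constant
    term disappears. *)
Lemma inflow_bound k A dx c l K : (0 < dx) -> 1 - r%:Z <= l <= 0 ->
  (forall m (x : R), (m <= k)%N -> is_derive x 1 (A m) (A m.+1 x)) ->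
  (forall s, `|s| <= r%:R * dx -> `|A k.+1 (- c + s)| <= K) ->
  `|average_of (A 0%N) dx c l -
    \sum_(0 <= m < k) dx ^+ m / m.+1`!%:R * (l ^+ m.+1 - (l - 1) ^+ m.+1)%:~R * A m.+1 (- c)|
  <= 2 * r%:R ^+ k.+1 * (dx ^+ k * K).
Proof.
move=> dx0 lr dA bK; have dn : dx != 0 by rewrite gt_eqF.
have tA := taylor_tower dA bK.
have in_r i : 0 - r%:Z <= i <= 0 -> `|i%:~R * dx| <= r%:R * dx.
  move=> hi; rewrite normrM (gtr0_norm dx0) ler_wpM2r ?(ltW dx0) // ler_norml.
  have -> : r%:R = (r%:Z)%:~R :> R by [].
  by rewrite -rmorphN /= !ler_int; move: hi; clear; lia.
have h1 : 0 - r%:Z <= l <= 0 by move: lr; clear; lia.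
have h2 : 0 - r%:Z <= l - 1 <= 0 by move: lr; clear; lia.
have t1 := tA _ (in_r _ h1); have t2 := tA _ (in_r _ h2).
have -> : average_of (A 0%N) dx c l -
    \sum_(0 <= m < k) dx ^+ m / m.+1`!%:R * (l ^+ m.+1 - (l - 1) ^+ m.+1)%:~R * A m.+1 (- c) =
    ((A 0%N (- c + l%:~R * dx) - taylor_sum k.+1 (A ^~ (- c)) (l%:~R * dx))
     - (A 0%N (- c + (l - 1)%:~R * dx) - taylor_sum k.+1 (A ^~ (- c)) ((l - 1)%:~R * dx))) / dx.
  have -> : \sum_(0 <= m < k) dx ^+ m / m.+1`!%:R * (l ^+ m.+1 - (l - 1) ^+ m.+1)%:~R * A m.+1 (- c)
     = (taylor_sum k.+1 (A ^~ (- c)) (l%:~R * dx)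
        - taylor_sum k.+1 (A ^~ (- c)) ((l - 1)%:~R * dx)) / dx.
    rewrite big_mkord /taylor_sum !big_ord_recl !expr0 opprD addrACA subrr add0r -sumrB mulr_suml.
    apply: eq_bigr => m _; rewrite /= /bump ?add1n /= !exprMn rmorphB !rmorphXn /=.
    have f0 : m.+1`!%:R != 0 :> R by rewrite pnatr_eq0 -lt0n fact_gt0.
    by rewrite [dx ^+ m.+1]exprS; field; rewrite dn f0.
  rewrite /average_of /Dminus -mulrBl; congr (_ / _).
  by rewrite [- c + l%:~R * dx]addrC [- c + (l - 1)%:~R * dx]addrC; ring.
rewrite normrM [X in _ * X]ger0_norm ?invr_ge0 ?(ltW dx0) // ler_pdivrMr //.
apply: le_trans (ler_normB _ _) _; apply: le_trans (lerD t1 t2) _.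
by rewrite exprMn [dx ^+ k.+1]exprS le_eqVlt; apply/orP; left; apply/eqP; ring.
Qed.

Lemma iter_Dminus_crude i v j M : (forall m : nat, (m <= i)%N -> `|v (j - m%:Z)| <= M) ->
  `|iter i Dminus v j| <= 2 ^+ i * M.
Proof.
elim: i v j => [|i IH] v j H; first by rewrite mul1r -[j]subr0; exact: (H 0%N).
rewrite iterS {1}/Dminus; apply: le_trans (ler_normB _ _) _.
rewrite exprS -mulrA [2 * _]mulr_natl mulr2n; apply: lerD; apply: IH => m mi.
  by apply: H; exact: leqW.
by rewrite -addrA -opprD -(PoszD 1); exact: H.
Qed.

(** A cell average is already a first difference of the primitive. Differences of
    order at most [k + 1] of the latter gain one power of [dx] each, the
    remaining ones are estimated crudely. *)
Lemma outflow_bound k kb A dx c j K : 0 < dx ->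
  (forall m (x : R), (m <= k)%N -> is_derive x 1 (A m) (A m.+1 x)) ->
  (forall m x, (m <= k)%N -> (j - kb.+1%:Z)%:~R * dx - c <= x <= j%:~R * dx - c -> `|A m.+1 x| <= K) ->
  `|iter kb Dminus (average_of (A 0%N) dx c) j| <= 2 ^+ kb * (dx ^+ minn k kb * K).
Proof.
move=> dx0 dA bK; have K0 : 0 <= K.
  apply: le_trans (normr_ge0 _) (bK 0%N (j%:~R * dx - c) (leq0n _) _).
  by rewrite lexx andbT lerB // ler_wpM2r ?(ltW dx0) // ler_int; clear; lia.
pose V (i : int) := A 0%N (i%:~R * dx - c).
have it i v : iter i Dminus (fun j => v j / dx) = (fun j => iter i Dminus v j / dx).
  elim: i => [//|i IH]; rewrite !iterS IH; apply/funext => j'.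
  by rewrite /Dminus mulrBl.
have := it kb (Dminus V) => ->; rewrite -iterSr.
rewrite normrM [X in _ * X]ger0_norm ?invr_ge0 ?(ltW dx0) // ler_pdivrMr //.
have m0 : (minn k kb <= kb)%N by rewrite geq_minr.
have mk : (minn k kb <= k)%N by rewrite geq_minl.
have -> : kb.+1 = ((kb - minn k kb) + (minn k kb).+1)%N by rewrite addnS subnK.
rewrite iterD; apply: le_trans (_ : 2 ^+ (kb - minn k kb) * (dx ^+ (minn k kb).+1 * K) <= _).
  apply: iter_Dminus_crude => m mi; apply: iter_Dminus_bound; first exact: ltW.
    by move=> m' x m'k; apply: dA; move: mk m'k; clear; lia.
  move=> x /andP[x1 x2]; apply: bK => //; apply/andP; split.
    apply: le_trans x1; rewrite lerB // ler_wpM2r ?(ltW dx0) // ler_int.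
    by move: mi m0; clear; lia.
  apply: le_trans x2 _; rewrite lerB // ler_wpM2r ?(ltW dx0) // ler_int; clear; lia.
rewrite exprSr -!mulrA [dx * K]mulrC; apply: ler_wpM2r.
  by rewrite !mulr_ge0 ?exprn_ge0 // ltW.
by apply: ler_weXn2l; [rewrite ler1n|exact: leq_subr].
Qed.

End Consistency.

Section ForcingBound.
Context {R : realType}.

Lemma wsum_sqr_bound s M (v : int -> R) B : (forall j, s <= j < s + M%:Z -> `|v j| <= B) ->
  wsum s M (fun j => v j ^+ 2) <= M%:R * B ^+ 2.
Proof.
move=> h; rewrite -(wsum_const s M); apply: le_wsum => j hj.
have := h j hj; have := normr_ge0 (v j) => v0 vB.
by rewrite -real_normK ?num_real // ler_sqr ?nnegrE // (le_trans v0).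
Qed.

Lemma dx_power_le (dx L : R) i k : 0 <= dx -> dx <= L -> (i <= k)%N ->
  dx ^+ k <= L ^+ (k - i) * dx ^+ i.
Proof.
move=> dx0 dxL ik; rewrite -{1}(subnK ik) exprD ler_wpM2r ?exprn_ge0 //.
by apply: lerXn2r => //; rewrite nnegrE // (le_trans dx0).
Qed.

Variables (a L lambda : R) (kb p r k q : nat) (al : int -> R).
Hypothesis a0 : 0 < a.
Hypothesis L0 : 0 < L.
Hypothesis lambda0 : 0 < lambda.
Hypothesis rq : (r <= q)%N.
Hypothesis pq : (p <= q)%N.
Hypothesis cfl : lambda * a <= q%:R.
Hypothesis moments : forall m : nat, (m <= k)%N ->
  stencil_sum r p (fun l : int => l%:~R ^+ m * al l) = (- (lambda * a)) ^+ m.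

Let D : R := (r + p + kb)%:R * L.
Let i := minn k kb.
Let cin : R := r%:R * (2 * r%:R ^+ k.+1) ^+ 2 * L ^+ (2 * k - 2 * i).
Let cout : R := p%:R * (2 ^+ kb) ^+ 2.
Let cres : R := ((1 + stencil_sum r p (fun l => `|al l|)) * q%:R ^+ k.+1) ^+ 2
  * (q + q).+1%:R * L ^+ (2 * k - 2 * i) * L.

Variables (T K : R) (J : nat) (f g : R -> R) (u : nat -> int -> R).
Variables (A : nat -> R -> R) (P : R -> R).
Hypothesis J0 : (0 < J)%N.
Hypothesis spec : profile_spec a L D k T f g K A P.
Hypothesis sol : is_scheme_solution a L lambda kb k p r al T J f g u.

Let dx := L / J%:R.
Let dt := lambda * dx.
Let W m := average_of (A 0%N) dx (a * (m%:R * dt)).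

(** The three constants belong to the inflow values, to the outflow condition and
    to the residual. The weight [J] of the residual is compensated by the power
    of [dx] gained in [residual_sum_bound], as [J * dx = L]. *)
Lemma forcing_bound m : m.+1%:R * dt <= T ->
  forcing r p kb al J (fun n j => u n j - W n j) m <=
  (cin + cout + cres) * (dx ^+ (2 * i) * K ^+ 2).
Proof.
move=> mT; have [_ u_in u_out u_step] := sol.
have Jn : J%:R != 0 :> R by rewrite pnatr_eq0 -lt0n.
have dx0 : 0 < dx by rewrite divr_gt0 // ltr0n.
have JdxL : J%:R * dx = L by rewrite mulrC divfK.
have dxL : dx <= L by rewrite -JdxL ler_peMl ?(ltW dx0) // ler1n.
have dt0 : 0 < dt by rewrite mulr_gt0.
have mT' : m%:R * dt <= T by apply: le_trans mT; rewrite ler_wpM2r ?(ltW dt0) // ler_nat.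
have [dA hP PK AK Ain _] := spec.
have t0 : 0 <= m%:R * dt by rewrite mulr_ge0 // ltW.
set c := a * (m%:R * dt).
have c0 : 0 <= c by rewrite mulr_ge0 // ltW.
have cT : c <= a * T by rewrite ler_wpM2l // ltW.
have D0 : 0 <= D by rewrite mulr_ge0 // ltW.
have K0 : 0 <= K.
  apply: le_trans (normr_ge0 _) (AK 0%N 0 (leq0n _) _).
  by apply/andP; split; move: (le_trans c0 cT) D0 L0; lra.
have ND (n : nat) : (n <= r + p + kb)%N -> n%:R * dx <= D.
  by move=> hn; apply: ler_pM => //; [exact: ltW|rewrite ler_nat].
have i2 : (2 * i <= 2 * k)%N by rewrite leq_mul2l geq_minl.
have pw := dx_power_le (ltW dx0) dxL i2.
have K20 := sqr_ge0 K.
rewrite /forcing !mulrDl; apply: lerD; first apply: lerD.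
- apply: le_trans (wsum_sqr_bound (B := 2 * r%:R ^+ k.+1 * (dx ^+ k * K)) _) _.
    move=> j hj; have hj' : 1 - r%:Z <= j <= 0 by move: hj; clear; lia.
    rewrite u_in // distrC.
    apply: le_trans (inflow_bound (k := k) (A := A) (c := c) (K := K) dx0 hj' dA _).
      rewrite le_eqVlt; apply/orP; left; apply/eqP; congr (`| _ - _|).
      rewrite big_seq_cond [RHS]big_seq_cond; apply: eq_bigr => n.
      rewrite mem_index_iota andbT => /andP[_ nk].
      rewrite -/c Ain ?(ltnW nk) ?t0 //.
      by rewrite invfM -!mulrA; congr (_ * _); congr (_ * _); rewrite mulrCA.
    move=> s hs; apply: AK => //; move: hs; rewrite ler_norml => /andP[s1 s2].
    have h : r%:R * dx <= D by apply: ND; rewrite -addnA leq_addr.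
    by apply/andP; split; [rewrite lerD ?lerN2 // (le_trans _ s1) // lerN2|];
       move: s2 h L0 c0; lra.
  rewrite exprMn [(dx ^+ k * K) ^+ 2]exprMn -exprM [(k * 2)%N]mulnC /cin.
  have := sqr_ge0 (2 * r%:R ^+ k.+1 : R); move: (_ ^+ 2) => S S0; rewrite -!mulrA.
  apply: ler_wpM2l => //; apply: ler_wpM2l => //.
  by rewrite mulrA ler_wpM2r.
- apply: le_trans (wsum_sqr_bound (B := 2 ^+ kb * (dx ^+ i * K)) _) _.
    move=> j hj.
    have -> : iter kb Dminus (fun j => u m j - W m j) j = - iter kb Dminus (W m) j.
      have := iter_DminusD kb (fun j => u m j - W m j) (W m) j.
      under eq_fun do rewrite subrK.
      rewrite (_ : j = J%:Z + (j - J%:Z)) ?u_out //; last by move: hj; clear; lia.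
        by move/esym/eqP; rewrite addr_eq0 => /eqP.
      by move: hj; clear; lia.
    rewrite normrN; apply: outflow_bound => // n x nk /andP[x1 x2].
    apply: AK => //; apply/andP; split.
      apply: le_trans x1.
      have h : kb%:R * dx <= D by apply: ND; rewrite leq_addl.
      have : (- kb%:Z)%:~R * dx <= (j - kb.+1%:Z)%:~R * dx.
        by rewrite ler_wpM2r ?(ltW dx0) // ler_int; move: hj; clear; lia.
      rewrite rmorphN mulNr /= -[(kb%:Z)%:~R]/(kb%:R) -/c; move: h cT; lra.
    have h : p%:R * dx <= D by apply: ND; rewrite addnAC leq_addl.
    have : j%:~R * dx <= (J + p)%:R * dx.
      rewrite ler_wpM2r ?(ltW dx0) // -[(J + p)%:R]/(((J + p)%:Z)%:~R) ler_int.
      by move: hj; clear; lia.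
    rewrite natrD mulrDl JdxL; move: h c0 x2; rewrite -/c; lra.
  by rewrite /cout exprMn [(dx ^+ i * K) ^+ 2]exprMn -[(dx ^+ i) ^+ 2]exprM [(i * 2)%N]mulnC !mulrA.
have -> : sqnorm J (residual r p al (fun n j => u n j - W n j) m) =
    sqnorm J (fun j => average_of (A 0%N) dx (c + (lambda * a) * dx) j
                     - step_op r p al (average_of (A 0%N) dx c) j).
  apply: eq_wsum => j hj; rewrite -[LHS]sqrrN; congr (_ ^+ 2).
  rewrite /residual u_step //.
  have -> : step_op r p al (fun j => u m j - W m j) j =
      stencil_sum r p (fun l => al l * u m (j + l)) - step_op r p al (W m) j.
    by rewrite /step_op /stencil_sum -sumrB; apply: eq_bigr => l _; rewrite mulrBr.
  have -> : average_of (A 0%N) dx (c + (lambda * a) * dx) j = W m.+1 j.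
    by rewrite /W /c /dt -natr1; congr average_of; ring.
  by rewrite /W -/c; ring.
have nu0 : 0 <= lambda * a by rewrite mulr_ge0 // ltW.
have h := residual_sum_bound c J dx0 nu0 cfl rq pq moments dA hP PK.
apply: le_trans (ler_wpM2l (ler0n _ J) h) _.
set S := _ * (q + q).+1%:R.
have S0 : 0 <= S by rewrite mulr_ge0 // sqr_ge0.
have -> : J%:R * (S * (dx ^+ (2 * k).+1 * K ^+ 2)) = S * (L * (dx ^+ (2 * k) * K ^+ 2)).
  by rewrite -JdxL exprS; ring.
have -> : cres * (dx ^+ (2 * i) * K ^+ 2) =
    S * (L * ((L ^+ (2 * k - 2 * i) * dx ^+ (2 * i)) * K ^+ 2)).
  by rewrite /cres -/S; ring.
by rewrite ler_wpM2l // ler_wpM2l ?(ltW L0) // ler_wpM2r.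
Qed.

End ForcingBound.

(** * The error estimate *)

Lemma sqr_powR_half (R : realType) (x : R) (i : nat) : 0 < x ->
  (x `^ (i%:R - 2^-1)) ^+ 2 = x ^+ (2 * i) / x.
Proof.
move=> x0; rewrite -powR_mulrn ?powR_ge0 // -powRrM mulrBl mulVf ?pnatr_eq0 //.
rewrite powRB; last by rewrite (gt_eqF x0) implybT.
by rewrite powRr1 ?(ltW x0) // -natrM powR_mulrn ?(ltW x0) // mulnC.
Qed.

Lemma cell_average_transport (R : realType) (a L D T K : R) (k J : nat) (f g : R -> R) A P t j :
  (0 < J)%N -> 0 < L -> profile_spec a L D k T f g K A P -> 0 <= t <= T -> 1 <= j <= J%:Z ->
  cell_average (L / J%:R) j (transport_solution a f g t) =
  average_of (A 0%N) (L / J%:R) (a * t) j.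
Proof.
move=> J0 L0 spec tT /andP[j1 jJ]; have Jn : J%:R != 0 :> R by rewrite pnatr_eq0 -lt0n.
have dx0 : 0 < L / J%:R by rewrite divr_gt0 // ltr0n.
rewrite /cell_average (profile_transport spec tT) //.
- by rewrite /average_of /Dminus mulrC.
- by rewrite mulr_ge0 ?(ltW dx0) // ler0z subr_ge0.
- by rewrite ler_wpM2r ?(ltW dx0) // ler_int gerBl.
apply: le_trans (_ : J%:R * (L / J%:R) <= _); last by rewrite mulrC divfK.
by rewrite ler_wpM2r ?(ltW dx0) // -[J%:R]/((J%:Z)%:~R) ler_int.
Qed.

Theorem theorem1p2 (R : realType) (a L lambda : R) (kb p r k : nat)
    (al : int -> R) :
  0 < a -> 0 < L -> 0 < lambda -> (1 <= k)%N ->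
  al (- r%:Z) * al p%:Z != 0 ->
  (forall m : nat, (m <= k)%N ->
     stencil_sum r p (fun l : int => l%:~R ^+ m * al l) = (- (lambda * a)) ^+ m) ->
  (forall theta : R, 0 <= theta <= 2 * pi ->
     `|stencil_sum r p (fun l : int => (al l)%:C%C * expi (l%:~R * theta))| <= 1) ->
  exists2 C : R, 0 < C &
    forall (T : R) (J : nat) (f g : R -> R),
      1 <= T -> (1 <= J)%N -> (kb%:Z - r%:Z <= J%:Z) ->
      sobolev 0 L k.+1 f -> sobolev 0 T k.+1 g ->
      (forall m : nat, (m <= k)%N ->
         pointwise_derivative 0 L m f 0
         = (- a) ^- m * pointwise_derivative 0 T m g 0) ->
    forall u : nat -> int -> R,
      is_scheme_solution a L lambda kb k p r al T J f g u ->
    let dx := L / J%:R in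
    let dt := lambda * dx in
    forall (n : nat) (j : int), n%:R * dt <= T -> 1 <= j <= J%:Z ->
      `|u n j - cell_average dx j (transport_solution a f g (n%:R * dt))|
      <= C * T * expR (C * T / L) * dx `^ ((minn k kb)%:R - 2^-1)
         * (sobolev_norm 0 L k.+1 f + sobolev_norm 0 T k.+1 g).
Proof.
move=> a0 L0 lambda0 k1 alrp moments symbol.
have nu0 : 0 < lambda * a by rewrite mulr_gt0.
have mom0 : stencil_sum r p al = 1.
  by rewrite -[RHS](moments 0%N (leq0n k)); apply: eq_bigr => i _; rewrite mul1r.
have mom1 : stencil_sum r p (fun l => l%:~R * al l) = - (lambda * a).
  by rewrite -[RHS](moments 1%N k1); apply: eq_bigr => i _.
have alr : al (- r%:Z) != 0 by apply: contraNneq alrp => ->; rewrite mul0r.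
have [C1 C10 stable] := stability kb symbol nu0 mom0 mom1 alr.
pose D : R := (r + p + kb)%:R * L.
have D0 : 0 <= D by rewrite mulr_ge0 // ltW.
have [C2 C20 profile] := exists_profile k a0 L0 D0.
pose q := maxn (maxn r p) (Num.bound (lambda * a)).
have rq : (r <= q)%N by rewrite /q -maxnA leq_maxl.
have pq : (p <= q)%N by rewrite /q (leq_trans (leq_maxr r p)) // leq_maxl.
have cfl : lambda * a <= q%:R.
  apply: le_trans (ltW (archi_boundP (ltW nu0))) _.
  by rewrite ler_nat leq_maxr.
pose i := minn k kb.
have bound := fun T K J f g u A P J0 spec sol => @forcing_bound R a L lambda kb p r k q al
  a0 L0 lambda0 rq pq cfl moments T K J f g u A P J0 spec sol.
move: bound; set C3 := _ + _ + _ => bound.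
have C30 : 0 <= C3.
  have S0 : 0 <= stencil_sum r p (fun l => `|al l|) by apply: sumr_ge0.
  by rewrite /C3 !addr_ge0 // !mulr_ge0 ?exprn_ge0 ?addr_ge0 // ltW.
pose C4 := Num.sqrt (C1 * C3 / lambda) * C2.
have C40 : 0 <= C4 by rewrite mulr_ge0 ?sqrtr_ge0.
have C1l : 0 <= C1 / lambda by rewrite divr_ge0 // ltW.
exists (C4 + C1 / lambda + 1) => [|T J f g T1 J0 hJ Sf Sg compat u sol dx dt n j nT jJ].
  by rewrite ltr_wpDl // addr_ge0.
set C := _ + 1; set H := _ + sobolev_norm _ _ _ g.
have [A [P spec]] := profile T f g T1 Sf Sg compat.
have Jn : J%:R != 0 :> R by rewrite pnatr_eq0 -lt0n.
have dx0 : 0 < dx by rewrite divr_gt0 // ltr0n.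
have dt0 : 0 < dt by rewrite mulr_gt0.
have T0 : 0 < T by exact: lt_le_trans T1.
have H0 : 0 <= H by rewrite addr_ge0 // sobolev_norm_ge0.
pose W m := average_of (A 0%N) dx (a * (m%:R * dt)).
pose e m j := u m j - W m j.
have mdt m : (m <= n)%N -> 0 <= m%:R * dt <= T.
  move=> mn; rewrite mulr_ge0 ?(ltW dt0) //=; apply: le_trans nT.
  by rewrite ler_wpM2r ?(ltW dt0) // ler_nat.
have e0 l : 1 <= l <= J%:Z -> e 0%N l = 0.
  move=> hl; have [u0 _ _ _] := sol; rewrite /e u0 // /W.
  rewrite -(cell_average_transport J0 L0 spec (mdt 0%N (leq0n n)) hl).
  apply/eqP; rewrite subr_eq0; apply/eqP; congr (_ * _); apply: eq_Rintegral => x.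
  move=> /set_mem /=; rewrite in_itv /= => /andP[lx _].
  rewrite /transport_solution mul0r mulr0 subr0 ifT // (le_trans _ lx) //.
  by rewrite mulr_ge0 ?(ltW dx0) // ler0z subr_ge0; case/andP: hl.
rewrite (cell_average_transport J0 L0 spec (mdt n (leqnn n)) jJ) -/(W n j) -/(e n j).
have en2 : e n j ^+ 2 <= sqnorm J (e n).
  apply: (@wsum_term _ 1 J j (fun j => e n j ^+ 2)) => [|l _]; last exact: sqr_ge0.
  by move: jJ; clear; lia.
pose K := C2 * Num.sqrt T * H.
have hsum : \sum_(m < n) forcing r p kb al J e m <= n%:R * (C3 * (dx ^+ (2 * i) * K ^+ 2)).
  apply: le_trans (_ : \sum_(m < n) C3 * (dx ^+ (2 * i) * K ^+ 2) <= _); last first.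
    by rewrite sumr_const card_ord mulr_natl.
  apply: ler_sum => m _; apply: (bound _ _ _ _ _ _ _ _ J0 spec sol).
  by have /andP[] := mdt _ (ltn_ord m).
have F0 : 0 <= C3 * (dx ^+ (2 * i) * K ^+ 2).
  by rewrite !mulr_ge0 ?sqr_ge0 // exprn_ge0 // ltW.
have hn : n%:R <= T / dt by rewrite ler_pdivlMr.
pose x := C1 / lambda * T / L.
have x0 : 0 <= x by rewrite divr_ge0 ?(ltW L0) // mulr_ge0 // ltW.
(* The number of steps over the number of cells is at most [T / (lambda * L)]. *)
have hx : C1 * n%:R / J%:R <= x.
  have -> : x = C1 * (T / dt) / J%:R by rewrite /x /dt /dx; field; rewrite Jn !gt_eqF.
  by rewrite ler_wpM2r ?invr_ge0 // ler_wpM2l.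
pose Y := C4 * T * expR x * dx `^ (i%:R - 2^-1) * H.
have Y0 : 0 <= Y by rewrite !mulr_ge0 ?powR_ge0 ?expR_ge0 // ltW.
(* A single value is bounded by the sum over the cells. The number of steps, at
   most [T / (lambda * dx)], costs the half power of [dx] and contributes a square
   root of [T]; another one comes from the bound [K] on the profile. *)
have eY : e n j ^+ 2 <= Y ^+ 2.
  apply: le_trans en2 (le_trans (stable J e n J0 hJ e0) _).
  apply: le_trans (_ : C1 * expR x * (T / dt * (C3 * (dx ^+ (2 * i) * K ^+ 2))) <= _).
    apply: ler_pM; first by rewrite mulr_ge0 ?expR_ge0.
    - apply: sumr_ge0 => m _; rewrite /forcing !addr_ge0 ?mulr_ge0 ?sqnorm_ge0 //;
        by apply: wsum_ge0 => l _; exact: sqr_ge0.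
    - by rewrite ler_wpM2l // ler_expR.
    by apply: le_trans hsum _; rewrite ler_wpM2r.
  have -> : Y ^+ 2 = expR x * (C1 * expR x * (T / dt * (C3 * (dx ^+ (2 * i) * K ^+ 2)))).
    rewrite /Y /C4 /K !(exprMn 2) sqr_powR_half // !sqr_sqrtr ?(ltW T0) //; last first.
      by rewrite divr_ge0 ?mulr_ge0 // ltW.
    by rewrite /dt; field; rewrite !gt_eqF.
  rewrite ler_peMl //; last by have := expR_ge1Dx x; lra.
  apply: mulr_ge0; first by rewrite mulr_ge0 ?expR_ge0.
  by apply: mulr_ge0 F0; rewrite divr_ge0 ?(ltW T0) ?(ltW dt0).
have ->  : `|e n j| = Num.sqrt (e n j ^+ 2) by rewrite sqrtr_sqr.
apply: le_trans (_ : Y <= _).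
  by rewrite -[Y]ger0_norm // -sqrtr_sqr ler_wsqrtr.
have C4C : C4 <= C by rewrite /C; lra.
have C1C : C1 / lambda <= C by rewrite /C; lra.
rewrite /Y; apply: ler_wpM2r => //; apply: ler_wpM2r; first exact: powR_ge0.
apply: ler_pM; first by rewrite mulr_ge0 // ltW.
- exact: expR_ge0.
- by rewrite ler_wpM2r // ltW.
by rewrite ler_expR /x ler_wpM2r ?invr_ge0 ?(ltW L0) // ler_wpM2r // ltW.
Qed.
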